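(* Let $d\ge 2$ and let $(\omega_x : x\in\mathbb{Z}^d)$ be i.i.d. random variables taking values in a finite set $\Theta\subset\mathbb{R}$. For $n\ge 1$ let $\vec\Pi^{(n)}_{\max}$ be the (random) set of maximal paths of length $n$, i.e. the directed paths of length $n$ starting from $0$ whose weight is maximal among all directed paths of length $n$ starting from $0$. Then there exists $\delta>0$ (depending on $d$ and on the distribution of $\omega_0$) such that for every $n$ large enough, $$\mathbb{P}\big(|\vec\Pi^{(n)}_{\max}|\le 2^{\delta n}\big)\le \exp(-\delta n).$$
   Context: For $1\le i\le d$, $e_i\in\mathbb{Z}^d$ is the site with $i$-th coordinate $1$ and all other coordinates $0$. A directed path $\pi$ from $x$ to $y$ is a sequence of sites $x=\pi_1,\dots,\pi_k=y$ of $\mathbb{Z}^d$ with $\pi_{i+1}-\pi_i\in\{e_1,\dots,e_d\}$ for each $1\le i<k$; the integer $k$ (the number of sites) is called the length of $\pi$. The weight of $\pi$ is $W_\pi=\sum_{x\in\pi}\omega_x$. $|A|$ denotes the cardinality of a set $A$. *)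

(* Defs.v *)
From HB Require Import structures.
From mathcomp Require Import all_boot all_order all_algebra finmap.
From mathcomp Require Import all_classical all_reals all_analysis.

Set Implicit Arguments.
Unset Strict Implicit.
Unset Printing Implicit Defensive.

Import Order.TTheory GRing.Theory Num.Theory.

Local Open Scope classical_set_scope.
Local Open Scope ring_scope.

Definition site (d : nat) := 'rV[int]_d.

Definition step (d : nat) : rel (site d) :=
  fun x y => [exists i : 'I_d, y - x == delta_mx 0 i].

Definition directed_path (d : nat) (x y : site d) (p : seq (site d)) : Prop :=
  [/\ ohead p = Some x, last x p = y & sorted (@step d) p].

(* The length of a path is its number of sites, [size p]. *)
Definition paths0 (d n : nat) : set (seq (site d)) :=
  [set p | size p = n /\ exists y, directed_path 0 y p].

Definition weight (R : realType) (d : nat) (w : site d -> R)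
    (p : seq (site d)) : R :=
  \sum_(x <- p) w x.

Definition max_paths (R : realType) (d : nat) (w : site d -> R) (n : nat) :
    set (seq (site d)) :=
  [set p | paths0 n p /\ forall q, paths0 n q -> weight w q <= weight w p].

(* [fset_set] is the empty set on infinite sets; [finite_max_paths] below shows
   that this case never occurs here. *)
Definition nb_max_paths (R : realType) (d : nat) (w : site d -> R) (n : nat) :
    nat :=
  #|` fset_set (max_paths w n)|.

Lemma finite_sorted_step (d n : nat) (x : site d) :
  finite_set [set p : seq (site d) | size p = n /\ path (@step d) x p].
Proof.
elim: n x => [|n IHn] x.
  apply: (@sub_finite_set _ _ [set [::]]); last exact: finite_set1.
  by move=> p [/size0nil -> _].
apply: (@sub_finite_set _ _ (\bigcup_(i in [set: 'I_d])
   [set (x + delta_mx 0 i) :: q | q in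
     [set p | size p = n /\ path (@step d) (x + delta_mx 0 i) p]])).
  move=> [|y p] [] //= [sp] /andP[/existsP[i /eqP yx] pp].
  have yE : y = x + delta_mx 0 i by rewrite -yx addrC subrK.
  by exists i => //; exists p; rewrite -?yE.
apply: bigcup_finite => [|i _]; first exact: finite_finset.
exact/finite_image/IHn.
Qed.

Lemma finite_paths0 (d n : nat) : finite_set (@paths0 d n).
Proof.
apply: (@sub_finite_set _ _
  [set 0 :: q | q in [set p | size p = n.-1 /\ path (@step d) 0 p]]).
  move=> [|y p] [sp [z [//= [y0] _ pp]]].
  by subst y n; exists p.
exact/finite_image/finite_sorted_step.
Qed.

Lemma finite_max_paths (R : realType) (d : nat) (w : site d -> R) (n : nat) :
  finite_set (max_paths w n).
Proof. by apply: sub_finite_set (@finite_paths0 d n) => p []. Qed.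

Definition mutually_independent (disp : measure_display)
    (T : measurableType disp) (R : realType) (P : probability T R)
    (I : choiceType) (X : I -> {RV P >-> R}) : Prop :=
  forall (J : {fset I}) (A : I -> set R),
    (forall i, measurable (A i)) ->
    P (\bigcap_(i in [set` J]) (X i @^-1` A i)) =
      (\prod_(i <- J) P (X i @^-1` A i))%E.

Definition has_law (disp : measure_display) (T : measurableType disp)
    (R : realType) (P : probability T R) (X : {RV P >-> R})
    (mu : probability (measurableTypeR R) R) : Prop :=
  forall A : set R, measurable A -> distribution P X A = mu A.

Definition iid (disp : measure_display) (T : measurableType disp)
    (R : realType) (P : probability T R) (I : choiceType)
    (X : I -> {RV P >-> R}) (mu : probability (measurableTypeR R) R) : Prop :=
  mutually_independent X /\ forall i, has_law (X i) mu.

(* Main.v *)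
Require Import Defs.
From HB Require Import structures.
From mathcomp Require Import all_boot all_order all_algebra finmap.
From mathcomp Require Import all_classical all_reals all_analysis.
From mathcomp Require Import zify ring lra.

Set Implicit Arguments.
Unset Strict Implicit.
Unset Printing Implicit Defensive.

Import Order.TTheory GRing.Theory Num.Theory.

Local Open Scope ring_scope.

(** Cut a maximal path into pieces of a fixed length.  A piece is tied when another
    path between its endpoints is at least as heavy.  Ties in different pieces can
    be used independently, so that [k] tied pieces produce [2 ^ k] maximal paths
    ([max_words_ge]).  Hence it is enough that, up to an exponentially small
    probability, every maximal path has linearly many tied pieces.  Let [M] be the
    largest of the values that have positive probability, and call corner a change
    of direction.  If the law is degenerate all paths are maximal; assume it is not.

    Corners.  Maximal paths have linearly many corners ([few_corner_max_bound]).
    Indeed a staircase choosing at each turn the better of two sites beats the mean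
    by a linear amount, while words with few corners are so few that none of their
    weights does, by Chernoff bounds.  So a positive fraction of the pieces have many
    corners, and each of these contains either a good corner, with many values
    below [M] on both sides, or a long run of [M] ([good_corner_or_run]).

    Good corners.  Around a good corner of a maximal path, put [M] on the whole piece
    and on the opposite site of the unit square at this corner.  No path gains more
    than the modified one: this could only happen through the opposite site; a path
    visiting it and missing the piece on one side of the corner forgoes more than it
    gains there, and a path meeting the piece on both sides can be rerouted along
    it.  So the path stays maximal, and moreover the piece becomes tied for every
    path that is now maximal, which allows to locate the modification among few
    places.  When there are few ties there are many more good corners than places,
    and double counting ([local_modification]) shows that each additional tie at
    least doubles the probability ([good_corners_rare]).

    Runs.  The previous modification is useless where the path already sees only [M],
    which is typical if the sites of value [M] percolate.  There the argument is a
    first moment.  An untied word is determined by its endpoints, so that the number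
    of untied words of length [r] is at most polynomial in [r] ([count_untied]),
    whereas the expected number of those with a run of [M] of length [rho] is
    exponentially small in [rho] ([untied_run_bound], [unique_allM_bound]); since
    [r] is only a multiple of [rho], the product over the pieces of a path is
    exponentially small ([run_pieces_rare]).  The estimate for runs comes from another
    modification: at a corner of the only path of [M] between two points, put [M] on
    the opposite site and isolate it, so that all paths of [M] go on agreeing except
    at this level.

    All this takes place in a finite product space, since paths of length [n] only
    see a box of the lattice; [few_max_paths_le] transfers it to independent random
    variables. *)

(** * Elementary bounds *)

Lemma bernoulli (R : realType) (a : R) n : 0 <= a -> 1 + n%:R * a <= (1 + a) ^+ n.
Proof.
move=> a0; elim: n => [|n IH]; first by rewrite expr0 mul0r addr0.
rewrite exprS; apply: le_trans (ler_wpM2l _ IH); last lra.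
rewrite -[n.+1]addn1 natrD; have : 0 <= n%:R * (a * a) by rewrite !mulr_ge0.
by rewrite mulrA; lra.
Qed.

Lemma poly_exp (R : realType) (eps : R) k : 0 < eps ->
  exists2 C : R, 0 < C & forall n, (n.+1%:R) ^+ k <= C * (1 + eps) ^+ n.
Proof.
move=> eps0; elim: k eps eps0 => [|k IH] eps eps0.
  by exists 1 => // n; rewrite expr0 mul1r exprn_ege1 //; lra.
pose a : R := Num.min 1 (eps / 3).
have a0 : 0 < a by rewrite lt_min ltr01 /= divr_gt0.
have a1 : a <= 1 by rewrite ge_min lexx.
have a3 : a * 3 <= eps by rewrite -ler_pdivlMr // ge_min lexx orbT.
have aa : (1 + a) * (1 + a) <= 1 + eps by nra.
have [C C0 hC] := IH a a0; exists (C / a) => [|n]; first exact: divr_gt0.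
have h1 : n.+1%:R <= a^-1 * (1 + a) ^+ n.
  rewrite mulrC ler_pdivlMr //; apply: le_trans (bernoulli n (ltW a0)).
  by rewrite -addn1 natrD; lra.
rewrite exprS; apply: le_trans (ler_pM _ _ h1 (hC n)) _ => //.
rewrite [leLHS](_ : _ = (C / a) * ((1 + a) * (1 + a)) ^+ n); last by rewrite exprMn; ring.
by rewrite ler_pM2l ?divr_gt0 // lerXn2r ?nnegrE //; nra.
Qed.

(** * Words *)

Section Words.
Variable d : nat.

(** Words record the steps of directed paths of a given length. *)
Fixpoint words (L : nat) : seq (seq 'I_d) :=
  if L is L'.+1 then [seq i :: w | i <- enum 'I_d, w <- words L'] else [:: [::]].

Lemma mem_words L w : (w \in words L) = (size w == L).
Proof.
elim: L w => [|L IH] [|i w] //=; first by apply/allpairsP => -[[j u] []].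
rewrite eqSS -IH; apply/allpairsP/idP => [[[j u] /= [_ uL [_ ->]]]//|wL].
by exists (i, w); rewrite mem_enum.
Qed.

Lemma uniq_words L : uniq (words L).
Proof.
elim: L => //= L IH; apply: allpairs_uniq => //; first exact: enum_uniq.
by move=> [i u] [j w] _ _ /= [-> ->].
Qed.

Lemma size_words L : size (words L) = (d ^ L)%N.
Proof. by elim: L => //= L IH; rewrite size_allpairs IH size_enum_ord expnS. Qed.

Lemma big_wordsS (R : Type) (idx : R) (op : Monoid.law idx) L (F : seq 'I_d -> R) :
  \big[op/idx]_(w <- words L.+1) F w =
  \big[op/idx]_(i <- enum 'I_d) \big[op/idx]_(w <- words L) F (i :: w).
Proof.
by rewrite /= big_allpairs_dep.
Qed.

Lemma big_words_cat (R : Type) (idx : R) (op : Monoid.law idx) a b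
    (F : seq 'I_d -> R) :
  \big[op/idx]_(w <- words (a + b)) F w =
  \big[op/idx]_(u <- words a) \big[op/idx]_(w <- words b) F (u ++ w).
Proof.
elim: a F => [|a IH] F; first by rewrite big_seq1.
rewrite addSn !big_wordsS; apply: eq_bigr => i _.
by rewrite IH; apply: eq_bigr => u _.
Qed.

Fixpoint corners (w : seq 'I_d) : nat :=
  if w is i :: u then (if u is j :: _ then (i != j) + corners u else 0)%N else 0%N.

Lemma corners_cons2 i j w : corners [:: i, j & w] = ((i != j) + corners (j :: w))%N.
Proof. by []. Qed.

Lemma corners_size w : (corners w <= size w)%N.
Proof.
elim: w => //= i [|j u] //= IH; apply: leq_trans (leq_add (leq_b1 _) IH) _.
by rewrite addnC addn1.
Qed.

Lemma corners_cat u w : (corners (u ++ w) <= corners u + corners w + 1)%N.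
Proof.
elim: u => [|i u IH]; first by rewrite /= add0n leq_addr.
case: u IH => [|j u] /= IH.
  case: w IH => [|j w] //= _; lia.
by rewrite /= in IH *; lia.
Qed.

Lemma corners_split w : (0 < corners w)%N ->
  exists w1 i j w2, w = w1 ++ [:: i, j & w2] /\ i != j.
Proof.
elim: w => //= i [|j u] //= IH; case: eqP => [ij|/eqP ij] /=; last first.
  by move=> _; exists [::], i, j, u.
rewrite add0n => /IH [w1 [i' [j' [w2 [-> h]]]]].
by exists (i :: w1), i', j', w2.
Qed.

Lemma corners_genfun (R : realType) (z : R) L i : 0 <= z ->
  \sum_(w <- words L) z ^+ corners (i :: w) <= (1 + d%:R * z) ^+ L.
Proof.
move=> z0; elim: L i => [|L IH] i; first by rewrite big_seq1 /= !expr0.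
have a0 : 0 <= 1 + d%:R * z by rewrite addr_ge0 // mulr_ge0.
rewrite big_wordsS exprS.
have -> : \sum_(j <- enum 'I_d) \sum_(w <- words L) z ^+ corners [:: i, j & w] =
  \sum_(j <- enum 'I_d) z ^+ (i != j) * \sum_(w <- words L) z ^+ corners (j :: w).
  apply: eq_bigr => j _; rewrite big_distrr /=; apply: eq_bigr => w _.
  by rewrite -exprD.
apply: (@le_trans _ _ (\sum_(j <- enum 'I_d) z ^+ (i != j) * (1 + d%:R * z) ^+ L)).
  by apply: ler_sum => j _; rewrite ler_wpM2l // exprn_ge0.
rewrite -big_distrl /= ler_wpM2r ?exprn_ge0 //.
rewrite big_enum /= (bigD1 i) //= eqxx expr0 lerD2l.
apply: (@le_trans _ _ (\sum_(j : 'I_d) z)); last first.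
  by rewrite sumr_const card_ord mulr_natl.
rewrite [X in _ <= X](bigD1 i) //= -[leLHS]add0r lerD //.
by apply: ler_sum => j; rewrite eq_sym => ->; rewrite expr1.
Qed.

(** If each corner is given a small weight [z], the words of length [L] weigh about
    [(1 + d z) ^ L] together, while each word with at most [L / c] corners keeps a
    weight [z ^ (L / c)], which is almost [1] at exponential scale for [c] large. *)
Lemma few_corners (R : realType) (eps : R) : 0 < eps ->
  exists c : nat, (0 < c)%N /\ forall L,
   (size [seq w <- words L | (c * corners w < L)%N])%:R <= (d%:R + 1) * (1 + eps) ^+ L.
Proof.
move=> eps0; pose a : R := Num.min 1 (eps / 3).
have a0 : 0 < a by rewrite lt_min ltr01 /= divr_gt0.
have a1 : a <= 1 by rewrite ge_min lexx.
have a3 : a * 3 <= eps by rewrite -ler_pdivlMr // ge_min lexx orbT.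
have aa : (1 + a) * (1 + a) <= 1 + eps by nra.
have d0 : (0 : R) <= d%:R by [].
pose z : R := a / (d%:R + 1).
have z0 : 0 < z by rewrite divr_gt0 //; lra.
have dz : d%:R * z <= a.
  rewrite /z mulrCA ger_pMr // ler_pdivrMr; lra.
have [c hc] : exists c : nat, z^-1 <= (1 + a) ^+ c.
  have [c hc] : exists c : nat, z^-1 / a < c%:R.
    by exists (Num.bound (z^-1 / a)); apply: archi_boundP; rewrite ltW // divr_gt0 ?invr_gt0.
  exists c; apply: le_trans (bernoulli c (ltW a0)).
  by rewrite ltr_pdivrMr // in hc; lra.
exists c.+1; split => // L.
have hz w : (c.+1 * corners w < L)%N -> 1 <= z ^+ corners w * (1 + a) ^+ L.
  move=> hw; apply: (@le_trans _ _ (z ^+ corners w * (1 + a) ^+ (c.+1 * corners w))).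
    rewrite exprM -exprMn exprn_ege1 //.
    have: z * z^-1 = 1 by rewrite mulfV // gt_eqF.
    have : (1 + a) ^+ c <= (1 + a) ^+ c.+1 by rewrite ler_weXn2l //; lra.
    by move: ((1+a) ^+ c.+1) ((1 + a) ^+ c) hc => X Y; move: (z^-1) => u; nra.
  apply: ler_wpM2l; first by rewrite exprn_ge0 // ltW.
  by rewrite ler_weXn2l ?(ltnW hw) //; lra.
apply: (@le_trans _ _ (\sum_(w <- words L) z ^+ corners w * (1 + a) ^+ L)).
  rewrite -sum1_size natr_sum big_filter [leRHS](bigID (fun w => c.+1 * corners w < L)%N) /=.
  rewrite -[leLHS]addr0 lerD ?sumr_ge0 //.
    by apply: ler_sum => w; exact: hz.
  by move=> w _; rewrite mulr_ge0 // exprn_ge0 //; lra.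
rewrite -big_distrl /=.
have b0 : 0 <= 1 + a by lra.
have hs : \sum_(w <- words L) z ^+ corners w <= (d%:R + 1) * (1 + a) ^+ L.
  case: L {hz} => [|L].
    by rewrite big_seq1 /= !expr0; lra.
  rewrite big_wordsS; apply: (@le_trans _ _ (\sum_(i <- enum 'I_d) (1 + a) ^+ L)).
    apply: ler_sum => i _; apply: le_trans (corners_genfun _ _ (ltW z0)) _.
    by rewrite lerXn2r ?nnegrE //; nra.
  rewrite big_enum /= sumr_const card_ord -mulr_natl exprS.
  move: ((1 + a) ^+ L) (exprn_ge0 L b0) => X X0.
  have : 0 <= d%:R * X * a by rewrite !mulr_ge0 // ltW.
  by have : 0 <= X * a; [rewrite mulr_ge0 // ltW | nra].
apply: le_trans (ler_wpM2r _ hs) _; first by rewrite exprn_ge0.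
rewrite -mulrA ler_wpM2l ?addr_ge0 //.
have e0 : 0 <= 1 + eps by lra.
have m0 : 0 <= (1 + a) * (1 + a) by rewrite mulr_ge0.
by rewrite -exprMn lerXn2r ?nnegrE.
Qed.

End Words.

(** * Finite product measures *)

Section ProductMeasure.
Variables (R : realType) (K : finType) (p : K -> R).
Hypothesis p_gt0 : forall k, 0 < p k.
Hypothesis p_sum1 : \sum_k p k = 1.
Variable V : finType.
Implicit Types (sigma tau : {ffun V -> K}) (f g : {ffun V -> K} -> R)
  (E F : {ffun V -> K} -> Prop).

Definition mass sigma : R := \prod_x p (sigma x).
Definition Ex f : R := \sum_sigma mass sigma * f sigma.
Definition Pr E : R := Ex (fun sigma => (`[< E sigma >])%:R).

Lemma mass_gt0 sigma : 0 < mass sigma.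
Proof. by apply: prodr_gt0. Qed.

Lemma Ex_prod (h : V -> K -> R) :
  Ex (fun sigma => \prod_x h x (sigma x)) = \prod_x \sum_k p k * h x k.
Proof.
rewrite bigA_distr_bigA; apply: eq_bigr => sigma _.
by rewrite /mass -big_split.
Qed.

Lemma Ex_const c : Ex (fun=> c) = c.
Proof.
rewrite /Ex -big_distrl /= -[RHS]mul1r; congr (_ * _).
transitivity (Ex (fun sigma => \prod_(x : V) 1)).
  by apply: eq_bigr => sigma _; rewrite big1 // mulr1.
rewrite (Ex_prod (fun=> fun=> 1)) big1 // => x _.
by under eq_bigr => k _ do rewrite mulr1.
Qed.

Lemma ExD f g : Ex (fun sigma => f sigma + g sigma) = Ex f + Ex g.
Proof. by rewrite /Ex -big_split; apply: eq_bigr => s _; rewrite mulrDr. Qed.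

Lemma ExZ c f : Ex (fun sigma => c * f sigma) = c * Ex f.
Proof. by rewrite /Ex big_distrr; apply: eq_bigr => s _; rewrite mulrCA. Qed.

Lemma Ex_sum (I : Type) (r : seq I) (P : pred I) (f : I -> {ffun V -> K} -> R) :
  Ex (fun sigma => \sum_(i <- r | P i) f i sigma) = \sum_(i <- r | P i) Ex (f i).
Proof.
rewrite /Ex exchange_big /=; apply: eq_bigr => s _; by rewrite big_distrr.
Qed.

Lemma Ex_le f g : (forall sigma, f sigma <= g sigma) -> Ex f <= Ex g.
Proof. by move=> h; apply: ler_sum => s _; rewrite ler_pM2l ?mass_gt0. Qed.

Lemma eq_Ex f g : f =1 g -> Ex f = Ex g.
Proof. by move=> h; apply: eq_bigr => s _; rewrite h. Qed.

Lemma Ex_ge0 f : (forall sigma, 0 <= f sigma) -> 0 <= Ex f.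
Proof. by move=> h; rewrite -(Ex_const 0); apply: Ex_le. Qed.

Lemma markov E f : (forall sigma, 0 <= f sigma) ->
  (forall sigma, E sigma -> 1 <= f sigma) -> Pr E <= Ex f.
Proof. by move=> f0 f1; apply: Ex_le => s; case: asboolP => [/f1|_]. Qed.

Lemma Pr_ge0 E : 0 <= Pr E. Proof. by apply: Ex_ge0 => s; rewrite ler0n. Qed.

Lemma Pr_le1 E : Pr E <= 1.
Proof. by rewrite -[leRHS]Ex_const; apply: markov. Qed.

Lemma Pr_mono E F : (forall sigma, E sigma -> F sigma) -> Pr E <= Pr F.
Proof.
move=> EF; apply: markov => s; first by rewrite ler0n.
by move=> /EF h; rewrite asboolT.
Qed.

Lemma Pr_or E F : Pr (fun s => E s \/ F s) <= Pr E + Pr F.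
Proof.
rewrite -ExD; apply: markov => s; first by rewrite addr_ge0 ?ler0n.
by case=> h; rewrite (asboolT h) ?lerDl ?lerDr ler0n.
Qed.

Lemma Pr_exists (I : eqType) (r : seq I) (E : I -> {ffun V -> K} -> Prop) :
  Pr (fun s => exists2 i, i \in r & E i s) <= \sum_(i <- r) Pr (E i).
Proof.
rewrite -Ex_sum; apply: markov => s; first by rewrite sumr_ge0 // => i; rewrite ler0n.
move=> [i ir Ei]; rewrite (big_rem i) //= (asboolT Ei) lerDl.
by rewrite sumr_ge0 // => j _; rewrite ler0n.
Qed.

Lemma Ex_prod_seq (h : K -> R) (zs : seq V) : uniq zs ->
  Ex (fun sigma => \prod_(z <- zs) h (sigma z)) = (\sum_k p k * h k) ^+ size zs.
Proof.
move=> uz.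
transitivity (Ex (fun sigma => \prod_x (if x \in zs then h (sigma x) else 1))).
  by apply: eq_Ex => s; rewrite -big_mkcond big_uniq.
rewrite (Ex_prod (fun x k => if x \in zs then h k else 1)).
transitivity (\prod_(x in zs) (\sum_k p k * h k)); last first.
  by rewrite prodr_const; congr (_ ^+ _); apply/card_uniqP.
rewrite [RHS]big_mkcond; apply: eq_bigr => x _; case: ifP => // _.
by under eq_bigr => k _ do rewrite mulr1.
Qed.

Definition depends_on (A : pred V) (T : Type) (f : {ffun V -> K} -> T) :=
  forall sigma tau, (forall x, A x -> sigma x = tau x) -> f sigma = f tau.

(** Functions of disjoint sets of coordinates are independent: exchanging the
    coordinates in [A] between two independent copies preserves their joint
    law. *)
Lemma Ex_indep (A : pred V) f g : depends_on A f -> depends_on (predC A) g ->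
  Ex (fun sigma => f sigma * g sigma) = Ex f * Ex g.
Proof.
move=> fA gA.
pose mg sigma tau : {ffun V -> K} := [ffun x => if A x then sigma x else tau x].
have mgf s t : f (mg s t) = f s by apply: fA => x Ax; rewrite ffunE Ax.
have mgg s t : g (mg s t) = g t.
  by apply: gA => x /negbTE Ax; rewrite ffunE Ax.
pose sw (st : {ffun V -> K} * {ffun V -> K}) := (mg st.1 st.2, mg st.2 st.1).
have swK : involutive sw.
  by move=> [s t]; congr (_, _); apply/ffunP => x; rewrite !ffunE /=; case: (A x).
have masssw s t : mass (mg s t) * mass (mg t s) = mass s * mass t.
  rewrite /mass -!big_split; apply: eq_bigr => x _ /=.
  by rewrite !ffunE; case: (A x) => //; rewrite mulrC.
transitivity (Ex (fun sigma => f sigma * g sigma) * Ex (fun=> 1)).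
  by rewrite Ex_const mulr1.
rewrite /Ex !big_distrlr /= !pair_big /=.
rewrite (reindex_inj (can_inj swK)) /=; apply: eq_bigr => -[s t] _ /=.
rewrite mgf mgg mulr1.
transitivity ((mass (mg s t) * mass (mg t s)) * (f s * g t)); first by ring.
by rewrite masssw; ring.
Qed.

Lemma card_agree (A : {set V}) sigma :
  (#|[set tau : {ffun V -> K} | [forall x, (x \notin A) ==> (tau x == sigma x)]]|
     <= #|K| ^ #|A|)%N.
Proof.
pose h (tau : {ffun V -> K}) : {ffun {x | x \in A} -> K} := [ffun y => tau (val y)].
rewrite -[X in (_ <= _ ^ X)%N](card_sig (mem A)) -card_ffun -(@card_in_imset _ _ h).
  by apply: max_card.
move=> s t; rewrite !inE => /forallP hs /forallP ht /ffunP hst.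
apply/ffunP => x; have [xA|xA] := boolP (x \in A).
  by have := hst (exist _ x xA); rewrite !ffunE.
by have := hs x; have := ht x; rewrite xA => /eqP -> /eqP ->.
Qed.

Variable pm : R.
Hypothesis pm_gt0 : 0 < pm.
Hypothesis pm_le : forall k, pm <= p k.

Lemma pm_le1 (k : K) : pm <= 1.
Proof.
apply: le_trans (pm_le k) _; rewrite -p_sum1 (bigD1 k) //= lerDl.
by rewrite sumr_ge0 // => j _; rewrite ltW.
Qed.

Lemma p_le1 k : p k <= 1.
Proof.
rewrite -p_sum1 (bigD1 k) //= lerDl.
by rewrite sumr_ge0 // => j _; rewrite ltW.
Qed.

(** Both masses share the factors of the sites outside [A]. *)
Lemma mass_local (A : {set V}) sigma tau :
  (forall x, x \notin A -> sigma x = tau x) ->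
  pm ^+ #|A| * mass sigma <= mass tau.
Proof.
move=> h; rewrite /mass (bigID (mem A)) /= [leRHS](bigID (mem A)) /=.
rewrite mulrA; have -> : \prod_(x | x \notin A) p (tau x) = \prod_(x | x \notin A) p (sigma x).
  by apply: eq_bigr => x /h ->.
rewrite ler_pM2r ?prodr_gt0 // -[leRHS]mulr1 ler_pM ?exprn_ge0 ?(ltW pm_gt0) //.
- by rewrite prodr_ge0 // => x _; rewrite ltW.
- rewrite -prodr_const ler_prod // => x _; by rewrite (ltW pm_gt0) pm_le.
- by rewrite prodr_ile1 // => x _; rewrite (ltW (p_gt0 _)) p_le1.
Qed.

(** A multivalued map principle.  Suppose that every configuration of [E] can
    be changed at [a] different labels into configurations of [F], and that a
    configuration of [F] reveals the label up to [b] choices and, given the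
    label, a small region containing all the changed sites.  Double counting
    then compares the two probabilities. *)
Lemma local_modification (I : finType) E F (J : {ffun V -> K} -> {set I})
    (Reg : {ffun V -> K} -> I -> {set V}) (a b beta : nat) :
  (forall tau j, F tau -> j \in J tau -> (#|Reg tau j| <= beta)%N) ->
  (forall tau, F tau -> (#|J tau| <= b)%N) ->
  (forall sigma, E sigma -> exists S : {set I}, (a <= #|S|)%N /\
     forall j, j \in S -> exists tau, [/\ F tau, j \in J tau &
       forall x, x \notin Reg tau j -> sigma x = tau x]) ->
  a%:R * pm ^+ beta * Pr E <= b%:R * #|K|%:R ^+ beta * Pr F.
Proof.
move=> hReg hJ hE.
have K1 : (0 < #|K|)%N.
  rewrite lt0n; apply/eqP => /card0_eq K0; move: p_sum1; rewrite big_pred0 //.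
  by move/eqP; rewrite eq_sym oner_eq0.
pose L sigma tau j := [&& `[< F tau >], j \in J tau &
  [forall x, (x \notin Reg tau j) ==> (sigma x == tau x)]].
have count_labels sigma : E sigma -> (a <= \sum_tau \sum_j L sigma tau j)%N.
  move=> /hE [S [aS hS]]; apply: leq_trans aS _.
  rewrite exchange_big /= -sum1_card [leqRHS](bigID (mem S)) /=.
  apply: leq_trans (leq_addr _ _); apply: leq_sum => j /hS [tau [Ft jt st]].
  rewrite (bigD1 tau) //= /L (asboolT Ft) jt /=; apply: leq_trans (leq_addr _ _).
  by rewrite lt0b; apply/forallP => x; apply/implyP => /st ->.
have mass_label sigma tau j : (L sigma tau j)%:R * (pm ^+ beta * mass sigma) <=
    (L sigma tau j)%:R * mass tau.
  have [/and3P[/asboolP Ft jt /forallP st]|_] := boolP (L _ _ _); last by rewrite !mul0r.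
  rewrite !mul1r; apply: le_trans (mass_local (A := Reg tau j) _); last first.
    by move=> x xR; apply/eqP; exact: (implyP (st x)).
  rewrite ler_pM2r ?mass_gt0 // ler_wiXn2l ?(ltW pm_gt0) ?hReg //.
  by have /card_gt0P [k _] := K1; exact: pm_le1 k.
have count_preimages tau :
    (\sum_j \sum_sigma L sigma tau j <= `[< F tau >] * (b * #|K| ^ beta))%N.
  rewrite /L; case: asboolP => [Ft|_] /=; last first.
    by rewrite big1 // => j _; rewrite big1.
  rewrite mul1n; apply: leq_trans (leq_mul (hJ tau Ft) (leqnn _)).
  rewrite -sum_nat_const [leqRHS]big_mkcond /=; apply: leq_sum => j _.
  case: ifP => jt /=; last by rewrite big1.
  apply: leq_trans (leq_pexp2l K1 (hReg tau j Ft jt)).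
  apply: leq_trans (card_agree (Reg tau j) tau).
  rewrite -sum1_card [leqRHS]big_mkcond /=; apply: leq_sum => sigma _.
  by rewrite inE; case: [forall x, _].
apply: (@le_trans _ _ (\sum_sigma \sum_tau \sum_j (L sigma tau j)%:R * mass tau)).
  rewrite /Pr /Ex big_distrr /=; apply: ler_sum => sigma _.
  case: asboolP => [Es|_]; last first.
    rewrite !mulr0; do 2!apply: sumr_ge0 => ? _.
    by rewrite mulr_ge0 ?ler0n // ltW // mass_gt0.
  apply: (@le_trans _ _ (\sum_tau \sum_j (L sigma tau j)%:R * (pm ^+ beta * mass sigma))).
    have := count_labels sigma Es; rewrite -(ler_nat R) => h.
    rewrite mulr1 -mulrA; apply: le_trans (ler_wpM2r _ h) _.
      by rewrite mulr_ge0 ?exprn_ge0 ?ltW ?mass_gt0.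
    rewrite natr_sum big_distrl /=; apply: ler_sum => tau _.
    by rewrite natr_sum big_distrl.
  by apply: ler_sum => tau _; apply: ler_sum => j _.
rewrite exchange_big /= /Pr /Ex big_distrr /=; apply: ler_sum => tau _.
rewrite exchange_big /=; under eq_bigr => j _ do rewrite -big_distrl /= -natr_sum.
rewrite -big_distrl -natr_sum /= mulrCA [leLHS]mulrC ler_pM2l ?mass_gt0 //.
rewrite mulrC -natrX -!natrM ler_nat.
by have := count_preimages tau.
Qed.

(** The number of labels that suffices, per possible label of the image, to make
    [local_modification] a contraction by a factor [1 / 2]. *)
Definition halving_ratio (beta : nat) : nat :=
  Num.bound (2 * #|K|%:R ^+ beta / pm ^+ beta : R).

Lemma local_modification_half (I : finType) E F (J : {ffun V -> K} -> {set I})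
    (Reg : {ffun V -> K} -> I -> {set V}) (a b beta : nat) :
  (0 < a)%N -> (b * halving_ratio beta <= a)%N ->
  (forall tau j, F tau -> j \in J tau -> (#|Reg tau j| <= beta)%N) ->
  (forall tau, F tau -> (#|J tau| <= b)%N) ->
  (forall sigma, E sigma -> exists S : {set I}, (a <= #|S|)%N /\
     forall j, j \in S -> exists tau, [/\ F tau, j \in J tau &
       forall x, x \notin Reg tau j -> sigma x = tau x]) ->
  Pr E <= 2^-1 * Pr F.
Proof.
move=> a0 ab hReg hJ hE; have := local_modification hReg hJ hE.
have pb : 0 < pm ^+ beta by rewrite exprn_gt0.
have : 2 * #|K|%:R ^+ beta / pm ^+ beta <= (halving_ratio beta)%:R :> R.
  by apply/ltW/archi_boundP; rewrite divr_ge0 ?mulr_ge0 ?exprn_ge0 ?(ltW pm_gt0).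
rewrite ler_pdivrMr //; move: ab; rewrite -(ler_nat R) natrM.
have := Pr_ge0 F; have : 0 < a%:R :> R by rewrite ltr0n.
have b0 : 0 <= b%:R :> R by rewrite ler0n.
clear hReg hJ hE a0.
move: (Pr E) (Pr F) (#|K|%:R ^+ beta) (pm ^+ beta) pb (halving_ratio beta)%:R
  (a%:R : R) (b%:R : R) b0.
clear a b => e f k q q0 h a b b0 a0 f0 bh kh main.
have h1 : b * k * f <= a * q * (2^-1 * f).
  have : b * (2 * k) * f <= b * (h * q) * f by rewrite ler_wpM2r // ler_wpM2l.
  have : (b * h) * q * f <= a * q * f by rewrite ler_wpM2r // ler_wpM2r // ltW.
  by move=> *; nra.
have aq : 0 < a * q by rewrite mulr_gt0.
by rewrite -(ler_pM2l aq); apply: le_trans h1.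
Qed.

End ProductMeasure.

(** * Directed paths in a graded group *)

Section Lattice.
(* [lv] counts the steps of a path; this is only reliable up to level [N], because [V]
   is finite *)
Variables (d : nat) (V : finZmodType) (e : 'I_d -> V) (lv : V -> nat) (N : nat).
Hypothesis e_inj : injective e.
Hypothesis lvS : forall x i, (lv x < N)%N -> lv (x + e i) = (lv x).+1.
Implicit Types (x y z : V) (u w c q : seq 'I_d).

Definition disp w : V := \sum_(i <- w) e i.

Lemma disp_nil : disp [::] = 0. Proof. exact: big_nil. Qed.
Lemma disp_cons i w : disp (i :: w) = e i + disp w. Proof. exact: big_cons. Qed.
Lemma disp_cat u w : disp (u ++ w) = disp u + disp w. Proof. exact: big_cat. Qed.
Definition dispE := (disp_cat, disp_cons, disp_nil, addr0).

(** The starting site is left out: all paths from [0] share it, and the sites of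
    consecutive pieces are then disjoint. *)
Fixpoint sites x w : seq V :=
  if w is i :: u then x + e i :: sites (x + e i) u else [::].

Lemma size_sites x w : size (sites x w) = size w.
Proof. by elim: w x => //= i w IH x; rewrite IH. Qed.

Lemma sites_cat x u w : sites x (u ++ w) = sites x u ++ sites (x + disp u) w.
Proof.
elim: u x => [|i u IH] x /=; first by rewrite disp_nil addr0.
by rewrite IH disp_cons addrA.
Qed.

Lemma lv_disp x w : (lv x + size w <= N)%N -> lv (x + disp w) = (lv x + size w)%N.
Proof.
elim: w x => [|i w IH] x /= h; first by rewrite disp_nil addr0 addn0.
have hx : (lv x < N)%N by lia.
by rewrite disp_cons addrA IH lvS //; lia.
Qed.

Lemma sites_split x w z : z \in sites x w ->
  exists w1 i w2, w = w1 ++ i :: w2 /\ z = x + disp (rcons w1 i).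
Proof.
elim: w x => //= i w IH x; rewrite inE => /predU1P[->|/IH [w1 [j [w2 [-> ->]]]]].
  by exists [::], i, w; split => //; rewrite /= !dispE.
by exists (i :: w1), j, w2; split => //; rewrite rcons_cons disp_cons addrA.
Qed.

Lemma lv_sites x w z : (lv x + size w <= N)%N -> z \in sites x w ->
  (lv x < lv z <= lv x + size w)%N.
Proof.
move=> h /sites_split [w1 [i [w2 [ww ->]]]].
have hs := congr1 size ww; rewrite size_cat /= in hs.
by rewrite lv_disp size_rcons; lia.
Qed.

Lemma level_site x u i w z : (lv x + size (u ++ i :: w) <= N)%N ->
  z \in sites x (u ++ i :: w) -> lv z = (lv x + (size u).+1)%N -> z = x + disp u + e i.
Proof.
move=> h; have := h; rewrite size_cat /= => h'.
have lu : lv (x + disp u) = (lv x + size u)%N by rewrite lv_disp //; lia.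
have li : lv (x + disp u + e i) = (lv x + size u).+1 by rewrite lvS lu //; lia.
rewrite sites_cat mem_cat => /orP[/lv_sites|] /=; first by move=> /(_ ltac:(lia)); lia.
rewrite inE => /predU1P[-> //|/lv_sites]; rewrite li => /(_ ltac:(lia)); lia.
Qed.

Lemma uniq_sites x w : (lv x + size w <= N)%N -> uniq (sites x w).
Proof.
elim: w x => //= i w IH x h.
have li : lv (x + e i) = (lv x).+1 by rewrite lvS //; lia.
rewrite IH ?li; last by lia.
by rewrite andbT; apply/negP => /lv_sites; rewrite li => /(_ ltac:(lia)); lia.
Qed.

(** Levels count the steps, so that paths from a common level meet after equally
    many steps. *)
Lemma common_site x a y b z : lv x = lv y ->
  (lv x + size a <= N)%N -> (lv y + size b <= N)%N ->
  z \in sites x a -> z \in sites y b ->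
  exists a1 a2, [/\ a = a1 ++ a2, (0 < size a1 <= size b)%N, z = x + disp a1 &
    x + disp a1 = y + disp (take (size a1) b)].
Proof.
move=> xy ha hb /sites_split [a1 [i [a2 [aE zE]]]] /sites_split [b1 [j [b2 [bE zE']]]].
have sa := congr1 size aE; have sb := congr1 size bE; rewrite !size_cat /= in sa sb.
have := lv_disp (x := x) (w := rcons a1 i); rewrite -zE size_rcons => /(_ ltac:(lia)) l1.
have := lv_disp (x := y) (w := rcons b1 j); rewrite -zE' size_rcons => /(_ ltac:(lia)) l2.
have sab : size a1 = size b1 by lia.
exists (rcons a1 i), a2; rewrite -cats1 -catA /= cats1 size_rcons; split => //.
  by rewrite /=; lia.
rewrite -zE zE' sab bE -cat_rcons take_size_cat // size_rcons //.
Qed.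

Variables (R : realType) (K : finType) (v : K -> R).
Implicit Types (sigma tau : {ffun V -> K}).

Definition wt sigma x w : R := \sum_(z <- sites x w) v (sigma z).

Lemma wt_cat sigma x u w : wt sigma x (u ++ w) = wt sigma x u + wt sigma (x + disp u) w.
Proof. by rewrite /wt sites_cat big_cat. Qed.

Lemma wt_cons sigma x i w : wt sigma x (i :: w) = v (sigma (x + e i)) + wt sigma (x + e i) w.
Proof. exact: big_cons. Qed.

Lemma wt_local sigma tau x w : {in sites x w, sigma =1 tau} ->
  wt sigma x w = wt tau x w.
Proof. by move=> h; apply: eq_big_seq => z /h ->. Qed.

Definition is_max sigma w := forall q, size q = size w -> wt sigma 0 q <= wt sigma 0 w.

(** Untied words are the unique geodesics between their endpoints. *)
Definition tied sigma x c := exists c',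
  [/\ size c' = size c, c' <> c, disp c' = disp c & wt sigma x c <= wt sigma x c'].

Lemma tied_local sigma tau x c : (lv x + size c <= N)%N ->
  (forall z, (lv x < lv z <= lv x + size c)%N -> sigma z = tau z) ->
  tied sigma x c -> tied tau x c.
Proof.
move=> h st [c' [sc cc dc cw]]; exists c'; split => //.
have st' w : size w = size c -> wt sigma x w = wt tau x w.
  by move=> sw; apply: wt_local => z; rewrite -sw in h st => zw; apply: st (lv_sites h zw).
by rewrite -!st'.
Qed.

Variable kM : K.
Hypothesis v_max : forall k, v k <= v kM.

Definition allM sigma x w := all (fun z => sigma z == kM) (sites x w).
Definition nonM sigma x w := count (fun z => sigma z != kM) (sites x w).

Lemma wt_le_max sigma x w : wt sigma x w <= (size w)%:R * v kM.
Proof.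
rewrite -(size_sites x) mulr_natl -sum1_size -sumrMnr.
by apply: ler_sum => z _; exact: v_max.
Qed.

Lemma wt_allM sigma x w : allM sigma x w -> wt sigma x w = (size w)%:R * v kM.
Proof.
move=> /allP h; rewrite -(size_sites x) mulr_natl -sum1_size -sumrMnr.
by apply: eq_big_seq => z /h /eqP ->.
Qed.

(** * Raising a piece around a corner *)

Lemma wt_replace sigma y b1 mid mid' b2 :
  size mid = size mid' -> disp mid = disp mid' -> allM sigma (y + disp b1) mid' ->
  wt sigma y (b1 ++ mid ++ b2) <= wt sigma y (b1 ++ mid' ++ b2).
Proof.
move=> sm dm /wt_allM am; rewrite !wt_cat lerD2l dm lerD2r am -sm.
exact: wt_le_max.
Qed.

Definition raise sigma (A : {set V}) : {ffun V -> K} :=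
  [ffun z => if z \in A then kM else sigma z].

(* [m] missed sites cost more than what a single site can bring *)
Variables (g range : R) (m : nat).
Hypothesis v_gap : forall k, k != kM -> v k + g <= v kM.
Hypothesis v_range : forall k, v kM - v k <= range.
Hypothesis m_large : range < m%:R * g.

(* [c] is a piece with a corner, [v'] the opposite site of the square at this corner *)
Section RaisePiece.
Variables (sigma : {ffun V -> K}) (x : V) (c1 c2 : seq 'I_d) (i j : 'I_d).
Let c := c1 ++ [:: i, j & c2].
Let v' := x + disp c1 + e j.
Let x2 := x + disp c1 + e i + e j.
Hypothesis ij : i != j.
Hypothesis lvx : (lv x + size c <= N)%N.
Hypothesis nonM1 : (m <= nonM sigma x c1)%N.
Hypothesis nonM2 : (m <= nonM sigma x2 c2)%N.

Let sc : size c = (size c1 + (size c2).+2)%N.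
Proof. by rewrite size_cat. Qed.

Definition corner_patch : {set V} := [set z in sites x c] :|: [set v'].
Let tau := raise sigma corner_patch.
Let defect z := v kM - v (sigma z).

Lemma lv_flip_site : lv v' = (lv x + (size c1).+1)%N.
Proof.
have l1 : lv (x + disp c1) = (lv x + size c1)%N.
  by rewrite lv_disp //; move: lvx sc; clear; lia.
by rewrite lvS l1 ?addnS //; move: lvx sc; clear; lia.
Qed.

Lemma lv_corner_patch z : z \in corner_patch -> (lv x < lv z <= lv x + size c)%N.
Proof.
rewrite !inE => /orP[/(lv_sites lvx) //|/eqP ->].
by rewrite lv_flip_site; move: sc; clear; lia.
Qed.

Lemma defect_ge0 z : 0 <= defect z. Proof. by rewrite subr_ge0 v_max. Qed.

Lemma wt_gain y q : (lv y + size q <= N)%N ->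
  wt tau y q = wt sigma y q + \sum_(z in [set z in sites y q] :&: corner_patch) defect z.
Proof.
move=> /uniq_sites uq; rewrite /wt.
have -> : \sum_(z in [set z in sites y q] :&: corner_patch) defect z =
    \sum_(z <- sites y q) if z \in corner_patch then defect z else 0.
  rewrite big_uniq //= -big_mkcondr /=; apply: eq_bigl => z.
  by rewrite !inE.
rewrite -big_split; apply: eq_bigr => z _; rewrite ffunE /defect.
by case: ifP => _ /=; lra.
Qed.

Definition piece_gain := \sum_(z in [set z in sites x c]) defect z.

Lemma wt_gain_self : wt tau x c = wt sigma x c + piece_gain.
Proof.
rewrite wt_gain //; congr (_ + _); apply: eq_bigl => z.
by rewrite !inE; case: (z \in sites x c).
Qed.

Lemma wt_gain_avoid y q : (lv y + size q <= N)%N -> v' \notin sites y q ->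
  wt tau y q <= wt sigma y q + piece_gain.
Proof.
move=> hq nv; rewrite wt_gain // lerD2l.
rewrite /piece_gain [leRHS](bigID (mem [set z in sites y q])) /=.
rewrite -[leLHS]addr0 lerD ?sumr_ge0 // => [|z _]; last exact: defect_ge0.
rewrite le_eqVlt; apply/orP; left; apply/eqP; apply: eq_bigl => z; rewrite !inE.
by case: eqP => [->|_]; rewrite ?(negbTE nv) ?andbF ?orbF // andbC.
Qed.

(** The sites of [B] bring at least [m * g] to the raised path and nothing to a path
    avoiding them, which can only be compensated by the single raised site [v'], up
    to [range]. *)
Lemma wt_gain_miss y q B : (lv y + size q <= N)%N ->
  uniq B -> {subset B <= sites x c} -> (m <= count (fun z => sigma z != kM) B)%N ->
  (forall z, z \in B -> z \notin sites y q) ->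
  wt tau y q < wt sigma y q + piece_gain.
Proof.
move=> hq uB BC mB Bq; rewrite wt_gain // ltrD2l.
have hB : m%:R * g <= \sum_(z in [set z in B]) defect z.
  apply: (@le_trans _ _ (\sum_(z <- B | sigma z != kM) g)).
    rewrite big_const_seq iter_addr_0 -[leRHS]mulr_natl.
    have g0 : 0 <= g.
      have := v_range kM; rewrite subrr => r0.
      have := le_lt_trans r0 m_large.
      by case: (lerP 0 g) => // /ltW; have := ler0n R m; nra.
    by rewrite ler_wpM2r // ler_nat.
  have -> : \sum_(z in [set z in B]) defect z = \sum_(z <- B) defect z.
    by rewrite big_uniq //=; apply: eq_bigl => z; rewrite inE.
  rewrite [leRHS](bigID (fun z => sigma z != kM)) /= -[leLHS]addr0 lerD ?sumr_ge0 //.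
    by apply: ler_sum => z /v_gap; rewrite /defect; lra.
  by move=> z _; exact: defect_ge0.
have -> : piece_gain = \sum_(z in [set z in B]) defect z
    + \sum_(z in [set z in sites x c] :\: [set z in B]) defect z.
  rewrite /piece_gain (bigID (mem [set z in B])) /=; congr (_ + _); apply: eq_bigl => z.
    by rewrite !inE andbC; case: (boolP (z \in B)) => // /BC ->.
  by rewrite !inE andbC.
apply: (@le_lt_trans _ _ (range +
    \sum_(z in [set z in sites x c] :\: [set z in B]) defect z)); last first.
  by rewrite ltrD2r; exact: lt_le_trans hB.
apply: (@le_trans _ _ (defect v' + \sum_(z in [set z in sites x c] :\: [set z in B]) defect z)).
  have -> : defect v' = \sum_(z | z == v') defect z by rewrite big_pred1_eq.
  rewrite [leLHS](bigID (pred1 v')) /= lerD //.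
    rewrite [leRHS]big_mkcond [leLHS]big_mkcond; apply: ler_sum => z _ /=.
    rewrite !inE; case: (z == v'); rewrite ?andbF // andbT.
    by case: ifP => // _; exact: defect_ge0.
  rewrite [leRHS]big_mkcond [leLHS]big_mkcond; apply: ler_sum => z _ /=.
  rewrite !inE; case: (z == v'); rewrite ?andbF ?orbF ?andbT /=.
    by case: ifP => // _; exact: defect_ge0.
  case: (boolP (z \in B)) => [/Bq/negbTE -> //|_] /=.
  case: (z \in sites x c); rewrite ?andbF ?andbT //.
  by case: ifP => // _; exact: defect_ge0.
by rewrite lerD2r; exact: v_range.
Qed.

Lemma piece_allM u w1 w2 : c = u ++ w1 ++ w2 -> allM tau (x + disp u) w1.
Proof.
move=> cE; apply/allP => z zw; rewrite ffunE inE inE cE !sites_cat !mem_cat zw.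
by rewrite orbT.
Qed.

Lemma flip_allM a2 a3 a1 a4 : c1 = a1 ++ a2 -> c2 = a3 ++ a4 ->
  allM tau (x + disp a1) (a2 ++ [:: j, i & a3]).
Proof.
move=> c1E c2E; apply/allP => z; rewrite sites_cat mem_cat /= !inE.
have -> : x + disp a1 + disp a2 = x + disp c1 by rewrite c1E disp_cat addrA.
rewrite ffunE !inE /c => /orP[h|/predU1P[->|/predU1P[->|h]]].
- by rewrite c1E sites_cat mem_cat sites_cat mem_cat h !orbT.
- by rewrite eqxx orbT.
- by rewrite sites_cat mem_cat /= !inE [x + _ + e j + e i]addrAC eqxx !orbT.
- rewrite sites_cat mem_cat /= !inE c2E sites_cat mem_cat.
  by rewrite [x + _ + e i + e j]addrAC h !orbT.
Qed.

(* the piece [c] is now inside a maximal path, and [cq] will be the part of another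
   path at the same levels *)
Section Global.
Variables s1 s2 : seq 'I_d.
Hypothesis lv0 : lv 0 = 0%N.
Hypothesis xE : x = disp s1.
Hypothesis smax : is_max sigma (s1 ++ c ++ s2).
Hypothesis sN : (size (s1 ++ c ++ s2) <= N)%N.

Let lvs1 : lv (disp s1) = size s1.
Proof. by rewrite -[disp s1]add0r lv_disp lv0 // add0n; move: sN; rewrite size_cat; lia. Qed.

Lemma wt_outside q1 q2 cq : size q1 = size s1 -> size cq = size c -> size q2 = size s2 ->
  wt tau 0 q1 = wt sigma 0 q1 /\
  wt tau (disp (q1 ++ cq)) q2 = wt sigma (disp (q1 ++ cq)) q2.
Proof.
move=> e1 ec e2; have sN' := sN; rewrite size_cat (size_cat c) in sN'.
have hA z : (lv z <= size s1)%N || (size s1 + size c < lv z)%N -> tau z = sigma z.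
  rewrite ffunE; case: ifP => // /lv_corner_patch; rewrite xE lvs1; lia.
split; apply: wt_local => z /lv_sites.
  by rewrite lv0 => /(_ ltac:(lia)) h; apply: hA; lia.
rewrite -[disp _]add0r lv_disp; last by rewrite lv0 size_cat; lia.
rewrite lv0 size_cat add0n.
by move=> /(_ ltac:(lia)) h; apply: hA; lia.
Qed.

Lemma wt_cat3 sg w1 w2 w3 : wt sg 0 (w1 ++ w2 ++ w3) =
  wt sg 0 w1 + wt sg (disp w1) w2 + wt sg (disp (w1 ++ w2)) w3.
Proof. by rewrite !wt_cat add0r disp_cat addrA. Qed.

Lemma wt_gain_s : wt tau 0 (s1 ++ c ++ s2) = wt sigma 0 (s1 ++ c ++ s2) + piece_gain.
Proof.
have [h1 h2] := @wt_outside s1 s2 c erefl erefl erefl.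
by rewrite (wt_cat3 tau) (wt_cat3 sigma) h1 h2 -xE wt_gain_self; lra.
Qed.

Lemma gain_transfer q1 cq q2 : size q1 = size s1 -> size cq = size c ->
  size q2 = size s2 ->
  (wt tau (disp q1) cq <= wt sigma (disp q1) cq + piece_gain ->
   wt tau 0 (q1 ++ cq ++ q2) <= wt tau 0 (s1 ++ c ++ s2)) /\
  (wt tau (disp q1) cq < wt sigma (disp q1) cq + piece_gain ->
   wt tau 0 (q1 ++ cq ++ q2) < wt tau 0 (s1 ++ c ++ s2)).
Proof.
move=> e1 ec e2; have [h1 h2] := wt_outside e1 ec e2.
have := @smax (q1 ++ cq ++ q2); rewrite wt_gain_s.
have -> : size (q1 ++ cq ++ q2) = size (s1 ++ c ++ s2).
  by rewrite size_cat [in RHS]size_cat (size_cat c) (size_cat cq) e1 ec e2.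
move=> /(_ erefl); rewrite (wt_cat3 tau q1) (wt_cat3 sigma q1) h1 h2.
by split; lra.
Qed.

Variables q1 cq q2 : seq 'I_d.
Hypothesis e1 : size q1 = size s1.
Hypothesis ec : size cq = size c.
Hypothesis e2 : size q2 = size s2.
Let y := disp q1.

Let lvy : lv y = lv x.
Proof.
by rewrite xE lvs1 /y -[disp q1]add0r lv_disp lv0 // add0n e1; move: sN; rewrite size_cat; lia.
Qed.

Let hcq : (lv y + size cq <= N)%N. Proof. by rewrite lvy ec. Qed.

(** [cq] meets the piece before the corner, after [a1], and after it, after [a3]. *)
Definition straddles := exists a1 a2 a3 a4 b1 mid b4,
  [/\ c1 = a1 ++ a2, c2 = a3 ++ a4, cq = b1 ++ mid ++ b4 & size mid = (size a2 + (size a3).+2)%N]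
  /\ [/\ x + disp a1 = y + disp b1, disp mid = disp (a2 ++ [:: i, j & a3]),
   size b1 = size a1 & (exists2 z, z \in sites x c & z \in sites y cq)].

Lemma miss_or_straddle :
  wt tau y cq < wt sigma y cq + piece_gain \/ straddles.
Proof.
have l2 : lv x2 = (lv x + (size c1).+2)%N.
  by rewrite lvS (lv_disp, lvS) ?lv_disp //; lia.
have u1 : uniq (sites x c1) by apply: uniq_sites; lia.
have u2 : uniq (sites x2 c2) by apply: uniq_sites; rewrite l2; lia.
have sub1 : {subset sites x c1 <= sites x c}.
  by move=> z zc; rewrite sites_cat mem_cat zc.
have sub2 : {subset sites x2 c2 <= sites x c}.
  by move=> z zc; rewrite sites_cat mem_cat /= !inE zc !orbT.
have [/hasP [z1 z1c z1q]|/hasPn h1] := boolP (has (mem (sites y cq)) (sites x c1)); last first.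
  by left; apply: (wt_gain_miss _ u1).
have [/hasP [z2 z2c z2q]|/hasPn h2] := boolP (has (mem (sites y cq)) (sites x2 c2)); last first.
  by left; apply: (wt_gain_miss _ u2).
right.
have ha1 : (lv x + size c1 <= N)%N by move: lvx sc; clear; lia.
have [a1 [a2 [c1E sa1 z1E d1]]] := common_site (esym lvy) ha1 hcq z1c z1q.
have z2c' : z2 \in sites x c by exact: sub2.
have [p1 [p2 [cE sp1 z2E d2]]] := common_site (esym lvy) lvx hcq z2c' z2q.
have lz2 : lv z2 = (lv x + size p1)%N.
  by rewrite z2E lv_disp //; move: lvx (congr1 size cE); rewrite size_cat; clear; lia.
have hx2 : (lv x2 + size c2 <= N)%N by rewrite l2; move: lvx sc; clear; lia.
have := lv_sites hx2 z2c; rewrite l2 lz2 => sp1'.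
pose t := (size p1 - size c1 - 2)%N.
have p1E : p1 = c1 ++ [:: i, j & take t c2].
  have -> : p1 = take (size p1) c by rewrite cE take_size_cat.
  rewrite take_cat ltnNge ifN; last by move: sp1'; clear; lia.
  by have -> : (size p1 - size c1 = t.+2)%N by rewrite /t; move: sp1'; clear; lia.
have sa : size c1 = (size a1 + size a2)%N by rewrite c1E size_cat.
pose bb := take (size p1) cq.
exists a1, a2, (take t c2), (drop t c2), (take (size a1) cq), (drop (size a1) bb),
  (drop (size p1) cq).
have tb : take (size a1) cq = take (size a1) bb by rewrite take_takel //; move: sa sp1'; clear; lia.
have st : size p1 = (size c1 + (size (take t c2)).+2)%N by rewrite p1E size_cat.
have sbb : size bb = size p1 by rewrite size_takel //; move: sp1 sa1; clear; lia.
split; split => //.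
- by rewrite cat_take_drop.
- by rewrite tb catA cat_take_drop cat_take_drop.
- by rewrite size_drop sbb; move: sa st; clear; lia.
- apply: (addrI (x + disp a1)); rewrite {1}d1 tb -!addrA -!disp_cat cat_take_drop.
  by rewrite catA -c1E -p1E d2 disp_cat.
- by rewrite size_takel //; move: sp1 sa1; clear; lia.
- by exists z2.
Qed.

Lemma straddle_replace a1 a2 a3 b1 mid b4 w :
  size mid = (size a2 + (size a3).+2)%N ->
  x + disp a1 = y + disp b1 -> disp mid = disp (a2 ++ [:: i, j & a3]) ->
  size w = (size a2 + (size a3).+2)%N -> disp w = disp (a2 ++ [:: i, j & a3]) ->
  allM tau (x + disp a1) w ->
  [/\ size (b1 ++ w ++ b4) = size (b1 ++ mid ++ b4),
   disp (b1 ++ w ++ b4) = disp (b1 ++ mid ++ b4) &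
   wt tau y (b1 ++ mid ++ b4) <= wt tau y (b1 ++ w ++ b4)].
Proof.
move=> sm d1 dm sw dw aw; split.
- by rewrite !size_cat sm sw.
- by rewrite !disp_cat dm dw.
- by apply: wt_replace; rewrite ?sm ?sw ?dm ?dw // -d1.
Qed.

Lemma mid_allM a1 a2 a3 a4 : c1 = a1 ++ a2 -> c2 = a3 ++ a4 ->
  allM tau (x + disp a1) (a2 ++ [:: i, j & a3]).
Proof.
move=> c1E c2E; apply: (@piece_allM _ _ a4).
by rewrite /c c1E c2E -!catA.
Qed.

(** A path through [v'] which does not gain less than the piece meets it on both sides
    of the corner; following the piece in between does not decrease its weight and
    makes it avoid [v']. *)
Lemma raise_is_max : wt tau 0 (q1 ++ cq ++ q2) <= wt tau 0 (s1 ++ c ++ s2).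
Proof.
have [[]|] := miss_or_straddle.
  by have [_ h] := gain_transfer e1 ec e2 => /h/ltW.
have [hav|hv] := boolP (v' \in sites y cq); last first.
  by have [h _] := gain_transfer e1 ec e2 => _; apply/h/wt_gain_avoid.
move=> [a1 [a2 [a3 [a4 [b1 [mid [b4 [[c1E c2E cqE sm] [d1 dm sb _]]]]]]]]].
have [] := straddle_replace b4 sm d1 dm _ erefl (mid_allM c1E c2E).
  by rewrite size_cat.
rewrite -cqE; set cq' := b1 ++ _ => sc' dc' wc'.
apply: (@le_trans _ _ (wt tau 0 (q1 ++ cq' ++ q2))).
  by rewrite (wt_cat3 tau q1 cq) (wt_cat3 tau q1 cq') !(disp_cat q1) dc' lerD2r lerD2l.
have [h _] := gain_transfer e1 (etrans sc' ec) e2; apply/h/wt_gain_avoid.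
  by rewrite sc'.
have hcq' : (lv y + size cq' <= N)%N by rewrite sc'.
have cqE' : cq' = (b1 ++ a2) ++ i :: j :: a3 ++ b4 by rewrite /cq' -!catA.
apply/negP => hv; move: hcq' hv; rewrite cqE' => hcq' hv.
have := level_site hcq' hv; rewrite lv_flip_site lvy => /(_ _)/=.
rewrite size_cat sb c1E size_cat => /(_ erefl).
rewrite disp_cat addrA -d1 -[x + disp a1 + _]addrA -disp_cat -c1E /v' => /addrI/e_inj ji.
by move: ij; rewrite ji eqxx.
Qed.

(** A path which remains maximal cannot gain less than the piece, so it meets it on
    both sides of the corner.  In between it can follow the piece, or its flip at the
    corner, and one of these two detours is a different path. *)
Lemma raise_tied :
  wt tau 0 (s1 ++ c ++ s2) <= wt tau 0 (q1 ++ cq ++ q2) ->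
  tied tau y cq /\ exists2 z, z \in sites x c & z \in sites y cq.
Proof.
move=> qs; have [h|] := miss_or_straddle.
  have [_ /(_ h)] := gain_transfer e1 ec e2.
  by rewrite ltNge qs.
move=> [a1 [a2 [a3 [a4 [b1 [mid [b4 [[c1E c2E cqE sm] [d1 dm sb hz]]]]]]]]]; split => //.
have [] := straddle_replace b4 sm d1 dm _ erefl (mid_allM c1E c2E).
  by rewrite size_cat.
have [] := straddle_replace b4 sm d1 dm _ _ (flip_allM c1E c2E).
- by rewrite size_cat.
- by rewrite !disp_cat !disp_cons [e j + _]addrCA.
rewrite -cqE => sA dA wA sB dB wB.
have [E|/eqP nE] := eqVneq (b1 ++ (a2 ++ [:: i, j & a3]) ++ b4) cq; last first.
  by exists (b1 ++ (a2 ++ [:: i, j & a3]) ++ b4).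
exists (b1 ++ (a2 ++ [:: j, i & a3]) ++ b4); split => //.
rewrite -E; move/eqP; rewrite eqseq_cat // eqxx /= -!catA eqseq_cat // eqxx /=.
by rewrite eqseq_cons => /andP[/eqP ji _]; move: ij; rewrite ji eqxx.
Qed.

End Global.
End RaisePiece.

(** * Cutting a path into pieces *)

Definition start r w j := disp (take (j * r) w).
Definition piece r w j := take r (drop (j * r) w).

Definition good_corner sigma x c := exists c1 i j c2,
  [/\ c = c1 ++ [:: i, j & c2], i != j, (m <= nonM sigma x c1)%N &
      (m <= nonM sigma (x + disp c1 + e i + e j)%R c2)%N].

Lemma nonM_local sigma tau x c : {in sites x c, sigma =1 tau} ->
  nonM sigma x c = nonM tau x c.
Proof. by move=> h; apply: eq_in_count => z /h ->. Qed.

Lemma good_corner_local sigma tau x c : {in sites x c, sigma =1 tau} ->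
  good_corner sigma x c -> good_corner tau x c.
Proof.
move=> h [c1 [i [j [c2 [cE ij h1 h2]]]]]; exists c1, i, j, c2; split => //.
  by rewrite -(@nonM_local sigma) // => z zc; apply: h; rewrite cE sites_cat mem_cat zc.
rewrite -(@nonM_local sigma) // => z zc; apply: h; rewrite cE sites_cat mem_cat /= !inE.
by rewrite zc !orbT.
Qed.

Definition short_words b : seq (seq 'I_d) := flatten [seq words d t | t <- iota 0 b.+1].

Lemma mem_short_words b w : (w \in short_words b) = (size w <= b)%N.
Proof.
apply/flatten_mapP/idP => [[t]|wb].
  by rewrite mem_iota mem_words => + /eqP ->.
by exists (size w); rewrite ?mem_iota ?mem_words.
Qed.

Definition ball b x : {set V} :=
  [set z in [seq x + disp u - disp w | u <- short_words b, w <- short_words b]].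

Definition ball_size b : nat := (size (short_words b) * size (short_words b))%N.

Lemma card_ball b x : (#|ball b x| <= ball_size b)%N.
Proof. by rewrite cardsE; apply: leq_trans (card_size _) _; rewrite size_allpairs. Qed.

Lemma mem_ball b x u w : (size u <= b)%N -> (size w <= b)%N ->
  x + disp u - disp w \in ball b x.
Proof.
by move=> ub wb; rewrite inE; apply/allpairsP; exists (u, w); rewrite !mem_short_words.
Qed.

Lemma corner_patch_disp x c1 i j c2 z : z \in corner_patch x c1 c2 i j ->
  exists2 w, (size w <= size (c1 ++ [:: i, j & c2]))%N & z = x + disp w.
Proof.
rewrite !inE => /orP[/sites_split [w1 [k [w2 [-> ->]]]]|/eqP ->].
  by exists (rcons w1 k); rewrite // size_rcons size_cat /=; clear; lia.
exists (rcons c1 j); first by rewrite size_rcons size_cat /=; clear; lia.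
by rewrite -cats1 !dispE addrA.
Qed.

Hypothesis lv0 : lv 0 = 0%N.

Lemma lv_start r w j : (j * r <= size w)%N -> (size w <= N)%N ->
  lv (start r w j) = (j * r)%N.
Proof.
move=> h1 h2; have st : size (take (j * r) w) = (j * r)%N by rewrite size_takel.
by rewrite -[start r w j]add0r lv_disp lv0 st //; move: h1 h2; clear; lia.
Qed.

Lemma size_piece r mm w j : (mm * r <= size w)%N -> (j < mm)%N -> size (piece r w j) = r.
Proof. by move=> h1 h2; rewrite size_takel // size_drop; move: h1 h2; clear; nia. Qed.

Lemma cat_piece r w j :
  w = take (j * r) w ++ piece r w j ++ drop r (drop (j * r) w).
Proof. by rewrite /piece !cat_take_drop. Qed.

(** The properties of the raised configuration that matter for double counting: it
    agrees with [sigma] at the levels of the other pieces, and any path [q] that is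
    maximal for it reveals the place of the modification, by a tie of [q], and its
    region, by the position of [q]. *)
Lemma raise_good_corner sigma s r mm j :
  is_max sigma s -> (size s <= N)%N -> (mm * r <= size s)%N -> (j < mm)%N ->
  good_corner sigma (start r s j) (piece r s j) ->
  exists tau, [/\ is_max tau s,
    (forall z, ~~ (j * r < lv z <= j * r + r)%N -> tau z = sigma z) &
    forall q, size q = size s -> is_max tau q ->
      tied tau (start r q j) (piece r q j) /\
      forall z, z \notin ball (2 * r) (start r q j) -> sigma z = tau z].
Proof.
move=> smax sN hmm hj [c1 [i [k [c2 [cE ik n1 n2]]]]].
have hjr : (j * r + r <= size s)%N by nia.
have lvs : lv (start r s j) = (j * r)%N by rewrite lv_start //; lia.
have sc : size (c1 ++ [:: i, k & c2]) = r by rewrite -cE (size_piece hmm hj).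
have hx : (lv (start r s j) + size (c1 ++ [:: i, k & c2]) <= N)%N by rewrite lvs sc; lia.
have sE := cat_piece r s j; rewrite cE in sE.
move: (smax) (sN); rewrite {1 2}sE => smax' sN'.
pose tau := raise sigma (corner_patch (start r s j) c1 c2 i k).
have dec q : size q = size s -> [/\ size (take (j * r) q) = size (take (j * r) s),
    size (piece r q j) = size (c1 ++ [:: i, k & c2]) &
    size (drop r (drop (j * r) q)) = size (drop r (drop (j * r) s))].
  move=> sq; split; last by rewrite !size_drop sq.
    by rewrite !size_takel; lia.
  by rewrite sc (@size_piece _ mm) // sq.
have tmax : is_max tau s.
  move=> q sq; have [e1 ec e2] := dec q sq.
  rewrite {1}(cat_piece r q j) {1}sE.
  exact: (raise_is_max ik hx n1 n2 lv0 erefl smax' sN' e1 ec e2).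
exists tau; split => // [z hz|q sq qmax].
  rewrite ffunE; case: ifP => // /(lv_corner_patch hx).
  by rewrite lvs sc => h; move: hz; rewrite h.
have [e1 ec e2] := dec q sq.
have := @qmax s (esym sq); rewrite {1}(cat_piece r q j) {1}sE => qs.
have [tq [z zs zq]] := raise_tied ik hx n1 n2 lv0 erefl smax' sN' e1 ec e2 qs.
split => // u uB; rewrite ffunE; case: ifP => // /corner_patch_disp [w sw uE].
case/negP: uB; rewrite uE.
have lvq : lv (start r q j) = lv (start r s j) by rewrite !lv_start ?sq //; lia.
have hq : (lv (start r q j) + size (piece r q j) <= N)%N by rewrite lvq ec.
have [a1 [a2 [aE sa zE dE]]] := common_site (esym lvq) hx hq zs zq.
have -> : start r s j + disp w =
    start r q j + disp (take (size a1) (piece r q j) ++ w) - disp a1.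
  by rewrite disp_cat addrA -dE [RHS]addrAC addrK.
have sa1 : (size a1 <= r)%N by rewrite -sc aE size_cat; lia.
apply: mem_ball; last by lia.
rewrite sc in sw; rewrite size_cat size_takel; last by case/andP: sa.
by move: sw sa1; clear; lia.
Qed.


Variables (p : K -> R) (pm : R).
Hypothesis p_gt0 : forall k, 0 < p k.
Hypothesis p_sum1 : \sum_k p k = 1.
Hypothesis pm_gt0 : 0 < pm.
Hypothesis pm_le : forall k, pm <= p k.

Section GoodCorners.
Variables (L r mm t0 a0 : nat).
Hypothesis LN : (L <= N)%N.
Hypothesis mmL : (mm * r <= L)%N.

Definition tied_pieces sigma w : {set 'I_mm} :=
  [set j : 'I_mm | `[< tied sigma (start r w j) (piece r w j) >]].
Definition good_pieces sigma w : {set 'I_mm} :=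
  [set j : 'I_mm | `[< good_corner sigma (start r w j) (piece r w j) >]].

Let spec n sigma w := [/\ size w = L, is_max sigma w,
  (#|tied_pieces sigma w| <= t0 + n)%N & (a0 <= #|good_pieces sigma w| + n)%N].
Let event n sigma := exists w, spec n sigma w.

Lemma piece_sites w (j : 'I_mm) z : size w = L ->
  z \in sites (start r w j) (piece r w j) -> (j * r < lv z <= j * r + r)%N.
Proof.
move=> sw; have jm := ltn_ord j.
have hj : (j * r + r <= L)%N by move: mmL jm; clear; nia.
have lvs : lv (start r w j) = (j * r)%N by rewrite lv_start ?sw //; move: hj; clear; lia.
have sp : size (piece r w j) = r by apply: (size_piece _ jm); rewrite sw.
have hN : (lv (start r w j) + size (piece r w j) <= N)%N.
  by rewrite lvs sp; move: hj LN; clear; lia.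
by move=> zs; have := lv_sites hN zs; rewrite lvs sp.
Qed.

(** Each good piece gives a modified configuration with at most one more tie and at
    most one less good piece, and the modified piece is one of the ties of any
    maximal path. *)
Lemma good_corners_step n : (0 < a0 - n)%N ->
  ((t0 + n.+1) * halving_ratio K pm (ball_size (2 * r)) <= a0 - n)%N ->
  Pr p (event n) <= 2^-1 * Pr p (event n.+1).
Proof.
move=> h0 hh.
pose q tau := xget [::] [set w | spec n.+1 tau w].
have qP tau : event n.+1 tau -> spec n.+1 tau (q tau).
  exact: (@xgetPex _ [::] [set w | spec n.+1 tau w]).
apply: (local_modification_half p_gt0 p_sum1 pm_gt0 pm_le
  (J := fun tau => tied_pieces tau (q tau))
  (Reg := fun tau (j : 'I_mm) => ball (2 * r) (start r (q tau) j)) h0 hh).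
- by move=> tau j _ _; exact: card_ball.
- by move=> tau /qP [].
move=> sigma [w [sw wmax wt wa]]; exists (good_pieces sigma w); split.
  by rewrite leq_subLR addnC.
move=> j; rewrite inE => /asboolP gj.
have sN : (size w <= N)%N by rewrite sw.
have smm : (mm * r <= size w)%N by rewrite sw.
have [tau [tmax out qs]] := raise_good_corner wmax sN smm (ltn_ord j) gj.
have other (k : 'I_mm) : k != j -> {in sites (start r w k) (piece r w k), sigma =1 tau}.
  move=> kj z /(piece_sites sw) hz; rewrite out //; apply/negP => hz'.
  have : (k : nat) != j by [].
  by move: hz hz'; clear; case: (ltngtP k j) => // kj; nia.
have ev : event n.+1 tau.
  exists w; split => //.
    apply: (@leq_trans #|j |: tied_pieces sigma w|); last first.
      by rewrite cardsU1; move: wt; clear; case: (_ \notin _); lia.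
    apply/subset_leq_card/fintype.subsetP => k; rewrite !inE.
    case: eqVneq => //= kj tk; apply/asboolP;
    have lvk : lv (start r w k) = (k * r)%N.
      by rewrite lv_start //; move: (ltn_ord k) smm; clear; nia.
    have sk : size (piece r w k) = r by exact: size_piece smm _.
    apply: (@tied_local tau sigma _ _ _ _ tk); rewrite ?lvk ?sk.
      by move: (ltn_ord k) smm sN; clear; nia.
    move=> z hz; apply: out; apply/negP => hz'.
    have : (k : nat) != j by [].
    by move: hz hz'; clear; case: (ltngtP k j) => // kj; nia.
  apply: (@leq_trans (#|good_pieces tau w :|: [set j]| + n)); last first.
    have := (leq_card_setU (good_pieces tau w) [set j]).1.
    by rewrite cards1; clear; lia.
  apply: leq_trans wa _; rewrite leq_add2r; apply/subset_leq_card/fintype.subsetP => k.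
  rewrite !inE orbC; case: eqVneq => //= kj gk; apply/asboolP;
  by apply: good_corner_local gk; exact: other.
have [sq qmax _ _] := qP tau ev.
have [tq zq] := qs (q tau) (etrans sq (esym sw)) qmax.
by exists tau; split => //; rewrite inE; apply/asboolP.
Qed.

(** As long as good pieces outnumber ties by a large factor, one more tie at least
    doubles the probability. *)
Lemma good_corners_rare : (t0 <= a0)%N ->
  forall n0, ((t0 + n0) * (halving_ratio K pm (ball_size (2 * r))).+1 < a0)%N ->
  Pr p (fun sigma => exists w, [/\ size w = L, is_max sigma w,
    (#|tied_pieces sigma w| <= t0)%N & (a0 <= #|good_pieces sigma w|)%N])
  <= (2^-1) ^+ n0.
Proof.
move=> ta n0 h.
have h1 n : (n <= n0)%N -> Pr p (event (n0 - n)) <= (2^-1) ^+ n.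
  elim: n => [|n IH] hn; first by rewrite expr0 Pr_le1.
  have [h2 h3] : (0 < a0 - (n0 - n.+1) /\ (t0 + (n0 - n.+1).+1) *
      halving_ratio K pm (ball_size (2 * r)) <= a0 - (n0 - n.+1))%N.
    by move: h hn; clear; move: (halving_ratio _ _ _) => G; nia.
  apply: le_trans (good_corners_step h2 h3) _.
  have -> : (n0 - n.+1).+1 = (n0 - n)%N by move: hn; clear; lia.
  by rewrite exprS ler_pM2l ?invr_gt0 // IH // ltnW.
have := h1 n0 (leqnn _); rewrite subnn; apply: le_trans.
by apply: Pr_mono => // sigma [w [sw wmax wt wa]]; exists w; split; rewrite ?addn0.
Qed.

End GoodCorners.

(** * Unique paths of maximal sites *)

Lemma corner_levels w : exists S : seq nat,
  [/\ uniq S, size S = corners w & forall k, k \in S ->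
    exists w1 i j w2, [/\ w = w1 ++ [:: i, j & w2], i != j & k = (size w1).+1]].
Proof.
elim: w => [|i [|j u] IH]; [by exists [::]|by exists [::]|].
have [S [uS sS hS]] := IH.
have hS' k : k \in [seq k.+1 | k <- S] -> exists w1 a b w2,
    [/\ [:: i, j & u] = w1 ++ [:: a, b & w2], a != b & k = (size w1).+1] /\ (1 < k)%N.
  case/mapP => l lS ->; have [w1 [a [b [w2 [-> ab ->]]]]] := hS l lS.
  by exists (i :: w1), a, b, w2.
have uS' : uniq [seq k.+1 | k <- S] by rewrite map_inj_uniq // => a b [].
have hS'' k : k \in [seq k.+1 | k <- S] -> exists w1 a b w2,
    [/\ [:: i, j & u] = w1 ++ [:: a, b & w2], a != b & k = (size w1).+1].
  by case/hS' => w1 [a [b [w2 [h _]]]]; exists w1, a, b, w2.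
rewrite corners_cons2; have [ij|ij] := eqVneq i j.
  by exists [seq k.+1 | k <- S]; rewrite size_map.
exists (1%N :: [seq k.+1 | k <- S]); split => /=; last 1 first.
- by move=> k; rewrite inE => /predU1P[->|/hS'' //]; exists [::], i, j, u.
- by rewrite uS' andbT; apply/negP => /hS' [? [? [? [? [_]]]]].
- by rewrite size_map sS.
Qed.

Lemma site_take x w z : (lv x + size w <= N)%N -> z \in sites x w ->
  z = x + disp (take (lv z - lv x) w).
Proof.
move=> h /sites_split [w1 [i [w2 [wE zE]]]].
have hs := congr1 size wE; rewrite size_cat /= in hs.
have -> : lv z = (lv x + (size w1).+1)%N.
  by rewrite zE lv_disp size_rcons //; move: h hs; clear; lia.
by rewrite addKn wE -cat_rcons take_size_cat ?size_rcons.
Qed.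

Section MaximalPaths.
Variables (x : V) (rho : nat) (Z : V) (k0 : K).
Hypothesis hrho : (lv x + rho < N)%N.
Hypothesis k0M : k0 != kM.

Definition Mpath sigma w := [/\ size w = rho, disp w = Z & allM sigma x w].

(** The levels at which the paths of [M] from [x] to [x + Z] do not all agree. *)
Definition split_levels sigma : {set 'I_rho.+1} :=
  [set k : 'I_rho.+1 | `[< exists w w', [/\ Mpath sigma w, Mpath sigma w' &
     disp (take k w) <> disp (take k w')] >]].

Section Flip.
Variables (sigma : {ffun V -> K}) (w1 w2 : seq 'I_d) (i j : 'I_d).
Let w := w1 ++ [:: i, j & w2].
Hypothesis ij : i != j.
Hypothesis wM : Mpath sigma w.
Let x0 := x + disp w1.
Let v1 := x0 + e i.
Let v2 := x0 + e j.
Let y0 := x0 + e i + e j.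

(** The neighbours of [v2] other than [x0] and [y0], which it shares with the path:
    once they are not maximal, a path of [M] through [v2] follows [x0], [v2], [y0]. *)
Definition isolated z := ((z != x0) && [exists l, z + e l == v2])
  || ((z != y0) && [exists l, z == v2 + e l]).
Definition isolate : {ffun V -> K} :=
  [ffun z => if z == v2 then kM else if isolated z then k0 else sigma z].
Let tau := isolate.

Let sw : size w = rho. Proof. by case: wM. Qed.
Let sw12 : rho = (size w1 + (size w2).+2)%N. Proof. by rewrite -sw size_cat. Qed.
Let hw : (lv x + size w <= N)%N. Proof. by rewrite sw ltnW. Qed.

Let lvx0 : lv x0 = (lv x + size w1)%N.
Proof. by rewrite lv_disp //; move: hrho sw12; clear; lia. Qed.
Let lvv l : lv (x0 + e l) = (lv x + (size w1).+1)%N.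
Proof. by rewrite lvS lvx0 ?addnS //; move: hrho sw12; clear; lia. Qed.
Let lvy l l' : lv (x0 + e l + e l') = (lv x + (size w1).+2)%N.
Proof. by rewrite lvS lvv ?addnS //; move: hrho sw12; clear; lia. Qed.

Lemma path_not_isolated z : z \in sites x w -> isolated z = false.
Proof.
move=> zw; have hz := lv_sites hw zw; have zE := site_take hw zw.
apply/negbTE/negP => /orP[/andP[zx0 /existsP [l /eqP zl]]|/andP[zy0 /existsP [l /eqP zl]]].
  have lz : lv z = (lv x + size w1)%N.
    have lzN : (lv z < N)%N by move: hz hrho; rewrite sw; clear; lia.
    by have := lvS l lzN; rewrite zl lvv; clear; lia.
  by case/eqP: zx0; rewrite zE lz addKn take_size_cat.
have lz : lv z = (lv x + (size w1).+2)%N by rewrite zl lvy.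
case/eqP: zy0; rewrite zE lz addKn /w -cat1s -(cat1s j) !catA take_size_cat.
  by rewrite !dispE !addrA.
by rewrite !size_cat /= addn1 addn1.
Qed.

Lemma isolate_on_path z : z \in sites x w -> tau z = kM.
Proof.
move=> zw; rewrite ffunE path_not_isolated //; case: eqP => // _.
by case: wM => _ _ /allP /(_ z zw) /eqP.
Qed.

Lemma Mpath_isolate : Mpath tau w.
Proof.
by case: wM => h1 h2 _; split => //; apply/allP => z /isolate_on_path ->.
Qed.

Lemma Mpath_flip : Mpath tau (w1 ++ [:: j, i & w2]).
Proof.
case: wM => h1 h2 _; split.
- by rewrite -h1 !size_cat.
- by rewrite -h2 !dispE [e j + _]addrCA.
apply/allP => z; rewrite sites_cat mem_cat /= !inE -/x0 [x0 + e j + e i]addrAC.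
move=> /orP[h|/predU1P[->|h]]; last 2 first.
- by rewrite ffunE eqxx.
- by rewrite isolate_on_path // sites_cat mem_cat /= !inE h !orbT.
- by rewrite isolate_on_path // sites_cat mem_cat h.
Qed.

(** A path of [M] for the new configuration through [v2] is forced to come from [x0]
    and to leave to [y0], so that it could as well use [v1]; a path avoiding [v2]
    only sees sites that were already maximal. *)
Lemma Mpath_unflip q : Mpath tau q ->
  (v2 \notin sites x q /\ Mpath sigma q) \/
  exists q1 q2, [/\ q = q1 ++ [:: j, i & q2], size q1 = size w1, disp q1 = disp w1 &
    Mpath sigma (q1 ++ [:: i, j & q2])].
Proof.
move=> [sq dq qM].
have hq : (lv x + size q <= N)%N by rewrite sq ltnW.
have qtau z : z \in sites x q -> z != v2 -> sigma z = kM /\ isolated z = false.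
  move=> zq zv; move/allP/(_ z zq): qM; rewrite ffunE (negbTE zv).
  case: ifP => [_|]; first by rewrite (negbTE k0M).
  by move=> _ /eqP.
have [v2q|v2q] := boolP (v2 \in sites x q); last first.
  left; split => //; split => //; apply/allP => z zq.
  have zv : z != v2 by apply: contraNneq v2q => <-.
  by have [-> _] := qtau z zq zv.
right; have [q1 [l [q' [qE v2E]]]] := sites_split v2q.
have sqE := congr1 size qE; rewrite size_cat /= in sqE.
have s1 : size q1 = size w1.
  have := lvv j; rewrite -/v2 v2E lv_disp size_rcons; last by move: sqE hq; clear; lia.
  by clear; lia.
move: v2E; rewrite -cats1 !dispE addrA => v2E.
have d1 : x + disp q1 = x0.
  case: (posnP (size q1)) => [/size0nil q10|q1_gt0].
    by move: s1; rewrite /x0 q10 /= => /esym/size0nil ->.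
  have zq : x + disp q1 \in sites x q.
    rewrite qE sites_cat mem_cat; case/lastP: q1 q1_gt0 {qE sqE s1 v2E} => // q1 a _.
    by rewrite -cats1 sites_cat mem_cat !dispE addrA /= inE eqxx orbT.
  have zv : x + disp q1 != v2.
    apply: contra_eqN (lvv j) => /eqP; rewrite -/v2 => <-.
    by rewrite lv_disp s1; [|rewrite -s1; move: sqE hq]; clear; lia.
  have [_] := qtau _ zq zv; rewrite /isolated => /negbT; rewrite negb_or => /andP[].
  rewrite negb_and negbK => /orP[/eqP //|/negP h _]; case: h.
  by apply/existsP; exists l; rewrite -v2E.
have lj : l = j by apply: e_inj; apply: (addrI x0); rewrite -{1}d1 -v2E.
have [b [q2 q'E]] : exists b q2, q' = b :: q2.
  by case: q' qE sqE => [|b q2] _ sqE; [move: sqE sq s1 sw12; clear => /=; lia|exists b, q2].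
have bi : b = i.
  have zq : v2 + e b \in sites x q.
    by rewrite qE q'E sites_cat mem_cat /= !inE d1 lj eqxx !orbT.
  have zv : v2 + e b != v2.
    apply: contra_eqN (lvy j b) => /eqP; rewrite -/v2 => ->; rewrite lvv; clear; lia.
  have [_] := qtau _ zq zv; rewrite /isolated => /negbT; rewrite negb_or => /andP[_].
  rewrite negb_and negbK => /orP[/eqP h|/negP h]; last first.
    by case: h; apply/existsP; exists b.
  by apply: e_inj; apply: (addrI v2); rewrite h /y0 /v2 addrAC.
exists q1, q2; rewrite qE q'E lj bi; split => //.
  by apply: (addrI x); rewrite d1.
split; first by rewrite -sq qE q'E !size_cat.
  by rewrite -dq qE q'E lj bi !dispE [e i + _]addrCA.
have hq' : (lv x + size (q1 ++ [:: i, j & q2]) <= N)%N.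
  by move: hq; rewrite qE q'E !size_cat.
apply/allP => z zq'; have [->|zv1] := eqVneq z v1.
  case: wM => _ _ /allP; apply; rewrite sites_cat mem_cat /= inE -/x0 -/v1 eqxx orbT.
  by [].
have zq : z \in sites x q.
  move: zq'; rewrite qE q'E lj bi !sites_cat !mem_cat /= !inE d1 -/v1 (negbTE zv1) /=.
  by rewrite [x0 + e j + e i]addrAC => /orP[->|->]; rewrite ?orbT.
have zv2 : z != v2.
  apply: contraNneq zv1 => zv2; apply/eqP.
  by rewrite (level_site hq' zq') ?d1 // s1 zv2 lvv.
by have [-> _] := qtau z zq zv2.
Qed.

Lemma isolate_split_levels (k : 'I_rho.+1) : k = (size w1).+1 :> nat ->
  k \in split_levels tau /\ split_levels tau \subset k |: split_levels sigma.
Proof.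
move=> kE; split.
  rewrite inE; apply/asboolP; exists w, (w1 ++ [:: j, i & w2]); split.
  - exact: Mpath_isolate.
  - exact: Mpath_flip.
  have takeS a b : take (size w1).+1 (w1 ++ [:: a, b & w2]) = rcons w1 a.
    by rewrite -cat_rcons take_size_cat ?size_rcons.
  rewrite kE !takeS -!cats1 !dispE.
  by move/addrI/e_inj => h; move: ij; rewrite h eqxx.
apply/fintype.subsetP => l; rewrite !inE; case: eqVneq => //= lk [q [q' [hq hq' dl]]].
have unflip u : Mpath tau u -> exists2 u', Mpath sigma u' & disp (take l u') = disp (take l u).
  move=> /Mpath_unflip [[_ h]|[u1 [u2 [-> su du hu]]]]; first by exists u.
  exists (u1 ++ [:: i, j & u2]) => //; rewrite !take_cat su.
  case: ltnP => // lw; rewrite !disp_cat; congr (_ + _).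
  have : (l : nat) != (size w1).+1 by rewrite -kE.
  case E : (l - size w1)%N => [|[|t]] //.
    by move=> /eqP []; move: E lw; clear; lia.
  by move=> _; rewrite /= !disp_cons addrCA.
apply/asboolP; have [u uM uE] := unflip q hq; have [u' u'M u'E] := unflip q' hq'.
by exists u, u'; split => //; rewrite uE u'E.
Qed.

(** The modification is near any path of [M] of the new configuration, because at
    level [k] such a path is at [v1] or [v2]. *)
Lemma isolate_ball (k : 'I_rho.+1) q : k = (size w1).+1 :> nat ->
  k \notin split_levels sigma -> Mpath tau q ->
  forall z, z \notin ball 2 (x + disp (take k q)) -> sigma z = tau z.
Proof.
move=> kE kT qM z.
suff h : exists u u', [/\ (size u <= 1)%N, (size u' <= 1)%N &
    v2 = x + disp (take k q) + disp u - disp u'].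
  have [u [u' [su su' vE]]] := h.
  rewrite ffunE; case: eqP => [->|_].
    by rewrite vE mem_ball // ?(leq_trans su) // (leq_trans su').
  case: ifP => // /orP[/andP[_ /existsP[l /eqP zl]]|/andP[_ /existsP [l /eqP zl]]].
    have -> : z = x + disp (take k q) + disp u - disp (rcons u' l).
      by rewrite -cats1 !dispE opprD addrA -vE -zl addrK.
    by rewrite mem_ball // ?(leq_trans su) // size_rcons.
  have -> : z = x + disp (take k q) + disp (rcons u l) - disp u'.
    by rewrite zl vE -cats1 !dispE !addrA [LHS]addrAC.
  by rewrite mem_ball ?size_rcons // (leq_trans su').
have [[_ qs]|[q1 [q2 [qE sq1 dq1 _]]]] := Mpath_unflip qM.
  have dk : disp (take k q) = disp (take k w).
    apply: contrapT => h; case/negP: kT; rewrite inE; apply/asboolP.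
    by exists q, w.
  exists [:: j], [:: i]; split => //; rewrite dk kE /w -cat_rcons take_size_cat ?size_rcons //.
  by rewrite -cats1 !dispE addrA [_ + e i + e j]addrAC addrK.
exists [::], [::]; split => //; rewrite qE kE -sq1 -cat_rcons take_size_cat ?size_rcons //.
by rewrite -cats1 !dispE subr0 dq1 addrA.
Qed.

End Flip.

Definition cornered_event a n sigma := exists w,
  [/\ Mpath sigma w, (a <= corners w)%N & (#|split_levels sigma| <= n)%N].

(** Flipping a corner at a level where all paths of [M] agree creates exactly one more
    level of disagreement, at which the modification can be located; the original
    path, hence the number of its corners, is kept. *)
Lemma cornered_step a n : (0 < a - n)%N ->
  (n.+1 * halving_ratio K pm (ball_size 2) <= a - n)%N ->
  Pr p (cornered_event a n) <= 2^-1 * Pr p (cornered_event a n.+1).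
Proof.
move=> h0 hh.
pose q tau := xget [::] [set w | Mpath tau w].
have qP tau w : Mpath tau w -> Mpath tau (q tau).
  by move=> hw; apply: (@xgetPex _ [::] [set w | Mpath tau w]); exists w.
apply: (local_modification_half p_gt0 p_sum1 pm_gt0 pm_le
  (J := split_levels)
  (Reg := fun tau (k : 'I_rho.+1) => ball 2 (x + disp (take k (q tau)))) h0 hh).
- by move=> tau j _ _; exact: card_ball.
- by move=> tau [w []].
move=> sigma [w [wM wa wT]].
have [S [uS sS hS]] := corner_levels w.
pose B := [set k : 'I_rho.+1 | val k \in S].
exists (B :\: split_levels sigma); split.
  have SB : (size S <= #|B|)%N.
    rewrite cardE -(size_map val); apply: uniq_leq_size => // k kS.
    have krho : (k < rho.+1)%N.
      have [w1 [i [j [w2 [wE _ ->]]]]] := hS k kS; case: wM => <- _ _.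
      by rewrite wE size_cat /=; clear; lia.
    by apply/mapP; exists (Ordinal krho); rewrite // mem_enum inE.
  rewrite cardsD leq_sub //; first by rewrite -sS in wa; exact: leq_trans SB.
  by apply: leq_trans wT; exact/subset_leq_card/finset.subsetIr.
move=> k; rewrite finset.in_setD [X in _ && X]inE => /andP[kT kS].
have [w1 [i [j [w2 [wE ij kE]]]]] := hS _ kS; rewrite wE in wM wa.
have wM' := Mpath_isolate wM.
exists (isolate sigma w1 i j).
have [kI sI] := isolate_split_levels ij wM kE.
split => //; last first. move=> z zB. exact: (isolate_ball wM kE kT (qP _ _ wM') zB).
exists (w1 ++ [:: i, j & w2]); split => //.
apply: leq_trans (subset_leq_card sI) _; rewrite cardsU1.
by move: wT; clear; case: (_ \notin _); lia.
Qed.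

Lemma cornered_rare a n0 : (n0 * (halving_ratio K pm (ball_size 2)).+1 < a)%N ->
  Pr p (cornered_event a 0) <= (2^-1) ^+ n0.
Proof.
move=> h.
have h1 n : (n <= n0)%N -> Pr p (cornered_event a (n0 - n)) <= (2^-1) ^+ n.
  elim: n => [|n IH] hn; first by rewrite expr0 Pr_le1.
  have [h2 h3] : (0 < a - (n0 - n.+1) /\ (n0 - n.+1).+1 *
      halving_ratio K pm (ball_size 2) <= a - (n0 - n.+1))%N.
    by move: h hn; clear; move: (halving_ratio _ _ _) => G; nia.
  apply: le_trans (cornered_step h2 h3) _.
  have -> : (n0 - n.+1).+1 = (n0 - n)%N by move: hn; clear; lia.
  by rewrite exprS ler_pM2l ?invr_gt0 // IH // ltnW.
by have := h1 n0 (leqnn _); rewrite subnn.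
Qed.

End MaximalPaths.

(** The endpoint of a word only depends on how often each step occurs. *)
Lemma card_disps r : (#|[set z in [seq disp w | w <- words d r]]| <= r.+1 ^ d)%N.
Proof.
pose h (f : {ffun 'I_d -> 'I_r.+1}) : V := \sum_i e i *+ f i.
apply: (@leq_trans #|[set h f | f in [set: {ffun 'I_d -> 'I_r.+1}]]|); last first.
  by apply: leq_trans (leq_imset_card _ _) _; rewrite cardsT card_ffun !card_ord.
apply/subset_leq_card/fintype.subsetP => z; rewrite inE => /mapP [w].
rewrite mem_words => /eqP sw ->.
apply/imsetP; exists [ffun i => inord (count_mem i w)] => //.
rewrite /h /disp big_seq_cond /= -big_seq_cond.
under [RHS]eq_bigr => i _ do rewrite ffunE inordK ?ltnS -?sw ?count_size //.
elim: w {sw} => [|j w IH]; first by rewrite big_nil big1.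
rewrite big_cons IH /= [RHS](eq_bigr (fun i => e i *+ (j == i) + e i *+ count_mem i w)).
  rewrite big_split /=; congr (_ + _).
  rewrite (bigD1 j) //= eqxx mulr1n big1 ?addr0 // => i /negbTE.
  by rewrite eq_sym => ->.
by move=> i _; rewrite mulrnDr.
Qed.

Lemma untied_disp_inj sigma x c c' : size c = size c' -> disp c = disp c' ->
  ~ tied sigma x c -> ~ tied sigma x c' -> c = c'.
Proof.
move=> sc dc t t'; apply: contrapT => cc'.
have [h|/ltW h] := leP (wt sigma x c) (wt sigma x c').
  by apply: t; exists c'; split => // /esym.
by apply: t'; exists c.
Qed.

(** Two untied words cannot have the same endpoint. *)
Lemma count_untied sigma x r :
  (size [seq c <- words d r | `[< ~ tied sigma x c >]] <= r.+1 ^ d)%N.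
Proof.
apply: leq_trans (card_disps r); rewrite -(size_map disp).
have /card_uniqP <- : uniq [seq disp c | c <- words d r & `[< ~ tied sigma x c >]].
  rewrite map_inj_in_uniq ?filter_uniq ?uniq_words // => a b.
  rewrite !mem_filter !mem_words => /andP[/asboolP ta /eqP sa] /andP[/asboolP tb /eqP sb] dab.
  by apply: untied_disp_inj ta tb; rewrite ?sa ?sb.
apply/subset_leq_card/fintype.subsetP => z /mapP [c]; rewrite mem_filter => /andP[_ cw ->].
by rewrite inE; apply/mapP; exists c.
Qed.

Lemma Pr_allM x w : (lv x + size w <= N)%N ->
  Pr p (fun sigma => allM sigma x w) = p kM ^+ size w.
Proof.
move=> h; rewrite -(size_sites x w).
have -> : p kM = \sum_k p k * (k == kM)%:R.
  rewrite (bigD1 kM) //= eqxx mulr1 big1 ?addr0 // => k /negbTE ->.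
  by rewrite mulr0.
rewrite -Ex_prod_seq ?uniq_sites //; apply: eq_Ex => sigma.
rewrite /allM; elim: (sites x w) => [|z s IH] /=; first by rewrite big_nil asboolT.
rewrite big_cons -IH -natrM mulnb; congr (nat_of_bool _)%:R.
by apply/asboolP/andP => [/andP[-> h']|[-> /asboolP ->] //]; split => //; apply/asboolP.
Qed.

(** Paths of maximal sites which are alone between their endpoints are rare even
    when maximal sites percolate.  The words with few corners are too few for one of
    them to see only [M]; the others are counted by their endpoints, each of which
    has an exponentially small probability by [cornered_rare]. *)
Lemma unique_allM_bound x rho (c0 n0 : nat) (k0 : K) : k0 != kM -> (lv x + rho < N)%N ->
  (c0 * (n0 * (halving_ratio K pm (ball_size 2)).+1) < rho)%N ->
  \sum_(c <- words d rho) Pr p (fun sigma => allM sigma x c /\ ~ tied sigma x c) <=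
    (size [seq w <- words d rho | (c0 * corners w < rho)%N])%:R * p kM ^+ rho +
    rho.+1%:R ^+ d * (2^-1) ^+ n0.
Proof.
move=> k0M hrho hn0.
rewrite (bigID (fun c => c0 * corners c < rho)%N) /=; apply: lerD.
  rewrite -sum1_size natr_sum big_distrl /= big_filter.
  rewrite [leLHS]big_seq_cond [leRHS]big_seq_cond; apply: ler_sum => c.
  rewrite mem_words => /andP[/eqP sc _]; rewrite mul1r.
  have hc : (lv x + size c <= N)%N by rewrite sc ltnW.
  have := Pr_allM hc; rewrite sc => <-.
  by apply: Pr_mono => // sigma [].
set a := (n0 * (halving_ratio K pm (ball_size 2)).+1).+1.
pose Ds := [set z in [seq disp w | w <- words d rho]].
apply: (@le_trans _ _ (\sum_(z in Ds) Pr p (cornered_event x rho z a 0))); last first.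
  apply: (@le_trans _ _ (\sum_(z in Ds) (2^-1) ^+ n0)).
    by apply: ler_sum => z _; apply: cornered_rare hrho k0M _ _ _; rewrite /a.
  rewrite sumr_const -[leLHS]mulr_natl ler_wpM2r ?exprn_ge0 ?invr_ge0 //.
  by rewrite -natrX ler_nat card_disps.
rewrite -!Ex_sum; apply: Ex_le => // sigma.
set U := fun c => allM sigma x c /\ ~ tied sigma x c.
pose l := [seq c <- words d rho | `[< U c >] && ~~ (c0 * corners c < rho)%N].
have -> : \sum_(c <- words d rho | ~~ (c0 * corners c < rho)%N) (`[< U c >])%:R =
   \sum_(z <- [seq disp c | c <- l]) 1 :> R.
  rewrite big_map big_filter [LHS]big_mkcond [RHS]big_mkcond; apply: eq_bigr => c _.
  by case: `[< _ >]; case: (_ < _)%N.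
have ul : uniq [seq disp c | c <- l].
  rewrite map_inj_in_uniq ?filter_uniq ?uniq_words // => u w.
  rewrite !mem_filter !mem_words.
  move=> /andP[/andP[/asboolP [_ tu] _] /eqP su] /andP[/andP[/asboolP [_ tw] _] /eqP sw] duw.
  by apply: untied_disp_inj tu tw; rewrite ?su ?sw.
rewrite big_uniq //= [leLHS]big_mkcond [leRHS]big_mkcond; apply: ler_sum => z _ /=.
case: ifP => [/mapP [c]|_]; last by case: ifP.
rewrite mem_filter mem_words => /andP[/andP[/asboolP [cM ct] cc] /eqP sc] ->.
rewrite inE map_f ?mem_words ?sc // asboolT //.
exists c; split => //.
  by rewrite /a; move: cc hn0; clear; move: (halving_ratio _ _ _) => G; nia.
rewrite leqn0 cards_eq0; apply/eqP/setP => k; rewrite !inE; apply/negbTE/negP => /asboolP.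
have uniqc u : Mpath x rho (disp c) sigma u -> u = c.
  move=> [su du uM]; apply: contrapT => uc; apply: ct; exists u; split => //.
    by rewrite su.
  by rewrite !wt_allM // su sc.
by move=> [u [w [/uniqc -> /uniqc ->]]].
Qed.

(** * Pieces containing a run of maximal sites *)

Definition has_run rho sigma x c := exists c1 c2 c3,
  [/\ c = c1 ++ c2 ++ c3, size c2 = rho & allM sigma (x + disp c1) c2].

Lemma has_run_local rho sigma tau x c : {in sites x c, sigma =1 tau} ->
  has_run rho sigma x c -> has_run rho tau x c.
Proof.
move=> h [c1 [c2 [c3 [cE sc aM]]]]; exists c1, c2, c3; split => //.
apply/allP => z zc; rewrite -h; first exact: (allP aM).
by rewrite cE !sites_cat !mem_cat zc orbT.
Qed.

Lemma has_run_cat rho sigma x c1 c2 c3 :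
  has_run rho sigma (x + disp c1) c2 -> has_run rho sigma x (c1 ++ c2 ++ c3).
Proof.
move=> [u1 [u2 [u3 [-> su aM]]]]; exists (c1 ++ u1), u2, (u3 ++ c3).
by rewrite -!catA disp_cat addrA.
Qed.

Lemma untied_cat sigma x u w : ~ tied sigma x (u ++ w) ->
  ~ tied sigma x u /\ ~ tied sigma (x + disp u) w.
Proof.
move=> h; split=> -[c [sc cN dc wc]]; apply: h.
  exists (c ++ w); split; rewrite ?size_cat ?sc ?disp_cat ?dc //.
    by move/eqP; rewrite eqseq_cat // => /andP[/eqP].
  by rewrite !wt_cat dc lerD2r.
exists (u ++ c); split; rewrite ?size_cat ?sc ?disp_cat ?dc //.
  by move/eqP; rewrite eqseq_cat // => /andP[_ /eqP].
by rewrite !wt_cat lerD2l.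
Qed.

Lemma nonM_cat sigma x u w : nonM sigma x (u ++ w) =
  (nonM sigma x u + nonM sigma (x + disp u)%R w)%N.
Proof. by rewrite /nonM sites_cat count_cat. Qed.

Lemma run_of_few_nonM rho sigma k x c : size c = (k * rho)%N ->
  (nonM sigma x c < k)%N -> has_run rho sigma x c.
Proof.
elim: k x c => [//|k IH] x c; rewrite mulSn => sc.
have s1 : size (take rho c) = rho by rewrite size_takel // sc leq_addr.
have s2 : size (drop rho c) = (k * rho)%N by rewrite size_drop sc addKn.
rewrite -{1}(cat_take_drop rho c) nonM_cat => h.
have [aM|aM] := boolP (allM sigma x (take rho c)).
  exists [::], (take rho c), (drop rho c).
  by rewrite cat_take_drop s1 disp_nil addr0.
rewrite -(cat_take_drop rho c) -[drop _ _]cats0; apply: has_run_cat; apply: IH => //.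
have : (0 < nonM sigma x (take rho c))%N.
  by rewrite /nonM -has_count has_predC.
by move: h; clear; lia.
Qed.

(** With that many corners one of them is at distance [m * rho] from both ends.  If
    one of its sides has less than [m] sites below the maximum, then one of the [m]
    blocks of length [rho] at the corresponding end is a run. *)
Lemma good_corner_or_run rho sigma x c : (2 * (m * rho) + 2 < corners c)%N ->
  good_corner sigma x c \/ has_run rho sigma x c.
Proof.
move=> h.
have sc := leq_trans h (corners_size c).
pose A := take (m * rho) c; pose B' := drop (m * rho) c.
pose B := take (size B' - m * rho) B'; pose C := drop (size B' - m * rho) B'.
have sB' : size B' = (size c - m * rho)%N by rewrite size_drop.
have sA : size A = (m * rho)%N by rewrite size_takel //; move: sc; clear; lia.
have sC : size C = (m * rho)%N by rewrite size_drop sB'; move: sc; clear; lia.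
have cE : c = A ++ B ++ C by rewrite /A /B /C !cat_take_drop.
have cB : (0 < corners B)%N.
  have := corners_cat A (B ++ C); have := corners_cat B C; rewrite -cE.
  have := corners_size A; have := corners_size C; rewrite sA sC.
  by move: h; clear; lia.
have [w1 [i [j [w2 [BE ij]]]]] := corners_split cB.
have cE' : c = (A ++ w1) ++ [:: i, j & w2 ++ C] by rewrite cE BE -!catA.
have [h1|h1] := leqP m (nonM sigma x (A ++ w1)); last first.
  right; rewrite cE -[A]cat0s -catA; apply: has_run_cat.
  rewrite disp_nil addr0; apply: run_of_few_nonM sA _.
  by apply: leq_ltn_trans h1; rewrite nonM_cat leq_addr.
set x2 := x + disp (A ++ w1) + e i + e j.
have [h2|h2] := leqP m (nonM sigma x2 (w2 ++ C)); last first.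
  right; rewrite cE -[C]cats0 catA; apply: has_run_cat.
  apply: run_of_few_nonM sC _; apply: leq_ltn_trans h2.
  rewrite nonM_cat; have -> : x + disp (A ++ B) = x2 + disp w2.
    by rewrite /x2 BE !dispE !addrA.
  exact: leq_addl.
by left; exists (A ++ w1), i, j, (w2 ++ C).
Qed.

Section Runs.
Variables (rho : nat) (U : R).
Hypothesis U_bound : forall y, (lv y + rho < N)%N ->
  \sum_(c <- words d rho) Pr p (fun sigma => allM sigma y c /\ ~ tied sigma y c) <= U.

Lemma tied_depends x c l : (lv x + size c <= l <= N)%N ->
  depends_on (fun z => lv z <= l)%N (fun sigma => `[< tied sigma x c >]).
Proof.
move=> h s t st; apply: asbool_equiv_eq; split; apply: tied_local => [|z hz].
- by move: h; clear; lia.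
- by apply: st; move: h hz; clear; lia.
- by move: h; clear; lia.
- by apply/esym/st; move: h hz; clear; lia.
Qed.

Lemma tied_depends_gt x c l : (l <= lv x)%N -> (lv x + size c <= N)%N ->
  depends_on (predC (fun z => lv z <= l)%N) (fun sigma => `[< tied sigma x c >]).
Proof.
move=> h h' s t st; apply: asbool_equiv_eq; split; apply: tied_local => // z hz.
- by apply: st => /=; move: h hz; clear; lia.
- by apply/esym/st => /=; move: h hz; clear; lia.
Qed.

Lemma sum_untied_le x b B : (b <= B)%N -> forall sigma,
  \sum_(c <- words d b) (`[< ~ tied sigma x c >])%:R <= B.+1%:R ^+ d :> R.
Proof.
move=> bB sigma; rewrite -natr_sum -natrX ler_nat.
have -> : (\sum_(c <- words d b) `[< ~ tied sigma x c >] =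
    size [seq c <- words d b | `[< ~ tied sigma x c >]])%N.
  rewrite -sum1_size big_filter [RHS]big_mkcond; apply: eq_bigr => c _.
  by case: `[< _ >].
apply: leq_trans (count_untied _ _ _) _.
by have [->|d0] := posnP d; rewrite ?expn0 // leq_exp2r.
Qed.

Lemma depends_unique y c l : (l <= lv y)%N -> (lv y + size c <= N)%N ->
  depends_on (predC (fun z => lv z <= l)%N)
    (fun sigma => `[< allM sigma y c /\ ~ tied sigma y c >]).
Proof.
move=> h h' s t st; have tE := tied_depends_gt h h' st.
have aE : allM s y c = allM t y c.
  apply: eq_in_all => z /(lv_sites h') hz; rewrite st //=.
  by move: h hz; clear; lia.
by rewrite !asbool_and !asbool_neg tE aE.
Qed.

(** The parts before, inside and after the run are untied too.  The first and the last
    one have at most polynomially many choices, whatever the configuration, and the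
    middle one depends on other levels than the first. *)
Lemma untied_run_bound x r : 0 <= U -> (lv x + r < N)%N ->
  \sum_(c <- words d r) Pr p (fun sigma => has_run rho sigma x c /\ ~ tied sigma x c)
  <= r.+1%:R * (r.+1%:R ^+ d * U * r.+1%:R ^+ d).
Proof.
move=> U0 hx; set M : R := r.+1%:R ^+ d.
have M0 : 0 <= M by rewrite exprn_ge0.
pose run_at a sigma c := exists c1 c2 c3, [/\ c = c1 ++ c2 ++ c3, size c1 = a,
  size c2 = rho & allM sigma (x + disp c1) c2].
apply: (@le_trans _ _ (\sum_(c <- words d r) \sum_(a < r.+1 | (a + rho <= r)%N)
    Pr p (fun sigma => run_at a sigma c /\ ~ tied sigma x c))).
  rewrite [leLHS]big_seq [leRHS]big_seq; apply: ler_sum => c; rewrite mem_words => /eqP sc.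
  rewrite -Ex_sum; apply: markov => // sigma; first by apply: sumr_ge0 => a _.
  move=> [[c1 [c2 [c3 [cE s2 aM]]]] tc].
  have har : (size c1 + rho <= r)%N by rewrite -sc cE !size_cat s2 addnA leq_addr.
  have ha : (size c1 < r.+1)%N by move: har; clear; lia.
  rewrite (bigD1 (Ordinal ha)) //= asboolT; last by split => //; exists c1, c2, c3.
  by rewrite lerDl; apply: sumr_ge0.
rewrite exchange_big /=.
apply: (@le_trans _ _ (\sum_(a < r.+1) M * U * M)); last first.
  by rewrite sumr_const card_ord mulr_natl.
have UM0 : 0 <= M * U * M by rewrite !mulr_ge0.
rewrite [leLHS]big_mkcond; apply: ler_sum => a _; case: ifP => // har.
pose b := (r - a - rho)%N.
have rE : r = (a + (rho + b))%N by rewrite /b; move: har; clear; lia.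
rewrite {1}rE big_words_cat; under eq_bigr => c1 _ do rewrite big_words_cat.
pose f1 c1 sigma : R := (`[< ~ tied sigma x c1 >])%:R.
pose f2 c1 c2 sigma : R :=
  (`[< allM sigma (x + disp c1) c2 /\ ~ tied sigma (x + disp c1) c2 >])%:R.
apply: (@le_trans _ _ (\sum_(c1 <- words d a) \sum_(c2 <- words d rho)
    Ex p (fun sigma => M * (f1 c1 sigma * f2 c1 c2 sigma)))).
  rewrite [leLHS]big_seq [leRHS]big_seq; apply: ler_sum => c1; rewrite mem_words => /eqP s1.
  rewrite [leLHS]big_seq [leRHS]big_seq; apply: ler_sum => c2; rewrite mem_words => /eqP s2.
  rewrite -Ex_sum; apply: Ex_le => // sigma.
  apply: (@le_trans _ _ (\sum_(c3 <- words d b) f1 c1 sigma * f2 c1 c2 sigma *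
      (`[< ~ tied sigma (x + disp (c1 ++ c2)) c3 >])%:R)); last first.
    rewrite -big_distrr /= mulrC ler_wpM2r ?mulr_ge0 ?ler0n //.
    by apply: sum_untied_le; rewrite /b; move: har; clear; lia.
  apply: ler_sum => c3 _; case: asboolP => [[[u1 [u2 [u3 [cE su1 su2 aM]]]] tc]|_]; last first.
    by rewrite !mulr_ge0 ?ler0n.
  move/eqP: cE; rewrite eqseq_cat ?su1 // => /andP[/eqP c1E].
  rewrite eqseq_cat ?su2 // => /andP[/eqP c2E _].
  have [t1 t23] := untied_cat tc; have [t2 t3] := untied_cat t23.
  rewrite /f1 /f2 disp_cat addrA !asboolT ?mulr1 //.
  by split => //; rewrite c1E c2E.
apply: (@le_trans _ _ (\sum_(c1 <- words d a) M * (Ex p (f1 c1) * U))).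
  rewrite [leLHS]big_seq [leRHS]big_seq; apply: ler_sum => c1; rewrite mem_words => /eqP s1.
  have lv1 : lv (x + disp c1) = (lv x + a)%N.
    by rewrite lv_disp s1 //; move: hx har; clear; lia.
  have ind c2 : size c2 = rho -> Ex p (fun sigma => M * (f1 c1 sigma * f2 c1 c2 sigma)) =
      M * (Ex p (f1 c1) * Ex p (f2 c1 c2)).
    move=> s2; rewrite ExZ; congr (_ * _).
    apply: (@Ex_indep _ _ p p_sum1 V (fun z => (lv z <= lv x + a)%N)) => s t st.
      rewrite /f1; congr (nat_of_bool _)%:R; rewrite !asbool_neg; congr (~~ _).
      by apply: tied_depends st; rewrite s1; move: hx har; clear; lia.
    rewrite /f2; congr (nat_of_bool _)%:R.
    by apply: depends_unique st; rewrite lv1 ?s2 //; move: hx har; clear; lia.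
  rewrite (eq_big_seq (fun c2 => M * (Ex p (f1 c1) * Ex p (f2 c1 c2)))); last first.
    by move=> c2; rewrite mem_words => /eqP; exact: ind.
  rewrite -!big_distrr /= ler_wpM2l // ler_wpM2l //; first by apply: Ex_ge0 => // s; rewrite ler0n.
  by apply: U_bound; rewrite lv1; move: hx har; clear; lia.
rewrite -big_distrr -big_distrl /= -Ex_sum (_ : M * U * M = M * (M * U)); last by ring.
apply: ler_wpM2l => //; apply: ler_wpM2r => //; rewrite -[leRHS](Ex_const p_sum1 V).
apply: Ex_le => // sigma; apply: sum_untied_le.
by move: har; clear; lia.
Qed.

End Runs.

Section RunPieces.
Variables (rho r : nat) (alpha b wB : R).
Hypothesis alpha_gt0 : 0 < alpha.
Hypothesis alpha_le1 : alpha <= 1.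
Hypothesis b_ge1 : 1 <= b.
Hypothesis wB_bound : forall x, (lv x + r < N)%N ->
  \sum_(c <- words d r) Pr p (fun sigma => has_run rho sigma x c /\ ~ tied sigma x c) <= wB.

(** Ties are penalized by [alpha] and untied pieces with a run are rewarded by [b], so
    that a path with few ties and many runs contributes a lot to the sum over all
    paths of the products of these weights. *)
Definition piece_weight sigma x c : R :=
  if `[< tied sigma x c >] then alpha else if `[< has_run rho sigma x c >] then b else 1.

Fixpoint pieces_genfun k x sigma : R :=
  if k is k'.+1 then
    \sum_(c <- words d r) piece_weight sigma x c * pieces_genfun k' (x + disp c) sigma
  else 1.

Definition piece_rate : R := alpha * d%:R ^+ r + b * wB + r.+1%:R ^+ d.

Let b_gt0 : 0 < b. Proof. exact: lt_le_trans b_ge1. Qed.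

Lemma piece_weight_gt0 sigma x c : 0 < piece_weight sigma x c.
Proof. by rewrite /piece_weight; case: ifP => // _; case: ifP. Qed.

Lemma pieces_genfun_ge0 k x sigma : 0 <= pieces_genfun k x sigma.
Proof.
elim: k x => //= k IH x; apply: sumr_ge0 => c _.
by rewrite mulr_ge0 // ltW // piece_weight_gt0.
Qed.

Lemma sum_piece_weight x : (lv x + r < N)%N ->
  \sum_(c <- words d r) Ex p (fun sigma => piece_weight sigma x c) <= piece_rate.
Proof.
move=> hx; apply: (@le_trans _ _ (\sum_(c <- words d r) Ex p (fun sigma => alpha +
   b * (`[< has_run rho sigma x c /\ ~ tied sigma x c >])%:R +
   (`[< ~ tied sigma x c >])%:R))).
  apply: ler_sum => c _; apply: Ex_le => // sigma; rewrite /piece_weight.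
  rewrite asbool_and !asbool_neg; move: alpha_gt0 b_gt0.
  by case: `[< tied _ _ _ >]; case: `[< has_run _ _ _ _ >] => /=; lra.
under eq_bigr => c _ do rewrite ExD ExD Ex_const // ExZ.
rewrite !big_split /= /piece_rate; apply: lerD; first apply: lerD.
- by rewrite big_const_seq count_predT size_words iter_addr_0 -[leLHS]mulr_natr natrX.
- rewrite -big_distrr /=; apply: ler_wpM2l; first exact: ltW.
  by have := wB_bound hx.
rewrite -Ex_sum -[leRHS](Ex_const p_sum1 V); apply: Ex_le => // sigma.
exact: sum_untied_le.
Qed.

Lemma piece_weight_local sigma tau x c : (lv x + size c <= N)%N ->
  (forall z, (lv x < lv z <= lv x + size c)%N -> sigma z = tau z) ->
  piece_weight sigma x c = piece_weight tau x c.
Proof.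
move=> h st; rewrite /piece_weight.
have -> : `[< tied sigma x c >] = `[< tied tau x c >].
  by apply: asbool_equiv_eq; split; apply: tied_local => // z hz; rewrite st.
have -> // : `[< has_run rho sigma x c >] = `[< has_run rho tau x c >].
by apply: asbool_equiv_eq; split; apply: has_run_local => z /(lv_sites h) hz; rewrite st.
Qed.

Lemma pieces_genfun_depends k y l : (l <= lv y)%N -> (lv y + k * r <= N)%N ->
  depends_on (predC (fun z => lv z <= l)%N) (pieces_genfun k y).
Proof.
elim: k y => [//|k IH] y hl hN s t st /=; rewrite mulSn in hN.
rewrite [LHS]big_seq [RHS]big_seq; apply: eq_bigr => c; rewrite mem_words => /eqP sc.
have hy : (lv y + size c <= N)%N by rewrite sc; move: hN; clear; lia.
congr (_ * _).
  by apply: piece_weight_local => // z hz; apply: st => /=; move: hl hz; clear; lia.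
by apply: IH st; rewrite lv_disp // sc; move: hl hN; clear; lia.
Qed.

(** The pieces live at different levels, so that their contributions multiply. *)
Lemma Ex_pieces_genfun k x : (lv x + k * r < N)%N ->
  Ex p (pieces_genfun k x) <= piece_rate ^+ k.
Proof.
elim: k x => [|k IH] x; first by rewrite /= expr0 Ex_const.
rewrite mulSn => hx /=; rewrite exprS.
have hr : (lv x + r < N)%N by move: hx; clear; lia.
have rate0 : 0 <= piece_rate ^+ k.
  apply: exprn_ge0; apply: le_trans (sum_piece_weight hr); apply: sumr_ge0 => c _.
  by apply: Ex_ge0 => // sigma; rewrite ltW // piece_weight_gt0.
rewrite Ex_sum; apply: le_trans (ler_wpM2r rate0 (sum_piece_weight hr)).
rewrite big_distrl /= [leLHS]big_seq [leRHS]big_seq; apply: ler_sum => c.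
rewrite mem_words => /eqP sc.
have lc : lv (x + disp c) = (lv x + r)%N by rewrite lv_disp sc // ltnW.
rewrite (@Ex_indep _ _ p p_sum1 V (fun z => lv z <= lv x + r)%N); last 2 first.
- move=> s t st; apply: piece_weight_local => [|z hz]; first by rewrite sc; exact: ltnW.
  by apply: st; rewrite sc in hz; move: hz; clear; lia.
- by apply: pieces_genfun_depends; rewrite lc //; move: hx; clear; lia.
rewrite ler_wpM2l //.
  by apply: Ex_ge0 => // sigma; rewrite ltW // piece_weight_gt0.
by apply: IH; rewrite lc; move: hx; clear; lia.
Qed.

Lemma startS w j : start r w j.+1 = disp (take r w) + start r (drop r w) j.
Proof. by rewrite /start mulSn takeD disp_cat. Qed.

Lemma pieceS w j : piece r w j.+1 = piece r (drop r w) j.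
Proof. by rewrite /piece drop_drop mulSn addnC. Qed.

Lemma start0 w : start r w 0 = 0. Proof. by rewrite /start mul0n take0 disp_nil. Qed.
Lemma piece0 w : piece r w 0 = take r w. Proof. by rewrite /piece mul0n drop0. Qed.

Lemma pieces_genfun_ge sigma mm x w : (mm * r <= size w)%N ->
  \prod_(j < mm) piece_weight sigma (x + start r w j) (piece r w j)
    <= pieces_genfun mm x sigma.
Proof.
elim: mm x w => [|k IH] x w; first by rewrite big_ord0.
rewrite mulSn => hw; rewrite big_ord_recl /= start0 addr0 piece0.
have tw : take r w \in words d r.
  by rewrite mem_words size_takel ?eqxx //; exact: leq_trans (leq_addr _ _) hw.
rewrite (big_rem _ tw) /= -[leLHS]addr0 lerD //; last first.
  by apply: sumr_ge0 => c _; rewrite mulr_ge0 ?pieces_genfun_ge0 // ltW // piece_weight_gt0.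
rewrite ler_wpM2l //; first by rewrite ltW // piece_weight_gt0.
under eq_bigr => j _ do rewrite startS pieceS addrA.
by apply: IH; rewrite size_drop; move: hw; clear; lia.
Qed.

Section Bound.
Variables (L mm t0 b0 : nat).
Hypothesis mmN : (mm * r < N)%N.
Hypothesis mmL : (mm * r <= L)%N.

Definition run_pieces sigma w : {set 'I_mm} :=
  [set j : 'I_mm | `[< has_run rho sigma (start r w j) (piece r w j) >]].

Lemma run_pieces_rare :
  Pr p (fun sigma => exists w, [/\ size w = L, (#|tied_pieces r mm sigma w| <= t0)%N &
    (b0 <= #|run_pieces sigma w|)%N]) * (alpha ^+ t0 * b ^+ (b0 - t0))
  <= piece_rate ^+ mm.
Proof.
have pos : 0 < alpha ^+ t0 * b ^+ (b0 - t0) by rewrite mulr_gt0 ?exprn_gt0.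
rewrite -ler_pdivlMr //; apply: (@le_trans _ _
  (Ex p (fun sigma => (alpha ^+ t0 * b ^+ (b0 - t0))^-1 * pieces_genfun mm 0 sigma))).
  apply: markov => // sigma.
    by rewrite mulr_ge0 ?pieces_genfun_ge0 // invr_ge0 ltW.
  move=> [w [sw wt wb]]; rewrite mulrC ler_pdivlMr // mul1r.
  apply: le_trans (pieces_genfun_ge sigma 0 (w := w) _); last by rewrite sw.
  pose T := tied_pieces r mm sigma w.
  have -> : \prod_(j < mm) piece_weight sigma (0 + start r w j) (piece r w j) =
      alpha ^+ #|T| * b ^+ #|run_pieces sigma w :\: T|.
    rewrite (bigID (mem T)) /=; congr (_ * _).
      rewrite -prodr_const; apply: eq_bigr => j; rewrite inE add0r /piece_weight => tj.
      by rewrite tj.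
    rewrite (bigID (mem (run_pieces sigma w))) /= [X in _ * X]big1 ?mulr1; last first.
      by move=> j; rewrite !inE add0r /piece_weight => /andP[/negbTE -> /negbTE ->].
    rewrite -prodr_const; apply: eq_big => j; first by rewrite finset.in_setD.
    by rewrite !inE add0r /piece_weight => /andP[/negbTE -> ->].
  apply: ler_pM; rewrite ?exprn_ge0 ?(ltW alpha_gt0) ?(ltW b_gt0) //.
    by apply: ler_wiXn2l => //; rewrite ltW.
  apply: ler_weXn2l => //; rewrite cardsD leq_sub //.
  by apply: leq_trans wt; exact/subset_leq_card/finset.subsetIr.
rewrite ExZ mulrC; apply: ler_wpM2r; first by rewrite invr_ge0 ltW.
by apply: Ex_pieces_genfun; rewrite lv0.
Qed.

End Bound.
End RunPieces.

(** * Counting maximal words *)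

Definition heavier sigma x w : seq (seq 'I_d) :=
  [seq w' <- words d (size w) | `[< disp w' = disp w /\ wt sigma x w <= wt sigma x w' >]].

Lemma mem_heavier sigma x w w' : (w' \in heavier sigma x w) <->
  [/\ size w' = size w, disp w' = disp w & wt sigma x w <= wt sigma x w'].
Proof.
rewrite mem_filter mem_words; split.
  by move=> /andP[/asboolP [h1 h2] /eqP h3].
by move=> [-> h1 h2]; rewrite eqxx andbT; apply/asboolP.
Qed.

Lemma uniq_heavier sigma x w : uniq (heavier sigma x w).
Proof. by rewrite filter_uniq // uniq_words. Qed.

(** Alternatives for two consecutive parts of a path can be combined freely. *)
Lemma heavier_cat sigma x u w :
  (size (heavier sigma x u) * size (heavier sigma (x + disp u)%R w)
    <= size (heavier sigma x (u ++ w)))%N.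
Proof.
rewrite -(size_allpairs cat); apply: uniq_leq_size.
  apply: allpairs_uniq; rewrite ?uniq_heavier // => -[a1 a2] [b1 b2].
  move=> /allpairsP [[c1 c2] /= [h1 h2 [-> ->]]] /allpairsP [[c3 c4] /= [h3 h4 [-> ->]]] /=.
  move/eqP; rewrite eqseq_cat; first by move=> /andP[/eqP -> /eqP ->].
  by have [-> _ _] := (mem_heavier _ _ _ _).1 h1; have [-> _ _] := (mem_heavier _ _ _ _).1 h3.
move=> c /allpairsP [[a1 a2] /= [/mem_heavier [s1 d1 w1] /mem_heavier [s2 d2 w2] ->]].
apply/mem_heavier; rewrite !size_cat !disp_cat !wt_cat s1 s2 d1 d2; split => //.
exact: lerD.
Qed.

Lemma heavier_tied sigma x c : (2 ^ `[< tied sigma x c >] <= size (heavier sigma x c))%N.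
Proof.
have cc : c \in heavier sigma x c by apply/mem_heavier; split.
case: asboolP => [[c' [sc cN dc wc]]|_] /=; last by rewrite -has_predT; apply/hasP; exists c.
apply: (@uniq_leq_size _ [:: c; c']); first by rewrite /= andbT inE; apply/eqP => /esym.
move=> z; rewrite !inE => /orP[|] /eqP -> //.
by apply/mem_heavier; split.
Qed.

Lemma heavier_pieces sigma r mm x w : (mm * r <= size w)%N ->
  (2 ^ (\sum_(j < mm) `[< tied sigma (x + start r w j)%R (piece r w j) >])
     <= size (heavier sigma x w))%N.
Proof.
elim: mm x w => [|k IH] x w.
  rewrite big_ord0 => _; rewrite -has_predT; apply/hasP; exists w => //.
  by apply/mem_heavier; split.
rewrite mulSn => hw; rewrite big_ord_recl /= start0 addr0 piece0 expnD.
have := heavier_cat sigma x (take r w) (drop r w); rewrite cat_take_drop; apply: leq_trans.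
apply: leq_mul; first exact: heavier_tied.
under eq_bigr => j _ do rewrite startS pieceS addrA.
by apply: IH; rewrite size_drop; move: hw; clear; lia.
Qed.

Definition max_words sigma L : seq (seq 'I_d) :=
  [seq w <- words d L | `[< is_max sigma w >]].

Lemma max_words_ge sigma r mm L w : size w = L -> is_max sigma w -> (mm * r <= L)%N ->
  (2 ^ #|tied_pieces r mm sigma w| <= size (max_words sigma L))%N.
Proof.
move=> sw wmax hmm.
have -> : #|tied_pieces r mm sigma w| =
    (\sum_(j < mm) `[< tied sigma (0 + start r w j)%R (piece r w j) >])%N.
  rewrite -sum1_card big_mkcond; apply: eq_bigr => j _.
  by rewrite inE add0r; case: asboolP.
apply: leq_trans (heavier_pieces sigma 0 _) _; first by rewrite sw.
apply: uniq_leq_size; first exact: uniq_heavier.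
move=> c /mem_heavier [sc _ wc]; rewrite mem_filter mem_words sc sw eqxx andbT.
by apply/asboolP => q; rewrite sc => /wmax h; exact: le_trans wc.
Qed.

Lemma corners_pieces r mm w : (mm * r <= size w)%N ->
  (corners w <= \sum_(j < mm) corners (piece r w j) + mm + (size w - mm * r))%N.
Proof.
elim: mm w => [|k IH] w; first by rewrite big_ord0 subn0 => _; exact: corners_size.
rewrite mulSn => hw; rewrite big_ord_recl /= piece0.
have -> : (\sum_(j < k) corners (piece r w (lift ord0 j)) =
    \sum_(j < k) corners (piece r (drop r w) j))%N.
  by apply: eq_bigr => j _; rewrite pieceS.
have hd : (k * r <= size (drop r w))%N by rewrite size_drop; move: hw; clear; lia.
have := IH _ hd; have := corners_cat (take r w) (drop r w).
rewrite cat_take_drop size_drop.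
by move: hw; clear; move: (\sum_(_ < _) _)%N; lia.
Qed.

(** A piece has at most [r] corners, cutting loses at most one corner per piece, and the
    remainder is short. *)
Lemma cornered_pieces r mm w h : (mm * r <= size w)%N ->
  (corners w <= mm * h + r * #|[set j : 'I_mm | h < corners (piece r w j)]| + mm
    + (size w - mm * r))%N.
Proof.
move=> hw; apply: leq_trans (corners_pieces hw) _; rewrite !leq_add2r.
rewrite -sum1_card big_distrr /= [X in (_ <= _ + X)%N]big_mkcond.
have -> : (mm * h = \sum_(j < mm) h)%N by rewrite sum_nat_const card_ord.
rewrite -big_split; apply: leq_sum => j _ /=; rewrite inE; case: ltnP => hj.
  apply: leq_trans (leq_addl _ _); rewrite muln1.
  by apply: leq_trans (corners_size _) _; rewrite (size_piece hw).
by rewrite addn0.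
Qed.

(** * Maximal paths have many corners *)

Lemma Ex_three (x1 x2 x3 : V) (F : K * K * K -> R) : x1 != x2 -> x1 != x3 -> x2 != x3 ->
  Ex p (fun sigma : {ffun V -> K} => F (sigma x1, sigma x2, sigma x3)) =
  \sum_k p k.1.1 * p k.1.2 * p k.2 * F k.
Proof.
move=> n12 n13 n23.
have n21 : x2 != x1 by rewrite eq_sym.
have n31 : x3 != x1 by rewrite eq_sym.
have n32 : x3 != x2 by rewrite eq_sym.
have n3 : (x3 != x1) && (x3 != x2) by rewrite n31.
pose h (k : K * K * K) x l : R :=
  if x == x1 then (l == k.1.1)%:R else if x == x2 then (l == k.1.2)%:R
  else if x == x3 then (l == k.2)%:R else 1.
have hE k (sigma : {ffun V -> K}) :
    \prod_x h k x (sigma x) = ((sigma x1, sigma x2, sigma x3) == k)%:R.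
  rewrite (bigD1 x1) //= (bigD1 x2) //= (bigD1 x3) //=.
  rewrite big1; last first.
    move=> x /andP[/andP[y1 y2] y3].
    by rewrite /h (negbTE y1) (negbTE y2) (negbTE y3).
  rewrite /h !eqxx (negbTE n21) (negbTE n31) (negbTE n32).
  rewrite mulr1 -!natrM !mulnb; congr (nat_of_bool _)%:R.
  by case: k => [[a b] c]; rewrite !xpair_eqE andbA.
have Eh k : Ex p (fun sigma => \prod_x h k x (sigma x)) = p k.1.1 * p k.1.2 * p k.2.
  have ind a : \sum_l p l * (l == a)%:R = p a.
    rewrite (bigD1 a) //= eqxx mulr1 big1 ?addr0 // => l /negbTE ->.
    by rewrite mulr0.
  rewrite Ex_prod (bigD1 x1) //= (bigD1 x2) //= (bigD1 x3) //=.
  rewrite [X in _ * (_ * (_ * X))]big1; last first.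
    move=> x /andP[/andP[y1 y2] y3].
    rewrite /h (negbTE y1) (negbTE y2) (negbTE y3) -[RHS]p_sum1.
    by apply: eq_bigr => l _; rewrite mulr1.
  rewrite /h !eqxx (negbTE n21) (negbTE n31) (negbTE n32).
  by rewrite !ind mulr1 mulrA.
transitivity (Ex p (fun sigma => \sum_k F k * \prod_x h k x (sigma x))).
  apply: eq_Ex => sigma.
  rewrite (bigD1 (sigma x1, sigma x2, sigma x3)) //= [X in _ + X]big1 => [|k kN].
    by rewrite hE eqxx mulr1 addr0.
  by rewrite hE eq_sym (negbTE kN) mulr0.
rewrite Ex_sum; apply: eq_bigr => k _.
by rewrite ExZ Eh mulrC.
Qed.

Section ZigZag.
Variables (i0 i1 : 'I_d) (theta : R).
Hypothesis i01 : i0 != i1.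

(** The staircase with steps [i0] and [i1], taking at each turn the better of the two
    corners of the square. *)
Fixpoint zigzag sigma x h : R :=
  if h is h'.+1 then
    Num.max (v (sigma (x + e i0))) (v (sigma (x + e i1)))
      + v (sigma (x + e i0 + e i1)) + zigzag sigma (x + e i0 + e i1) h'
  else 0.

Lemma zigzag_word sigma x h : exists2 w, size w = (2 * h)%N & wt sigma x w = zigzag sigma x h.
Proof.
elim: h x => [|h IH] x; first by exists [::]; rewrite //= /wt big_nil.
have [w sw ww] := IH (x + e i0 + e i1).
have [le01|/ltW le10] := leP (v (sigma (x + e i0))) (v (sigma (x + e i1))).
  exists [:: i1, i0 & w]; first by rewrite /= sw mulnS.
  by rewrite !wt_cons /= (max_r le01) [x + e i1 + e i0]addrAC ww addrA.
exists [:: i0, i1 & w]; first by rewrite /= sw mulnS.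
by rewrite !wt_cons /= (max_l le10) ww addrA.
Qed.

Definition zigzag_excess (k : K * K * K) : R :=
  Num.max (v k.1.1) (v k.1.2) + v k.2 - 2 * theta.

Variable t : R.
Hypothesis t_gt0 : 0 < t.
Definition zigzag_rate : R :=
  \sum_(k : K * K * K) p k.1.1 * p k.1.2 * p k.2 * expR (- t * zigzag_excess k).

Lemma Ex_zigzag h x : (lv x + 2 * h <= N)%N ->
  Ex p (fun sigma => expR (- t * (zigzag sigma x h - (2 * h)%:R * theta))) = zigzag_rate ^+ h.
Proof.
elim: h x => [|h IH] x hx.
  rewrite expr0 -[RHS](Ex_const p_sum1 V); apply: eq_Ex => sigma.
  by rewrite /= mul0r subrr mulr0 expR0.
have l1 i : lv (x + e i) = (lv x).+1 by rewrite lvS //; move: hx; clear; lia.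
have l2 : lv (x + e i0 + e i1) = (lv x).+2 by rewrite lvS l1 //; move: hx; clear; lia.
set y := x + e i0 + e i1 in l2 *.
pose f (sigma : {ffun V -> K}) := expR (- t * zigzag_excess
  (sigma (x + e i0), sigma (x + e i1), sigma y)).
pose rest (sigma : {ffun V -> K}) := expR (- t * (zigzag sigma y h - (2 * h)%:R * theta)).
have gdep z (s s' : {ffun V -> K}) k : (lv z + 2 * k <= N)%N ->
    (forall z', ~~ (lv z' <= lv z)%N -> s z' = s' z') -> zigzag s z k = zigzag s' z k.
  elim: k z => [//|k IHk] z hz ss /=.
  have m1 i : lv (z + e i) = (lv z).+1 by rewrite lvS //; move: hz; clear; lia.
  have m2 : lv (z + e i0 + e i1) = (lv z).+2 by rewrite lvS m1 //; move: hz; clear; lia.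
  rewrite !ss ?m1 ?m2; try by clear; lia.
  congr (_ + _); apply: IHk => [|z' hz']; first by rewrite m2; move: hz; clear; lia.
  by apply: ss; move: hz'; rewrite m2; clear; lia.
transitivity (Ex p (fun sigma => f sigma * rest sigma)).
  apply: eq_Ex => sigma; rewrite /f /rest -expRD /zigzag_excess /=; congr expR.
  by rewrite -/y mulnS natrD; ring.
rewrite (@Ex_indep _ _ p p_sum1 V (fun z => lv z <= (lv x).+2)%N); last 2 first.
- by move=> s s' ss; rewrite /f !ss ?l1 ?l2.
- move=> s s' ss; rewrite /rest (@gdep _ s s') //; first by rewrite l2; move: hx; clear; lia.
  by move=> z hz; apply: ss; rewrite /= -l2.
rewrite /rest IH; last by rewrite l2; move: hx; clear; lia.
rewrite exprS; congr (_ * _); rewrite /f.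
rewrite (Ex_three (fun k => expR (- t * zigzag_excess k))) //.
- apply/negP => /eqP/addrI/e_inj; exact/eqP.
- by apply/negP => /eqP h01; have := l2; rewrite -h01 l1; clear; lia.
- by apply/negP => /eqP h01; have := l2; rewrite -h01 l1; clear; lia.
Qed.

Variable t' : R.
Hypothesis t'_gt0 : 0 < t'.
Definition step_rate : R := \sum_k p k * expR (t' * (v k - theta)).

Lemma Pr_heavy_word x w : (lv x + size w <= N)%N ->
  Pr p (fun sigma => (size w)%:R * theta <= wt sigma x w) <= step_rate ^+ size w.
Proof.
move=> hw; rewrite -{2}(size_sites x w) -Ex_prod_seq ?uniq_sites //.
apply: markov => // [sigma|sigma h].
  by apply: prodr_ge0 => z _; exact: expR_ge0.
rewrite -expR_sum -expR0 ler_expR -big_distrr /= mulr_ge0 ?(ltW t'_gt0) //.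
rewrite sumrB subr_ge0; apply: le_trans h; rewrite big_const_seq count_predT.
by rewrite iter_addr_0 size_sites mulr_natl.
Qed.

Variable B : R.
Hypothesis v_bound : forall k, - B <= v k.

(** A maximal path is at least as heavy as the staircase.  If it has few corners,
    either the staircase is below [theta] per site or one of the few words with few
    corners is above it; the first term handles the former by an exponential moment
    of the staircase, up to one site when [L] is odd, and the second one the latter. *)
Lemma few_corner_max_bound (cd : nat) L : (L <= N)%N ->
  Pr p (fun sigma => exists w, [/\ size w = L, is_max sigma w & (cd * corners w < L)%N]) <=
  expR (t * (`|theta| + `|B|)) * zigzag_rate ^+ L./2 +
  (size [seq w <- words d L | (cd * corners w < L)%N])%:R * step_rate ^+ L.
Proof.
move=> LN; set h := L./2; set D0 : R := `|theta| + `|B|.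
have LE : L = (2 * h + odd L)%N by rewrite -[LHS]odd_double_half -muln2 mulnC addnC.
have hN : (lv 0%R + 2 * h <= N)%N by rewrite lv0; move: LN LE; clear; lia.
pose few := [seq w <- words d L | (cd * corners w < L)%N].
apply: (@le_trans _ _ (Pr p (fun sigma => zigzag sigma 0 h <= (2 * h)%:R * theta + D0 \/
   exists2 w, w \in few & L%:R * theta <= wt sigma 0 w))).
  apply: Pr_mono => // sigma [w [sw wmax wc]].
  have [le|lt] := leP (zigzag sigma 0 h) ((2 * h)%:R * theta + D0); [by left|right].
  exists w; first by rewrite mem_filter wc mem_words sw eqxx.
  have [w0 sw0 ww0] := zigzag_word sigma 0 h.
  have sw1 : size (w0 ++ nseq (odd L) i0) = size w.
    by rewrite size_cat size_nseq sw0 sw -LE.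
  apply: le_trans (wmax _ sw1); rewrite wt_cat ww0.
  have : - `|B| <= wt sigma (0 + disp w0) (nseq (odd L) i0).
    case: (odd L) => /=; rewrite /wt ?big_cons big_nil; last by rewrite oppr_le0.
    rewrite addr0; apply: le_trans (v_bound _).
    by rewrite lerN2 ler_norm.
  have : L%:R * theta <= (2 * h)%:R * theta + `|theta|.
    rewrite {1}LE natrD mulrDl lerD2l; case: (odd L); rewrite ?mul1r ?mul0r //.
    exact: ler_norm.
  by move: lt; rewrite /D0; lra.
apply: le_trans (Pr_or p_gt0 _ _) _; apply: lerD.
  apply: (@le_trans _ _ (Ex p (fun sigma => expR (t * D0) *
      expR (- t * (zigzag sigma 0 h - (2 * h)%:R * theta))))); last first.
    by rewrite ExZ Ex_zigzag.
  apply: markov => // sigma hz.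
  rewrite -expRD -[leLHS]expR0 ler_expR.
  rewrite [leRHS](_ : _ = t * (D0 - (zigzag sigma 0 h - (2 * h)%:R * theta))); last by ring.
  by apply: mulr_ge0; [exact: ltW | move: hz; lra].
apply: le_trans (Pr_exists p_gt0 _ _) _.
rewrite -sum1_size natr_sum big_distrl /= [leLHS]big_seq [leRHS]big_seq.
apply: ler_sum => w; rewrite mem_filter mem_words => /andP[_ /eqP sw].
have hw : (lv 0%R + size w <= N)%N by rewrite lv0 sw.
by have := Pr_heavy_word hw; rewrite sw mul1r.
Qed.
End ZigZag.

Lemma exists_max_word sigma L : (0 < d)%N -> exists w, size w = L /\ is_max sigma w.
Proof.
move=> d0.
have key (T : eqType) (f : T -> R) (s : seq T) : s != [::] ->
    exists2 a, a \in s & forall b, b \in s -> f b <= f a.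
  elim: s => // a [|a' s] IH _.
    by exists a; rewrite ?mem_head // => b; rewrite inE => /eqP ->.
  have [c cs hc] := IH isT; have [ac|/ltW ca] := leP (f a) (f c).
    exists c => [|b]; first by rewrite inE cs orbT.
    by rewrite inE => /predU1P[->|/hc].
  exists a => [|b]; first by rewrite mem_head.
  by rewrite inE => /predU1P[->//|/hc h]; exact: le_trans ca.
have [|w] := key _ (wt sigma 0) (words d L).
  by rewrite -size_eq0 size_words expn_eq0 -leqn0 leqNgt d0.
rewrite mem_words => /eqP sw hw; exists w; split => // q sq.
by apply: hw; rewrite mem_words sq sw.
Qed.

(** Fewer than [2 ^ t0.+1] maximal paths means at most [t0] ties along any of them.  A
    maximal path with many corners has at least [2 * a0 - 1] pieces with many corners,
    so [a0] pieces with a good corner or [a0] pieces with a run. *)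
Lemma bad_event_split (cd rho t0 L : nat) :
  let h := (2 * (m * rho) + 2)%N in
  let r := (2 * cd * h.+1)%N in
  let mm := (L %/ r)%N in
  let a0 := (mm %/ (4 * cd))%N in
  (0 < d)%N -> (0 < cd)%N ->
  Pr p (fun sigma => size (max_words sigma L) < 2 ^ t0.+1)%N <=
  Pr p (fun sigma => exists w, [/\ size w = L, is_max sigma w & (cd * corners w < L)%N]) +
  (Pr p (fun sigma => exists w, [/\ size w = L, is_max sigma w,
    (#|tied_pieces r mm sigma w| <= t0)%N & (a0 <= #|good_pieces r mm sigma w|)%N]) +
  Pr p (fun sigma => exists w, [/\ size w = L, (#|tied_pieces r mm sigma w| <= t0)%N &
    (a0 <= #|run_pieces rho r mm sigma w|)%N])).
Proof.
move=> h r mm a0 d0 cd0.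
apply: le_trans; last by apply: lerD; [exact: lexx | exact: (Pr_or p_gt0)].
apply: le_trans; last by exact: (Pr_or p_gt0).
apply: Pr_mono => // sigma few; have [w [sw wmax]] := exists_max_word sigma L d0.
have [wc|wc] := ltnP (cd * corners w) L; [by left; exists w|right].
have hmm : (mm * r <= L)%N by exact: leq_divM.
have r0 : (0 < r)%N by rewrite /r !muln_gt0 cd0.
have hL : (L < mm.+1 * r)%N by exact: ltn_ceil.
have tw : (#|tied_pieces r mm sigma w| <= t0)%N.
  by have := leq_ltn_trans (max_words_ge sw wmax hmm) few; rewrite ltn_exp2l.
set G := [set j : 'I_mm | (h < corners (piece r w j))%N].
have GAB : G \subset good_pieces r mm sigma w :|: run_pieces rho r mm sigma w.
  apply/fintype.subsetP => j; rewrite !inE => hj.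
  have := @good_corner_or_run rho sigma (start r w j) (piece r w j) hj.
  by case=> hyp; apply/orP; [left|right]; apply/asboolP.
have cG := subset_leq_card GAB.
have cU := (leq_card_setU (good_pieces r mm sigma w) (run_pieces rho r mm sigma w)).1.
have mG : (mm <= 2 * cd * #|G|.+1)%N.
  have hw : (mm * r <= size w)%N by rewrite sw.
  have := cornered_pieces h hw; rewrite -/G sw => hc.
  have : (mm * (2 * h.+1) <= mm * h.+1 + 2 * cd * h.+1 * #|G|.+1)%N.
    rewrite -(leq_pmul2l cd0).
    have -> : (cd * (mm * (2 * h.+1)) = mm * r)%N by rewrite /r; ring.
    apply: leq_trans hmm _; apply: leq_trans wc _; rewrite leq_mul2l.
    apply/orP; right; apply: leq_trans hc _.
    by move: hL; rewrite -/r; clear; nia.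
  rewrite (_ : mm * (2 * h.+1) = mm * h.+1 + mm * h.+1)%N; last by ring.
  rewrite leq_add2l (_ : 2 * cd * h.+1 * #|G|.+1 = (2 * cd * #|G|.+1) * h.+1)%N; last by ring.
  by rewrite leq_pmul2r.
have ha0 : (4 * cd * a0 <= mm)%N by rewrite mulnC; exact: leq_divM.
have aG : (2 * a0 <= #|G|.+1)%N.
  rewrite -(@leq_pmul2l (2 * cd)) ?muln_gt0 ?cd0 //; apply: leq_trans mG.
  by apply: leq_trans ha0; rewrite leq_eqVlt; apply/orP; left; apply/eqP; ring.
have [hA|hA] := leqP a0 #|good_pieces r mm sigma w|; [left|right]; exists w; split => //.
move: (leq_trans cG cU) aG hA; clear.
by move: #|G| #|good_pieces _ _ _ _| #|run_pieces _ _ _ _ _| a0 => x y z b; lia.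
Qed.

End Lattice.

(** * Choice of the constants *)

Section Constants.
Variable R : realType.
Implicit Types (q C : R).

Lemma small_poly_exp C q k : 0 <= q -> q < 1 ->
  exists s0, forall s, (s0 <= s)%N -> C * s.+1%:R ^+ k * q ^+ s <= 1.
Proof.
move=> q0 q1; pose u := Num.max q 2^-1.
have u0 : 0 < u by rewrite lt_max invr_gt0 ltr0n orbT.
have u1 : u < 1 by rewrite gt_max q1 invf_lt1 // ltr1n.
have qu : q <= u by rewrite le_max lexx.
pose eps := (1 - u) / 2; pose u' := (1 + u) / 2.
have eps0 : 0 < eps by rewrite /eps; lra.
have u'0 : 0 < u' by rewrite /u'; lra.
have u'1 : u' < 1 by rewrite /u'; lra.
have eu : (1 + eps) * u <= u' by rewrite /eps /u'; nra.
have [C1 C10 hC1] := poly_exp k eps0.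
pose a := u'^-1 - 1.
have a0 : 0 < a by rewrite /a subr_gt0 invf_gt1.
exists (Num.bound (`|C| * C1 / a)) => s hs.
have hb : `|C| * C1 <= 1 + s%:R * a.
  have := archi_boundP (divr_ge0 (mulr_ge0 (normr_ge0 C) (ltW C10)) (ltW a0)).
  rewrite ltr_pdivrMr // => h; apply: le_trans (ltW h) _.
  have : (Num.bound (`|C| * C1 / a))%:R * a <= s%:R * a by rewrite ler_pM2r // ler_nat.
  by lra.
have hu : 1 + s%:R * a <= u'^-1 ^+ s.
  by apply: le_trans (bernoulli s (ltW a0)) _; rewrite /a addrC subrK.
have qs : q ^+ s <= u ^+ s by rewrite lerXn2r ?nnegrE // ltW.
have x0 : 0 <= q ^+ s by rewrite exprn_ge0.
have n0 : 0 <= s.+1%:R ^+ k :> R by rewrite exprn_ge0.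
have C0 := normr_ge0 C.
apply: (@le_trans _ _ (`|C| * s.+1%:R ^+ k * q ^+ s)).
  by rewrite ler_wpM2r // ler_wpM2r // ler_norm.
apply: (@le_trans _ _ (`|C| * (C1 * (1 + eps) ^+ s) * u ^+ s)).
  by apply: ler_pM => //; exact: ler_wpM2l (hC1 s).
have -> : `|C| * (C1 * (1 + eps) ^+ s) * u ^+ s = (`|C| * C1) * ((1 + eps) * u) ^+ s.
  by rewrite exprMn; ring.
have us : ((1 + eps) * u) ^+ s <= u' ^+ s.
  by rewrite lerXn2r ?nnegrE ?(ltW u'0) // mulr_ge0 ?(ltW u0) //; lra.
apply: le_trans (ler_wpM2l _ us) _; first by rewrite mulr_ge0 // ltW.
rewrite -ler_pdivlMr ?exprn_gt0 // mul1r -exprVn; exact: le_trans hu.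
Qed.

(** For small [t], the second order term of the exponential is negligible with respect
    to the negative mean. *)
Lemma exp_moment (T : finType) (p f : T -> R) : (forall k, 0 <= p k) -> \sum_k p k = 1 ->
  \sum_k p k * f k < 0 -> exists2 t, 0 < t & \sum_k p k * expR (t * f k) < 1.
Proof.
move=> p0 p1 mean; set mu := \sum_k p k * f k in mean.
pose B : R := 1 + \sum_k `|f k|.
have fB k : `|f k| <= B.
  rewrite /B (bigD1 k) //= addrCA lerDl addr_ge0 // sumr_ge0 // => *; exact: normr_ge0.
have B0 : 0 < B by rewrite ltr_pwDl // sumr_ge0 // => *; exact: normr_ge0.
have exp2 (y : R) : y <= 2^-1 -> expR y <= 1 + y + 2 * (y * y).
  move=> hy; have h1 : 1 - y <= expR (- y) by have := expR_ge1Dx (- y).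
  have h2 : 0 < 1 - y by lra.
  rewrite -[y in expR y]opprK expRN; apply: (@le_trans _ _ (1 - y)^-1).
    by rewrite lef_pV2 // posrE ?expR_gt0.
  rewrite -[leLHS]mul1r ler_pdivrMr //; have : 0 <= y * y * (1 - 2 * y).
    by rewrite mulr_ge0 //; [rewrite -expr2 sqr_ge0 | lra].
  by lra.
pose t := Num.min (2 * B)^-1 (- mu / (4 * (B * B))).
have BB0 : 0 < B * B by rewrite mulr_gt0.
have t0 : 0 < t by rewrite lt_min invr_gt0 mulr_gt0 //= divr_gt0 ?mulr_gt0 // oppr_gt0.
have tB : t * B <= 2^-1.
  have : t <= (2 * B)^-1 by rewrite ge_min lexx.
  by rewrite invfM => h; have := ler_wpM2r (ltW B0) h; rewrite mulfVK // gt_eqF.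
have tmu : t * (4 * (B * B)) <= - mu.
  by rewrite -ler_pdivlMr ?mulr_gt0 // ge_min lexx orbT.
exists t => //.
apply: (@le_lt_trans _ _ (\sum_k (p k + t * (p k * f k) + 2 * (t * t * (B * B)) * p k))).
  apply: ler_sum => k _; have fk := fB k.
  have tf : t * f k <= 2^-1.
    by apply: le_trans tB; rewrite ler_pM2l //; apply: le_trans (ler_norm _) fk.
  have ff : f k * f k <= B * B.
    by rewrite -[leLHS]ger0_norm ?normrM ?ler_pM // -expr2 sqr_ge0.
  have := ler_wpM2l (p0 k) (exp2 _ tf).
  have : p k * (t * t) * (f k * f k) <= p k * (t * t) * (B * B).
    by rewrite ler_wpM2l // !mulr_ge0 // ltW.
  by lra.
rewrite !big_split /= -!big_distrr /= p1 -/mu.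
have : t * t * (4 * (B * B)) <= t * - mu by rewrite -mulrA ler_pM2l.
have : t * mu < 0 by rewrite pmulr_rlt0.
by lra.
Qed.

Lemma corner_constants (d : nat) (D lam1 lam2 : R) :
  0 <= D -> 0 <= lam1 -> lam1 < 1 -> 0 <= lam2 -> lam2 < 1 ->
  exists (cd : nat) (C kappa : R), [/\ (0 < cd)%N, 0 <= C, 0 <= kappa, kappa < 1 &
  forall L, D * lam2 ^+ L./2 +
    (size [seq w <- words d L | (cd * corners w < L)%N])%:R * lam1 ^+ L <= C * kappa ^+ L].
Proof.
move=> D0 l10 l11 l20 l21.
pose eps := (1 - lam1) / 2; have eps0 : 0 < eps by rewrite /eps; lra.
have [cd [cd0 few]] := few_corners d eps0.
pose k1 := (1 + lam1) / 2; pose k2 := (1 + lam2) / 2; pose kappa := Num.max k1 k2.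
have k10 : 0 < k1 by rewrite /k1; lra.
have k20 : 0 < k2 by rewrite /k2; lra.
have k1k : k1 <= kappa by rewrite le_max lexx.
have k2k : k2 <= kappa by rewrite le_max lexx orbT.
have kappa0 : 0 <= kappa by apply: le_trans k1k; exact: ltW.
exists cd, (D / k2 + (d%:R + 1)), kappa; split => //.
- by rewrite addr_ge0 ?divr_ge0 ?(ltW k20) // addr_ge0.
- by rewrite gt_max /k1 /k2; apply/andP; split; lra.
move=> L; rewrite mulrDl; apply: lerD.
  have kL : k2 ^+ L <= kappa ^+ L by rewrite lerXn2r ?nnegrE // ltW.
  apply: le_trans (ler_wpM2l _ kL); last by rewrite divr_ge0 // ltW.
  rewrite -mulrA ler_wpM2l // mulrC ler_pdivlMr //.
  apply: (@le_trans _ _ ((k2 * k2) ^+ L./2 * k2)).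
    rewrite ler_pM2r // lerXn2r ?nnegrE //; first by rewrite mulr_ge0 // ltW.
    by have := sqr_ge0 (1 - lam2); rewrite /k2 expr2; lra.
  rewrite -expr2 -exprM -exprSr; apply: ler_wiXn2l; rewrite ?(ltW k20) //.
    by rewrite /k2; lra.
  by have := odd_double_half L; rewrite -muln2; case: odd; lia.
have kL : k1 ^+ L <= kappa ^+ L by rewrite lerXn2r ?nnegrE // ltW.
have := few L; have l1L : 0 <= lam1 ^+ L by rewrite exprn_ge0.
move=> /(ler_wpM2r l1L) h; apply: le_trans h _.
rewrite -mulrA ler_wpM2l ?addr_ge0 //; apply: le_trans kL.
rewrite -exprMn lerXn2r ?nnegrE ?(ltW k10) //.
  by rewrite mulr_ge0 // /eps; lra.
by rewrite /eps /k1; nra.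
Qed.

(** The factor that is to be beaten is a power of [r], hence polynomial in [s], while
    the bound [U] on the runs decreases exponentially with [s]. *)
Lemma run_constants (d cd m G : nat) (pM : R) : 0 <= pM -> pM < 1 ->
  exists cB s : nat,
    let rho := (cB * (s * G.+1)).+1 in
    let r := (2 * cd * (2 * (m * rho) + 2).+1)%N in
    let U := (size [seq w <- words d rho | (cB * corners w < rho)%N])%:R * pM ^+ rho +
      rho.+1%:R ^+ d * 2^-1 ^+ s in
    (12 * r.+1%:R ^+ d) ^+ (16 * cd) * (r.+1%:R * (r.+1%:R ^+ d * U * r.+1%:R ^+ d)) <= 1.
Proof.
move=> pM0 pM1; pose q := (1 + pM) / 2.
have q0 : 0 <= q by rewrite /q; lra.
have q1 : q < 1 by rewrite /q; lra.
have qh : 2^-1 <= q by rewrite /q; lra.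
pose eps := (1 - pM) / 2; have eps0 : 0 < eps by rewrite /eps; lra.
have epsq : (1 + eps) * pM <= q by rewrite /eps /q; nra.
have [cB [cB0 few]] := few_corners d eps0; exists cB.
pose Q := (cB * G.+1)%N; pose Rc := ((2 * cd * (2 * m + 3) + 1) * (Q + 2))%N.
pose Cu : R := (d%:R + 1) + (Q + 2)%:R ^+ d.
have Cu0 : 0 <= Cu by rewrite !addr_ge0 // exprn_ge0.
pose E := (16 * cd)%N.
pose C := 12 ^+ E * (Rc%:R ^+ d) ^+ E * (Rc%:R * (Rc%:R ^+ d * Cu * Rc%:R ^+ d)).
have [s hs] := small_poly_exp C (d * E + 1 + d + d + d) q0 q1.
exists s => rho r U; set X : R := s.+1%:R.
have {hs} := hs s (leqnn s); apply: le_trans.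
have Xge1 : 1 <= X by rewrite ler1n.
have rhoX : (rho.+1 <= (Q + 2) * s.+1)%N by rewrite /rho /Q; nia.
have rX : (r.+1 <= Rc * s.+1)%N.
  apply: (@leq_trans ((2 * cd * (2 * m + 3) + 1) * rho.+1)%N).
    have lin n : ((2 * cd * (2 * (m * n) + 2).+1).+1 <= (2 * cd * (2 * m + 3) + 1) * n.+1)%N.
      by clear; nia.
    exact: lin.
  by rewrite /Rc -[leqRHS]mulnA leq_mul2l rhoX orbT.
have rX' : r.+1%:R <= Rc%:R * X by rewrite -natrM ler_nat.
have rhoX' : rho.+1%:R <= (Q + 2)%:R * X by rewrite -natrM ler_nat.
have srho : (s <= rho)%N.
  by apply: leqW; apply: leq_trans (leq_pmulr s (ltn0Sn G)) (leq_pmull _ cB0).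
have qs0 : 0 <= q ^+ s by rewrite exprn_ge0.
have Xd : 1 <= X ^+ d by rewrite exprn_ege1.
have U_le : U <= Cu * X ^+ d * q ^+ s.
  rewrite /U /Cu [leRHS](_ : _ = (d%:R + 1) * (X ^+ d * q ^+ s) +
    ((Q + 2)%:R ^+ d * X ^+ d) * q ^+ s); last by ring.
  apply: lerD.
    have pMr : 0 <= pM ^+ rho by rewrite exprn_ge0.
    apply: le_trans (ler_wpM2r pMr (few rho)) _.
    rewrite -[leLHS]mulrA ler_wpM2l ?addr_ge0 // -exprMn.
    apply: (@le_trans _ _ (q ^+ s)); last by rewrite ler_peMl.
    apply: (@le_trans _ _ (q ^+ rho)).
      by rewrite lerXn2r ?nnegrE // mulr_ge0 // /eps; lra.
    by apply: ler_wiXn2l srho => //; exact: ltW.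
  apply: ler_pM; rewrite ?exprn_ge0 ?invr_ge0 //.
    by rewrite -exprMn lerXn2r ?nnegrE // mulr_ge0.
  by rewrite lerXn2r ?nnegrE.
have U0 : 0 <= U by rewrite addr_ge0 ?mulr_ge0 ?exprn_ge0.
have RX0 : 0 <= Rc%:R * X by rewrite mulr_ge0.
have rd : r.+1%:R ^+ d <= (Rc%:R * X) ^+ d by rewrite lerXn2r ?nnegrE.
apply: (@le_trans _ _ ((12 * (Rc%:R * X) ^+ d) ^+ E *
   (Rc%:R * X * ((Rc%:R * X) ^+ d * (Cu * X ^+ d * q ^+ s) * (Rc%:R * X) ^+ d)))).
  apply: ler_pM; rewrite ?exprn_ge0 ?mulr_ge0 ?exprn_ge0 //.
    by rewrite lerXn2r ?nnegrE ?mulr_ge0 ?exprn_ge0 // ler_wpM2l.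
  apply: ler_pM; rewrite ?mulr_ge0 ?exprn_ge0 //.
  apply: ler_pM; rewrite ?mulr_ge0 ?exprn_ge0 //.
  by apply: ler_pM; rewrite ?mulr_ge0 ?exprn_ge0.
have alg (E' : nat) (x y z w : R) :
    (12 * (y * x) ^+ d) ^+ E' * (y * x * ((y * x) ^+ d * (z * x ^+ d * w) * (y * x) ^+ d)) =
    12 ^+ E' * (y ^+ d) ^+ E' * (y * (y ^+ d * z * y ^+ d)) *
      x ^+ (d * E' + 1 + d + d + d) * w.
  rewrite !exprMn !exprD expr1 exprM; move: (x ^+ d) (y ^+ d) => xd yd.
  by move: (12 ^+ E') (xd ^+ E') (yd ^+ E') => a b c; ring.
by rewrite /C alg.
Qed.

(** [delta] has to be below two thresholds: the number of ties per site needed to get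
    [2 ^ (delta n)] maximal paths, and the exponential rate of the sum of the
    probabilities of the three bad events. *)
Lemma final_constants (C kappa : R) (T : nat) :
  0 <= C -> 0 <= kappa -> kappa < 1 -> (0 < T)%N ->
  exists2 delta, 0 < delta & exists L0, forall L, (L0 <= L)%N ->
    delta * L.+1%:R < (L %/ T).+1%:R /\
    C * kappa ^+ L + (2^-1 ^+ (L %/ T) + 2^-1 ^+ (L %/ T)) <= expR (- (delta * L.+1%:R)).
Proof.
move=> C0 k0 k1 T0; have T0' : 0 < T%:R :> R by rewrite ltr0n.
pose k3 : R := 1 - (2 * T%:R)^-1.
have iT : 0 < (2 * T%:R)^-1 :> R by rewrite invr_gt0 mulr_gt0.
have iT1 : (2 * T%:R)^-1 <= 2^-1 :> R.
  by rewrite lef_pV2 ?posrE ?mulr_gt0 // ler_peMr // ler1n.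
have k30 : 0 < k3 by rewrite /k3; lra.
have k31 : k3 < 1 by rewrite /k3; lra.
have k3T : 2^-1 <= k3 ^+ T.
  have h n : 1 - n%:R * (2 * T%:R)^-1 <= k3 ^+ n.
    elim: n => [|n IH]; first by rewrite expr0 mul0r subr0.
    rewrite exprS -[n.+1]addn1 natrD mulrDl mul1r.
    apply: le_trans (ler_wpM2l (ltW k30) IH); rewrite /k3.
    have : 0 <= n%:R * ((2 * T%:R)^-1 * (2 * T%:R)^-1) :> R by rewrite !mulr_ge0 // ltW.
    by move: ((2 * T%:R)^-1) => y; nra.
  by have := h T; rewrite invfM mulrCA divff ?gt_eqF // mulr1; lra.
pose k := Num.max kappa k3; pose k' := (1 + k) / 2.
have kk : kappa <= k by rewrite le_max lexx.
have k3k : k3 <= k by rewrite le_max lexx orbT.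
have kpos : 0 < k by apply: lt_le_trans k3k.
have klt1 : k < 1 by rewrite gt_max k1.
have k'0 : 0 < k' by rewrite /k'; lra.
have kk' : k < k' by rewrite /k'; lra.
pose delta := Num.min (2 * T%:R)^-1 (1 - k').
have d0 : 0 < delta by rewrite lt_min iT subr_gt0 /k'; lra.
have dT : delta <= (2 * T%:R)^-1 by rewrite ge_min lexx.
have dk : delta <= 1 - k' by rewrite ge_min lexx orbT.
have [||L0 hL0] := @small_poly_exp ((C + 4) / k') (k / k') 0.
- by rewrite divr_ge0 // ltW.
- by rewrite ltr_pdivrMr // mul1r.
exists delta => //; exists (maxn L0 1) => L; rewrite geq_max => /andP[hL L1].
have LT : (L < (L %/ T).+1 * T)%N by exact: ltn_ceil.
split.
  apply: (@le_lt_trans _ _ ((2 * T%:R)^-1 * L.+1%:R)); first by rewrite ler_wpM2r.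
  rewrite mulrC ltr_pdivrMr ?mulr_gt0 // mulrCA -natrM -[2]/(2%:R) -natrM ltr_nat.
  by move: LT L1; clear; move: (L %/ T).+1 => z; nia.
have half : 2^-1 ^+ (L %/ T) <= 2 * k ^+ L.
  have : 2^-1 ^+ (L %/ T).+1 <= k ^+ L.
    apply: (@le_trans _ _ ((k3 ^+ T) ^+ (L %/ T).+1)).
      by rewrite lerXn2r ?nnegrE ?invr_ge0 // exprn_ge0 // ltW.
    rewrite -exprM; apply: (@le_trans _ _ (k3 ^+ L)).
      by apply: ler_wiXn2l; rewrite ?(ltW k30) ?(ltW k31) // mulnC ltnW.
    by rewrite lerXn2r ?nnegrE // ltW.
  by rewrite exprS; lra.
have kL : kappa ^+ L <= k ^+ L by rewrite lerXn2r ?nnegrE // ltW.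
apply: (@le_trans _ _ ((C + 4) * k ^+ L)).
  by have := ler_wpM2l C0 kL; lra.
apply: (@le_trans _ _ (k' ^+ L.+1)).
  have := hL0 L hL; rewrite expr0 mulr1 expr_div_n.
  rewrite [X in X <= 1](_ : _ = ((C + 4) * k ^+ L) / k' ^+ L.+1); last first.
    rewrite exprS; have -> : (k' * k' ^+ L)^-1 = k'^-1 * (k' ^+ L)^-1 by rewrite invfM.
    by rewrite [RHS]mulrACA.
  by rewrite ler_pdivrMr ?exprn_gt0 // mul1r.
have -> : expR (- (delta * L.+1%:R)) = expR (- delta) ^+ L.+1.
  by rewrite -expRM_natl mulrN [delta * _]mulrC.
rewrite lerXn2r ?nnegrE ?expR_ge0 ?(ltW k'0) //.
by apply: le_trans (expR_ge1Dx _); lra.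
Qed.

End Constants.

(** * The finite statement *)

Section FiniteStatement.
Variable R : realType.

Lemma finite_lower_bound (T : finType) (f : T -> R) : (forall k, 0 < f k) ->
  exists2 g, 0 < g & forall k, g <= f k.
Proof.
move=> f0; have s0 : 0 <= \sum_k (f k)^-1.
  by apply: sumr_ge0 => k _; rewrite invr_ge0 ltW.
exists (\sum_k (f k)^-1 + 1)^-1 => [|k]; first by rewrite invr_gt0 ltr_wpDl.
rewrite -[leRHS]invrK lef_pV2 ?posrE ?invr_gt0 ?ltr_wpDl //.
apply: ler_wpDr => //; rewrite (bigD1 k) //= lerDl.
by apply: sumr_ge0 => l _; rewrite invr_ge0 ltW.
Qed.

(** The case [alpha = d ^ - r], [b = (12 Y) ^ (16 cd)] and [Y = (r + 1) ^ d] of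
    [run_pieces_rare].  The rate is at most [3 Y]; the penalty of the ties costs at
    most [2] per piece; and the reward is at least [12 Y] per piece on average. *)
Lemma run_bound_arith (P Y wB : R) (d r cd mm a0 t0 : nat) :
  (0 < d)%N -> 0 <= P -> 1 <= Y -> 0 <= wB -> (12 * Y) ^+ (16 * cd) * wB <= 1 ->
  (mm <= 16 * cd * (a0 - t0))%N -> (d * r * t0 <= mm)%N -> (t0 <= mm)%N ->
  P * ((d%:R ^+ r)^-1 ^+ t0 * (12 * Y) ^+ (16 * cd) ^+ (a0 - t0)) <=
    ((d%:R ^+ r)^-1 * d%:R ^+ r + (12 * Y) ^+ (16 * cd) * wB + Y) ^+ mm ->
  P <= 2^-1 ^+ t0.
Proof.
move=> d0 P0 Y1 wB0 bw hmm hdr htm h.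
have d0' : 0 < d%:R :> R by rewrite ltr0n.
have dr0 : 0 < d%:R ^+ r :> R by rewrite exprn_gt0.
have y0 : 0 < 12 * Y by lra.
have h1 : 2^-1 ^+ mm * (12 * Y) ^+ mm <= (d%:R ^+ r)^-1 ^+ t0 * (12 * Y) ^+ (16 * cd) ^+ (a0 - t0).
  apply: ler_pM; rewrite ?exprn_ge0 ?invr_ge0 ?(ltW y0) //.
    rewrite !exprVn lef_pV2 ?posrE ?exprn_gt0 // -!natrX ler_nat -expnM.
    apply: (@leq_trans (2 ^ (d * (r * t0)))); last by rewrite leq_exp2l // mulnA.
    rewrite [leqRHS]expnM; case: (r * t0)%N => // k.
    by rewrite leq_exp2r // ltnW // ltn_expl.
  by rewrite -exprM; apply: ler_weXn2l => //; lra.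
have h2 : ((d%:R ^+ r)^-1 * d%:R ^+ r + (12 * Y) ^+ (16 * cd) * wB + Y) ^+ mm <= (3 * Y) ^+ mm.
  rewrite mulVf ?gt_eqF // lerXn2r ?nnegrE //; last by lra.
    by rewrite !addr_ge0 ?mulr_ge0 ?exprn_ge0 ?(ltW y0) //; lra.
  by lra.
have h3 : P * (6 * Y) ^+ mm <= (3 * Y) ^+ mm.
  apply: le_trans h2; apply: le_trans h; rewrite ler_wpM2l //; apply: le_trans h1.
  rewrite -exprMn (_ : 2^-1 * (12 * Y) = 6 * Y) //; lra.
have Y6 : 0 < (6 * Y) ^+ mm by rewrite exprn_gt0 //; lra.
apply: (@le_trans _ _ (2^-1 ^+ mm)); last by apply: ler_wiXn2l => //; lra.
rewrite -(ler_pM2r Y6); apply: le_trans h3 _.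
rewrite -exprMn lerXn2r ?nnegrE //; lra.
Qed.

Lemma piece_arith (cd dr G mm : nat) : (0 < cd)%N -> (16 * cd <= mm)%N ->
  let t := (mm %/ (16 * cd * G.+1 + dr + 8 * cd))%N in
  let a := (mm %/ (4 * cd))%N in
  [/\ (t <= a)%N, ((t + t) * G.+1 < a)%N, (mm <= 16 * cd * (a - t))%N,
      (dr * t <= mm)%N & (t <= mm)%N].
Proof.
move=> cd0 hmm t a.
have tT : (t * (16 * cd * G.+1 + dr + 8 * cd) <= mm)%N by exact: leq_divM.
have aT : (mm < a.+1 * (4 * cd))%N by apply: ltn_ceil; rewrite muln_gt0.
have a4 : (4 <= a)%N by rewrite leq_divRL ?muln_gt0 // mulnA.
clearbody t a.
have h1 : (4 * (t * G.+1) <= a)%N.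
  rewrite -ltnS -(@ltn_pmul2r (4 * cd)) ?muln_gt0 //; apply: leq_ltn_trans aT.
  by apply: leq_trans tT; nia.
have h2 : (8 * cd * t <= mm)%N by apply: leq_trans tT; nia.
split; [nia | nia | | nia | nia].
have h3 : (16 * cd * t + mm <= 16 * cd * a)%N by nia.
by rewrite mulnBr; lia.
Qed.

Variables (d : nat) (K : finType) (p v : K -> R).
Hypothesis d_gt1 : (1 < d)%N.
Hypothesis p_gt0 : forall k, 0 < p k.
Hypothesis p_sum1 : \sum_k p k = 1.
Hypothesis v_inj : injective v.

Lemma big_triple (F : K * K * K -> R) :
  \sum_k F k = \sum_a \sum_b \sum_c F (a, b, c).
Proof. by rewrite !pair_big /=; apply: eq_bigr => -[[a b] c]. Qed.

Let mean := \sum_k p k * v k.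
Let mean_max := \sum_(k : K * K * K)
  p k.1.1 * p k.1.2 * p k.2 * (Num.max (v k.1.1) (v k.1.2) + v k.2).

Lemma sum_triple1 : \sum_(k : K * K * K) p k.1.1 * p k.1.2 * p k.2 = 1.
Proof.
rewrite big_triple /= -[RHS]p_sum1; apply: eq_bigr => a _.
under eq_bigr => b _ do rewrite -big_distrr /= p_sum1 mulr1.
by rewrite -big_distrr /= p_sum1 mulr1.
Qed.

(** The maximum exceeds the half sum, strictly so when the two values differ, which has
    positive probability. *)
Lemma mean_max_gt (ka kb : K) : ka != kb -> 2 * mean < mean_max.
Proof.
move=> kab.
have marg (f : K * K * K -> K) : f = (fun k => k.1.1) \/ f = (fun k => k.1.2) \/ f = snd ->
    \sum_(k : K * K * K) p k.1.1 * p k.1.2 * p k.2 * v (f k) = mean.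
  rewrite big_triple /=; move=> [->|[->|->]] /=.
  - rewrite /mean; apply: eq_bigr => a _.
    under eq_bigr => b _ do rewrite -big_distrl -big_distrr /= p_sum1 mulr1.
    by rewrite -big_distrl -big_distrr /= p_sum1 mulr1.
  - rewrite exchange_big /mean; apply: eq_bigr => b _ /=.
    under eq_bigr => a _ do rewrite -big_distrl -big_distrr /= p_sum1 mulr1.
    by rewrite -!big_distrl /= p_sum1 mul1r.
  - under eq_bigr => a _ do under eq_bigr => b _ do
      (under eq_bigr => c _ do rewrite -mulrA; rewrite -big_distrr /= -/mean).
    under eq_bigr => a _ do rewrite -big_distrl -big_distrr /= p_sum1 mulr1.
    by rewrite -big_distrl /= p_sum1 mul1r.
have -> : 2 * mean = \sum_(k : K * K * K) p k.1.1 * p k.1.2 * p k.2 *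
    ((v k.1.1 + v k.1.2) / 2 + v k.2).
  have E k : p k.1.1 * p k.1.2 * p k.2 * ((v k.1.1 + v k.1.2) / 2 + v k.2) =
     2^-1 * (p k.1.1 * p k.1.2 * p k.2 * v k.1.1) +
     2^-1 * (p k.1.1 * p k.1.2 * p k.2 * v k.1.2) + p k.1.1 * p k.1.2 * p k.2 * v k.2.
    by lra.
  rewrite (eq_bigr _ (fun k _ => E k)) !big_split /= -!big_distrr /=.
  rewrite (marg (fun k => k.1.1)); last by left.
  rewrite (marg (fun k => k.1.2)); last by right; left.
  rewrite (marg snd); last by right; right.
  by lra.
have p3 k : 0 < p k.1.1 * p k.1.2 * p k.2 by rewrite !mulr_gt0.
have le k : p k.1.1 * p k.1.2 * p k.2 * ((v k.1.1 + v k.1.2) / 2 + v k.2) <=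
    p k.1.1 * p k.1.2 * p k.2 * (Num.max (v k.1.1) (v k.1.2) + v k.2).
  by rewrite ler_pM2l // lerD2r; case: (leP (v k.1.1) (v k.1.2)); lra.
rewrite /mean_max (bigD1 (ka, kb, ka)) //= [ltRHS](bigD1 (ka, kb, ka)) //=.
apply: ltr_leD; last by apply: ler_sum => k _; exact: le.
rewrite ltr_pM2l ?mulr_gt0 // ltrD2r.
have : v ka != v kb by apply: contra_neq kab; exact: v_inj.
by rewrite neq_lt; case: (ltgtP (v ka) (v kb)) => //= ? _; lra.
Qed.

(** The constants are chosen in this order: the density [1 / cd] of corners, the length
    [rho] of the runs and the length [r] of the pieces by [run_constants], then the
    density of ties, small enough for [good_corners_rare] and [run_pieces_rare]. *)
Theorem few_max_words_rare (ka kb : K) : ka != kb ->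
  exists2 delta : R, 0 < delta & exists L0, forall L, (L0 <= L)%N ->
    forall (V : finZmodType) (e : 'I_d -> V) (lv : V -> nat) (N : nat),
      injective e -> (forall x i, (lv x < N)%N -> lv (x + e i) = (lv x).+1) ->
      lv 0 = 0%N -> (L < N)%N ->
      Pr p (fun sigma => (size (max_words e v sigma L))%:R <= 2 `^ (delta * L.+1%:R))
        <= expR (- (delta * L.+1%:R)).
Proof.
move=> kab; have [kM v_max] : exists kM, forall k, v k <= v kM.
  by case: (@arg_maxP _ _ _ ka predT v isT) => kM _ h; exists kM => k; exact: h.
have [g g0 hg] : exists2 g, 0 < g & forall k, g <= if k == kM then 1 else v kM - v k.
  apply: finite_lower_bound => k; case: eqVneq => // kkM.
  by rewrite subr_gt0 lt_neqAle v_max andbT; apply: contra_neq kkM; exact: v_inj.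
have v_gap k : k != kM -> v k + g <= v kM.
  by move=> /negbTE kkM; have := hg k; rewrite kkM; lra.
have [k0 k0M] : exists k0, k0 != kM.
  by have [E|] := eqVneq ka kM; [exists kb; rewrite -E eq_sym | exists ka].
pose range := \sum_k (v kM - v k).
have v_range k : v kM - v k <= range.
  rewrite /range (bigD1 k) //= lerDl; apply: sumr_ge0 => l _.
  by rewrite subr_ge0.
have range0 : 0 <= range by apply: sumr_ge0 => l _; rewrite subr_ge0.
pose m := Num.bound (range / g).
have m_large : range < m%:R * g.
  by rewrite -ltr_pdivrMr //; apply: archi_boundP; rewrite divr_ge0 // ltW.
have [pm pm0 pm_le] := finite_lower_bound p_gt0.
pose B := \sum_k `|v k|.
have v_bound k : - B <= v k.
  have : `|v k| <= B.
    by rewrite /B (bigD1 k) //= lerDl; apply: sumr_ge0 => l _; exact: normr_ge0.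
  by rewrite ler_norml => /andP[].
have d0 : (0 < d)%N by exact: ltnW.
pose i0 := Ordinal d0; pose i1 := Ordinal d_gt1.
have i01 : i0 != i1 by [].
have hmean := mean_max_gt kab.
pose theta := (mean + mean_max / 2) / 2.
have [t' t'0 ht'] : exists2 t', 0 < t' & step_rate v p theta t' < 1.
  apply: (@exp_moment _ _ p (fun k => v k - theta)) => //; first by move=> k; exact: ltW.
  under eq_bigr => k _ do rewrite mulrBr.
  rewrite sumrB -big_distrl /= p_sum1 -/mean mul1r /theta; lra.
have [t t0' ht] : exists2 t, 0 < t & zigzag_rate v p theta t < 1.
  have [||u u0 hu] := @exp_moment _ _ (fun k : K * K * K => p k.1.1 * p k.1.2 * p k.2)
    (fun k => - zigzag_excess v theta k) _ sum_triple1.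
  - by move=> k; rewrite ltW // !mulr_gt0.
  - under eq_bigr => k _ do rewrite mulrN /zigzag_excess mulrBr opprB.
    rewrite sumrB -big_distrl /= sum_triple1 -/mean_max /theta; lra.
  exists u => //; rewrite /zigzag_rate; under eq_bigr => k _ do rewrite mulNr -mulrN.
  exact: hu.
have lam1_0 : 0 <= step_rate v p theta t'.
  by apply: sumr_ge0 => k _; rewrite mulr_ge0 ?expR_ge0 // ltW.
have lam2_0 : 0 <= zigzag_rate v p theta t.
  by apply: sumr_ge0 => k _; rewrite mulr_ge0 ?expR_ge0 // ltW // !mulr_gt0.
have [cd [C [kappa [cd0 C0 kap0 kap1 hC]]]] :=
  @corner_constants _ d _ _ _ (expR_ge0 (t * (`|theta| + `|B|))) lam1_0 ht' lam2_0 ht.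
have pM1 : p kM < 1.
  rewrite -p_sum1 (bigD1 kM) //= ltrDl (bigD1 k0) //= ltr_pwDl //.
  by apply: sumr_ge0 => k _; exact: ltW.
pose G2 := halving_ratio K pm (ball_size d 2).
have [cB [s hU]] := run_constants d cd m G2 (ltW (p_gt0 kM)) pM1.
pose rho := (cB * (s * G2.+1)).+1; pose r := (2 * cd * (2 * (m * rho) + 2).+1)%N.
pose U : R := (size [seq w <- words d rho | (cB * corners w < rho)%N])%:R * p kM ^+ rho +
  rho.+1%:R ^+ d * 2^-1 ^+ s.
pose wB := r.+1%:R * (r.+1%:R ^+ d * U * r.+1%:R ^+ d).
have {}hU : (12 * r.+1%:R ^+ d) ^+ (16 * cd) * wB <= 1 by exact: hU.
have r0 : (0 < r)%N by rewrite /r !muln_gt0 cd0.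
pose Gr := halving_ratio K pm (ball_size d (2 * r)).
pose T1 := (16 * cd * Gr.+1 + d * r + 8 * cd)%N.
have T10 : (0 < T1)%N by rewrite /T1 addn_gt0 muln_gt0 cd0 orbT.
have [|delta delta0 [L0 hL0]] := @final_constants _ C kappa (r * T1) C0 kap0 kap1.
  by rewrite muln_gt0 r0.
exists delta => //; exists (maxn L0 (r * (16 * cd))) => L; rewrite geq_max => /andP[hL hLr].
move=> V e lv N e_inj lvS lv0 LN.
have [hdelta hfin] := hL0 L hL; rewrite divnMA in hdelta hfin.
set mm := (L %/ r)%N in hdelta hfin; set t0 := (mm %/ T1)%N in hdelta hfin.
pose a0 := (mm %/ (4 * cd))%N.
have hmm : (16 * cd <= mm)%N by rewrite leq_divRL // mulnC.
have mmL : (mm * r <= L)%N by exact: leq_divM.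
have [hta htG hma hdt htm] := @piece_arith cd (d * r) Gr mm cd0 hmm.
apply: le_trans hfin; apply: (@le_trans _ _
  (Pr p (fun sigma : {ffun V -> K} => size (max_words e v sigma L) < 2 ^ t0.+1)%N)).
  apply: Pr_mono => // sigma hs; rewrite -(ltr_nat R) natrX; apply: le_lt_trans hs _.
  rewrite -powR_mulrn // /powR gt_eqF // ltr_expR ltr_pM2r //.
  by rewrite ln_gt0 // ltr1n.
apply: le_trans (bad_event_split e v kM m p_gt0 rho t0 L d0 cd0) _.
rewrite -/r -/mm -/a0; apply: lerD; last apply: lerD.
- apply: le_trans (few_corner_max_bound e_inj lvS lv0 p_gt0 p_sum1 theta i01 t0' t'0 v_bound
    cd (ltnW LN)) _.
  exact: hC.
- apply: (good_corners_rare e_inj lvS v_max v_gap v_range m_large lv0 p_gt0 p_sum1 pm0 pm_le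
    (ltnW LN) mmL).
  + exact: hta.
  + exact: htG.
have U0 : 0 <= U by rewrite addr_ge0 // mulr_ge0 // exprn_ge0 // ltW.
have wB0 : 0 <= wB by rewrite !mulr_ge0 ?exprn_ge0.
have Y1 : 1 <= r.+1%:R ^+ d :> R by rewrite exprn_ege1 // ler1n.
have dr0 : 0 < d%:R ^+ r :> R by rewrite exprn_gt0 // ltr0n.
apply: (@run_bound_arith _ (r.+1%:R ^+ d) wB d r cd mm a0) => //.
- exact: Pr_ge0.
apply: (run_pieces_rare lvS lv0 p_gt0 p_sum1) => //.
- by rewrite invr_gt0.
- by rewrite invf_le1 // exprn_ege1 // ler1n.
- by rewrite exprn_ege1 //; lra.
- move=> x hx; apply: (untied_run_bound lvS p_gt0 p_sum1) => // y hy.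
  have hs : (cB * (s * G2.+1) < rho)%N by [].
  exact: (unique_allM_bound e_inj lvS v p_gt0 p_sum1 pm0 pm_le k0M hy hs).
exact: leq_ltn_trans mmL LN.
Qed.


Lemma few_max_words_constant : (forall ka kb : K, ka = kb) ->
  forall L, (1 < L)%N -> forall (V : finZmodType) (e : 'I_d -> V) (sigma : {ffun V -> K}),
  2 `^ (2^-1 * L.+1%:R) < (size (max_words e v sigma L))%:R :> R.
Proof.
move=> kk L L1 V e sigma.
have wtE w : wt e v sigma 0 w = \sum_(z <- sites e 0 w) v (sigma 0).
  by apply: eq_bigr => z _; congr v; exact: kk.
have -> : size (max_words e v sigma L) = (d ^ L)%N.
  rewrite -size_words; congr size; apply/all_filterP/allP => w wL; apply/asboolP => q sq.
  by rewrite !wtE !big_const_seq !count_predT !size_sites sq.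
apply: (@lt_le_trans _ _ (2 ^+ L)); last by rewrite -natrX ler_nat leq_exp2r // (ltn_trans _ L1).
rewrite -powR_mulrn // /powR gt_eqF // ltr_expR ltr_pM2r; last by rewrite ln_gt0 // ltr1n.
rewrite mulrC ltr_pdivrMr // -natrM ltr_nat; lia.
Qed.

End FiniteStatement.

(** * The box of the lattice seen by short paths *)

Section Box.
Variables (R : realType) (d n : nat).

(* coordinates are taken modulo [n + 2], which paths with at most [n + 1] steps from the
   origin cannot notice *)
Let V := 'rV['I_n.+2]_d.

Definition unit_step (i : 'I_d) : V := delta_mx 0 i.
Definition box_level (x : V) : nat := (\sum_i x 0 i)%R.
Definition box_site (x : V) : site d := map_mx (fun a : 'I_n.+2 => (a : nat)%:Z) x.

Lemma unit_step_inj : injective unit_step.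
Proof.
move=> i j /rowP /(_ i); rewrite !mxE !eqxx /=; by by case: eqVneq => // _ /eqP.
Qed.

Lemma box_site0 : box_site 0 = 0.
Proof. by apply/rowP => i; rewrite !mxE. Qed.

Lemma box_level0 : box_level 0 = 0%N.
Proof. by rewrite /box_level big1 // => i _; rewrite mxE. Qed.

Lemma box_levelS x i : (box_level x < n.+1)%N ->
  box_level (x + unit_step i) = (box_level x).+1.
Proof.
rewrite /box_level => h.
have -> : \sum_j (x + unit_step i) 0 j = \sum_j x 0 j + 1.
  under eq_bigr => j _ do rewrite mxE.
  rewrite big_split; congr (_ + _); rewrite (bigD1 i) //= mxE !eqxx big1 ?addr0 // => j ji.
  by rewrite mxE (negbTE ji) andbF.
move: (\sum_j x 0 j) h => s h /=.
by rewrite /= !modn_small ?addn1.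
Qed.

Definition small_coords k (x : V) := forall i, (x 0%R i <= k)%N.

Lemma box_site_step k x i : (k <= n)%N -> small_coords k x ->
  box_site (x + unit_step i) = box_site x + delta_mx 0 i /\
  small_coords k.+1 (x + unit_step i).
Proof.
move=> kn hx.
have E j : ((x + unit_step i)%R 0%R j : nat) = (x 0%R j + (j == i))%N.
  rewrite !mxE eqxx /=; case: (j == i) => /=; last first.
    by rewrite addn0 modn_small // mod0n addn0.
  by rewrite !modn_small //; have := hx j; lia.
split; last by move=> j; rewrite E; have := hx j; case: (j == i); lia.
apply/rowP => j; have := E j; rewrite !mxE => ->; rewrite eqxx /= PoszD.
by case: (j == i).
Qed.

Definition lattice_path (x : site d) (w : seq 'I_d) : seq (site d) :=
  scanl (fun y i => y + delta_mx 0 i) x w.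

Lemma lattice_path_box k x w : (k + size w <= n.+1)%N -> small_coords k x ->
  lattice_path (box_site x) w = [seq box_site z | z <- sites unit_step x w].
Proof.
elim: w k x => //= i w IH k x hk hx.
have kn : (k <= n)%N by lia.
have [<- hx'] := box_site_step i kn hx.
by congr (_ :: _); apply: IH hx'; lia.
Qed.

Lemma path_lattice_path x w : path (@step d) x (lattice_path x w).
Proof.
elim: w x => //= i w IH x; rewrite IH andbT; apply/existsP; exists i.
by rewrite addrAC subrr add0r.
Qed.

Lemma lattice_pathP x q : path (@step d) x q -> exists w, q = lattice_path x w.
Proof.
elim: q x => [|y q IH] x /=; first by exists [::].
move=> /andP[/existsP [i /eqP yx] /IH [w ->]]; exists (i :: w).
by rewrite /= -yx addrC subrK.
Qed.

Lemma delta_mx_int_inj (i j : 'I_d) : delta_mx 0 i = delta_mx 0 j :> site d -> i = j.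
Proof. by move/rowP/(_ i); rewrite !mxE !eqxx /=; case: eqVneq. Qed.

Lemma lattice_path_inj x : injective (lattice_path x).
Proof.
move=> w; elim: w x => [|i w IH] x [|j w'] //= [/addrI/delta_mx_int_inj -> h].
by congr (_ :: _); exact: IH h.
Qed.

Lemma paths0P L q : paths0 L.+1 q <-> exists2 w, size w = L & q = 0 :: lattice_path (0 : site d) w.
Proof.
split=> [[sq [z [hq _ pq]]]|[w sw ->]].
  case: q sq hq pq => //= x q [sq] [->] /lattice_pathP [w qE].
  by exists w; rewrite -?qE // -sq qE size_scanl.
split; first by rewrite /= size_scanl sw.
by exists (last 0 (lattice_path 0 w)); split => //; exact: path_lattice_path.
Qed.

Section Configuration.
Variables (K : finType) (v : K -> R) (sigma : {ffun V -> K}) (f : site d -> R).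
Hypothesis f_box : forall y, f (box_site y) = v (sigma y).

Lemma weight_lattice_path w : (size w <= n)%N ->
  weight f (0 :: lattice_path 0 w) = f 0 + wt unit_step v sigma 0 w.
Proof.
move=> wn; rewrite /weight big_cons; congr (_ + _).
rewrite -{1}box_site0 (@lattice_path_box 0) //; first last.
- by move=> i; rewrite mxE.
- by rewrite add0n leqW.
by rewrite big_map; apply: eq_bigr => z _; exact: f_box.
Qed.

Lemma max_words_le L : (L <= n)%N ->
  (size (max_words unit_step v sigma L) <= nb_max_paths f L.+1)%N.
Proof.
move=> Ln; pose h (w : seq 'I_d) := 0 :: lattice_path (0 : site d) w.
rewrite -(size_map h) /nb_max_paths; apply: uniq_leq_size.
  by rewrite map_inj_uniq ?filter_uniq ?uniq_words // => a b [] /lattice_path_inj.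
move=> q /mapP [w]; rewrite mem_filter mem_words => /andP[/asboolP wmax /eqP sw] ->.
rewrite in_fset_set; last exact: finite_max_paths.
rewrite inE; split; first by apply/paths0P; exists w.
move=> q' /paths0P [w' sw' ->].
rewrite !weight_lattice_path ?sw ?sw' // lerD2l.
by apply: wmax; rewrite sw sw'.
Qed.

End Configuration.

Lemma nb_max_paths_box (f f' : site d -> R) L : (L <= n)%N ->
  (forall y, f (box_site y) = f' (box_site y)) ->
  nb_max_paths f L.+1 = nb_max_paths f' L.+1.
Proof.
move=> Ln ff'.
have W q : paths0 L.+1 q -> weight f q = weight f' q.
  move=> /paths0P [w sw ->]; rewrite /weight !big_cons.
  have -> : f 0 = f' 0 by rewrite -box_site0; exact: ff'.
  have -> : lattice_path 0 w = [seq box_site z | z <- sites unit_step 0 w].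
    rewrite -{1}box_site0 (@lattice_path_box 0) ?add0n ?sw ?leqW // => i.
    by rewrite mxE.
  by rewrite !big_map; congr (_ + _); apply: eq_bigr => z _; exact: ff'.
rewrite /nb_max_paths; congr (#|` fset_set _|); apply/seteqP.
split=> q [h1 h2]; split=> // q' hq'; have := h2 q' hq'.
  by rewrite !W.
by rewrite -!W.
Qed.

End Box.

(** * From independent variables to the finite product measure *)

Local Open Scope classical_set_scope.

Section Transfer.
Variables (R : realType) (d n : nat).
Let V := 'rV['I_n.+2]_d.

Definition box_coords (x : site d) : V := \row_i inord `|x 0%R i|%N.

Lemma box_siteK : cancel (@box_site d n) box_coords.
Proof. by move=> y; apply/rowP => i; rewrite !mxE /= inord_val. Qed.

Definition box : {fset site d} := [fset x in [seq @box_site d n y | y <- enum V]]%fset.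

Lemma big_box (T : Type) (idx : T) (op : Monoid.com_law idx) (F : site d -> T) :
  \big[op/idx]_(x <- box) F x = \big[op/idx]_(y : V) F (box_site y).
Proof.
rewrite -big_enum -(big_map (@box_site d n) xpredT F); apply: perm_big; apply: uniq_perm.
- exact: fset_uniq.
- by rewrite map_inj_uniq ?enum_uniq //; exact: can_inj box_siteK.
- by move=> x; rewrite inE.
Qed.

Lemma mem_box (y : V) : box_site y \in box.
Proof. by rewrite !inE; apply: map_f; rewrite mem_enum. Qed.

Lemma measure_bigU_le (disp : measure_display) (T : measurableType disp)
    (m : probability T R) (I : Type) (r : seq I) (Q : pred I) (F : I -> set T) :
  (forall i, measurable (F i)) ->
  (m (\big[setU/set0]_(i <- r | Q i) F i) <= \sum_(i <- r | Q i) m (F i))%E.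
Proof.
move=> mF; elim: r => [|i r IH]; first by rewrite !big_nil measure0.
rewrite !big_cons; case: ifP => // _.
apply: le_trans (measureU2 _ _ _) _ => //; first by apply: bigsetU_measurable.
by rewrite leeD2l.
Qed.

Section Law.
Variables (disp : measure_display) (T : measurableType disp) (P : probability T R).
Variables (omega : site d -> {RV P >-> R}) (mu : probability (measurableTypeR R) R).
Hypothesis omega_iid : iid omega mu.

Lemma law_preimage x (A : set R) : measurable A -> P (omega x @^-1` A) = mu A.
Proof. by move=> mA; case: omega_iid => _ /(_ x A mA). Qed.

Definition cylinder (F : {fset R}) (sigma : {ffun V -> F}) : set T :=
  \bigcap_(x in [set` box]) (omega x @^-1` [set val (sigma (box_coords x))]).

Lemma cylinderP (F : {fset R}) (sigma : {ffun V -> F}) t :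
  cylinder sigma t <-> forall y : V, omega (box_site y) t = val (sigma y).
Proof.
split=> [h y|h x /=].
  by have := h _ (mem_box y); rewrite /= box_siteK.
rewrite !inE => /mapP [y _ ->]; by rewrite box_siteK.
Qed.

Lemma measurable_cylinder (F : {fset R}) (sigma : {ffun V -> F}) : measurable (cylinder sigma).
Proof.
apply: fin_bigcap_measurable; first exact: finite_fset.
move=> x _; rewrite -[X in measurable X]setTI.
by apply: measurable_funP => //; exact: measurable_set1.
Qed.

Lemma P_cylinder (F : {fset R}) (sigma : {ffun V -> F}) :
  P (cylinder sigma) = (\prod_y mu [set val (sigma y)])%E.
Proof.
have [ind _] := omega_iid.
rewrite /cylinder (ind box (fun x => [set val (sigma (box_coords x))])); last first.
  by move=> x; exact: measurable_set1.
rewrite big_box; apply: eq_bigr => y _; rewrite box_siteK law_preimage //.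
Qed.

End Law.
End Transfer.

Section Atoms.
Variables (R : realType) (Theta : set R) (mu : probability (measurableTypeR R) R).
Hypothesis Theta_finite : finite_set Theta.
Hypothesis mu_Theta : mu Theta = 1%E.

(** The values of probability zero are discarded, since the modifications need a
    positive lower bound on the probabilities of the values. *)
Definition atoms : {fset R} := [fset x in fset_set Theta | (0 < mu [set x])%E]%fset.
Definition atom_mass (k : atoms) : R := fine (mu [set val k]).

Lemma measurable_fset (F : {fset R}) : measurable ([set` F] : set (measurableTypeR R)).
Proof.
have -> : [set` F] = \bigcup_(x in [set` F]) [set x].
  by apply/seteqP; split => [x Fx|x [y Fy /= ->]] //; exists x.
by apply: fin_bigcup_measurable => [|x _]; [exact: finite_fset | exact: measurable_set1].
Qed.

Lemma mu_fset (F : {fset R}) : mu [set` F] = (\sum_(x <- F) mu [set x])%E.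
Proof.
have {1}-> : [set` F] = \bigcup_(x in [set` F]) [set x].
  by apply/seteqP; split => [x Fx|x [y Fy /= ->]] //; exists x.
rewrite measure_fin_bigcup //.
- by rewrite fsbig_finite //= set_fsetK.
- by move=> x y _ _ [z [-> ->]].
Qed.

Lemma atom_mass_gt0 k : 0 < atom_mass k.
Proof.
have := valP k; rewrite !inE /= => /andP[_ h].
by rewrite /atom_mass fine_gt0 // h /= (le_lt_trans (probability_le1 mu _)) // ltry.
Qed.

Lemma mu_atom k : mu [set val k] = (atom_mass k)%:E.
Proof. by rewrite /atom_mass fineK // fin_num_measure. Qed.

Lemma mu_atoms : mu [set` atoms] = 1%E.
Proof.
rewrite mu_fset /atoms -big_fset_condE -mu_Theta -[X in _ = mu X](fset_setK Theta_finite) mu_fset.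
rewrite [RHS](bigID (fun x => (0 < mu [set x])%E)) /= [X in (_ + X)%E]big1 ?adde0 // => x.
by rewrite -leNgt => h; apply/eqP; rewrite eq_le h measure_ge0.
Qed.

Lemma atom_mass_sum : \sum_k atom_mass k = 1.
Proof.
apply: EFin_inj; rewrite -mu_atoms mu_fset big_seq_fsetE -sumEFin.
by apply: eq_bigr => k _; rewrite mu_atom.
Qed.

End Atoms.

Section TransferBound.
Variables (R : realType) (d L : nat).
Variables (Theta : set R) (mu : probability (measurableTypeR R) R).
Hypothesis Theta_finite : finite_set Theta.
Hypothesis mu_Theta : mu Theta = 1%E.
Variables (disp : measure_display) (T : measurableType disp) (P : probability T R).
Variables (omega : site d -> {RV P >-> R}).
Hypothesis omega_Theta : forall x t, Theta (omega x t).
Hypothesis omega_iid : iid omega mu.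
Let V := 'rV['I_L.+2]_d.

Let few (c : R) : set T := [set t | (nb_max_paths (fun x => omega x t) L.+1)%:R <= c].

(** The event only depends on the values in the box, which range over a finite set: it
    is a finite union of cylinders. *)
Lemma measurable_few c : measurable (few c).
Proof.
pose C (tau : {ffun V -> fset_set Theta}) : set T := cylinder omega tau.
pose good tau := `[< exists2 t, C tau t & few c t >].
have -> : few c = \big[setU/set0]_(tau | good tau) C tau.
  apply/seteqP; split=> [t ft|t].
    have h y : omega (@box_site d L y) t \in fset_set Theta.
      by rewrite in_fset_set // inE; exact: omega_Theta.
    pose tau : {ffun V -> fset_set Theta} := [ffun y => [` h y]%fset].
    have Ct : C tau t by apply/cylinderP => y; rewrite ffunE.
    rewrite (bigD1 tau) /=; first by left.
    by apply/asboolP; exists t.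
  apply: (big_ind (fun S : set T => S t -> few c t)) => [//|A B hA hB [/hA|/hB] //|tau].
  move=> /asboolP [t' /cylinderP Ct' ft'] /cylinderP Ct.
  rewrite /few /= (@nb_max_paths_box R d L _ (fun x => omega x t') L) //.
  by move=> y; rewrite Ct Ct'.
by apply: bigsetU_measurable => tau _; exact: measurable_cylinder.
Qed.

(** Up to the null event that some site of the box takes a value of probability zero,
    the event is covered by cylinders over the atoms, whose probabilities are the
    masses of the finite product measure. *)
Lemma few_max_paths_le c :
  (P (few c) <= (Pr (@atom_mass R Theta mu) (fun sigma : {ffun V -> atoms Theta mu} =>
     (size (max_words (@unit_step d L) val sigma L))%:R <= c))%:E)%E.
Proof.
pose bad (sigma : {ffun V -> atoms Theta mu}) :=
  (size (max_words (@unit_step d L) val sigma L))%:R <= c.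
pose null (y : V) : set T := omega (box_site y) @^-1` (~` [set` atoms Theta mu]).
have mnull0 : measurable (~` [set` atoms Theta mu] : set (measurableTypeR R)).
  by apply: measurableC; exact: measurable_fset.
have mnull y : measurable (null y).
  rewrite -[X in measurable X]setTI.
  by apply: measurable_funP => //; exact: mnull0.
have Pnull y : P (null y) = 0%E.
  rewrite (law_preimage omega_iid) // probability_setC; last exact: measurable_fset.
  by rewrite mu_atoms // subee.
pose U1 : set T := \big[setU/set0]_(sigma | bad sigma) cylinder omega sigma.
pose U2 : set T := \big[setU/set0]_(y : V) null y.
have mU1 : measurable U1.
  by apply: bigsetU_measurable => sigma _; exact: measurable_cylinder.
have mU2 : measurable U2 by apply: bigsetU_measurable.
have cover : few c `<=` U1 `|` U2.
  move=> t ft; have [[y nt]|ht] := pselect (exists y : V, null y t).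
    by right; rewrite /U2 (bigD1 y) //=; left.
  have h y : omega (@box_site d L y) t \in atoms Theta mu.
    by apply: contrapT => ny; apply: ht; exists y.
  left; pose sigma : {ffun V -> atoms Theta mu} := [ffun y => [` h y]%fset].
  have sE y : omega (@box_site d L y) t = val (sigma y) by rewrite ffunE.
  rewrite /U1 (bigD1 sigma) /=; first by left; apply/cylinderP.
  apply: le_trans ft; rewrite ler_nat.
  exact: (@max_words_le R d L (atoms Theta mu) val sigma (fun x => omega x t) sE L).
apply: le_trans (le_measure P _ _ cover) _; rewrite ?inE //.
- exact: measurable_few.
- exact: measurableU.
apply: le_trans (measureU2 _ mU1 mU2) _.
rewrite -[leRHS]adde0; apply: leeD; last first.
  by apply: le_trans (measure_bigU_le _ _ _ mnull) _; rewrite big1.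
apply: le_trans (measure_bigU_le _ _ _ (measurable_cylinder omega (F := atoms Theta mu))) _.
rewrite /Pr /Ex -sumEFin big_mkcond /=; apply: lee_sum => sigma _.
case: ifP => hb; last first.
  by rewrite lee_fin mulr_ge0 ?ler0n // ltW // mass_gt0 // => k; exact: atom_mass_gt0.
rewrite asboolT // mulr1 (P_cylinder omega_iid) /mass -prodEFin.
by rewrite le_eqVlt; apply/orP; left; apply/eqP; apply: eq_bigr => y _; rewrite mu_atom.
Qed.

End TransferBound.

Theorem theorem1 (R : realType) (d : nat) (hd : (2 <= d)%N)
    (Theta : set R) (hTheta : finite_set Theta)
    (mu : probability (measurableTypeR R) R) :
  exists2 delta : R, 0 < delta &
    \forall n \near \oo,
      forall (disp : measure_display) (T : measurableType disp)
        (P : probability T R) (omega : site d -> {RV P >-> R}),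
        (forall x t, Theta (omega x t)) ->
        iid omega mu ->
        (P [set t | ((nb_max_paths (fun x => omega x t) n)%:R
                      <= 2 `^ (delta * n%:R))%R]
           <= (expR (- (delta * n%:R)))%:E)%E.
Proof.
(* otherwise no variable with values in [Theta] has the law [mu] *)
have [mT|mT] := pselect (mu Theta = 1%E); last first.
  exists 1 => //; exists 0%N => // n _ disp T P omega oT [_ law]; case: mT.
  have mTheta : measurable (Theta : set (measurableTypeR R)).
    by rewrite -(fset_setK hTheta); exact: measurable_fset.
  rewrite -(law 0 Theta mTheta) /distribution /= /pushforward -(probability_setT P).
  by congr (P _); apply/seteqP; split => // t _ /=; exact: oT.
have p_gt0 := @atom_mass_gt0 R Theta mu.
have p_sum1 := atom_mass_sum hTheta mT.
(* a degenerate law makes all the [d ^ L] paths maximal, and [delta = 1 / 2] works because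
   [d ^ L >= 2 ^ L > 2 ^ ((L + 1) / 2)] once [L + 1 >= 3] *)
have [[ka [kb kab]]|none] := pselect (exists ka kb : atoms Theta mu, ka != kb); last first.
  exists 2^-1 => //; exists 3%N => // -[//|L] /= L3 disp T P omega oT oiid.
  apply: le_trans (few_max_paths_le L hTheta mT oT oiid _) _.
  rewrite lee_fin; apply: le_trans (expR_ge0 _).
  rewrite /Pr /Ex big1 // => sigma _; rewrite asboolF ?mulr0 //; apply/negP.
  rewrite -ltNge; apply: few_max_words_constant => // ka kb.
  by apply: contrapT => kab; apply: none; exists ka, kb; apply/eqP.
have [delta d0 [L0 hL0]] := few_max_words_rare hd p_gt0 p_sum1 val_inj kab.
exists delta => //; exists L0.+1 => // -[//|L] /= LL0 disp T P omega oT oiid.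
apply: le_trans (few_max_paths_le L hTheta mT oT oiid _) _.
rewrite lee_fin; apply: (hL0 L LL0 _ _ (@box_level d L) L.+1) => //.
- exact: unit_step_inj.
- exact: box_levelS.
- exact: box_level0.
Qed.
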